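(* All the choices of $p_r$, $p_{ra}$, $p$, $p_a$, $i$ and $i_a$ together generate four types of Khovanov homology for long virtual knots: among the maps $p_r$, $p_{ra}$, $i\circ p$, $i\circ p_a$, $i_a\circ p$, $i_a\circ p_a$ from based Gauss diagrams to sign-labelled chord diagrams there are exactly four different ones, $p_r$, $p_{ra}$, $i\circ p=i_a\circ p_a$ and $i_a\circ p=i\circ p_a$, and the corresponding four bigraded homologies $KH^{i,j}(p_r(D))$, $KH^{i,j}(p_{ra}(D))$, $KH^{i,j}(i\circ p(D))$, $KH^{i,j}(i_a\circ p(D))$ of a diagram $D$ are, up to isomorphism, invariants of the long virtual knot represented by $D$. Moreover, the tuple of these four Khovanov homologies is a stronger invariant of long virtual knots than the Khovanov homology $KH^{i,j}$: there exist long virtual knots $K_1,K_2$ with $KH^{i,j}(K_1)\simeq KH^{i,j}(K_2)$ for all $(i,j)$ whose tuples of four bigraded homologies are not isomorphic entry by entry.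
   Context: All knots are oriented. A long virtual knot diagram is a generic immersion of the oriented line in the plane (standard outside a compact set; equivalently an oriented circle with a base point away from the double points), with finitely many transversal double points, each declared either a real crossing (with over/under information) or a virtual crossing. A long virtual knot is a class of such diagrams modulo planar isotopy, Reidemeister moves and virtual moves performed away from the base point. Closing the line (forgetting the base point) gives a virtual knot. The Gauss diagram of a (long) virtual knot diagram is the counterclockwise oriented circle (with base point in the long case) with one chord joining the two preimages of each real crossing; each chord carries the sign (local writhe) of the crossing and an arrow from the over-branch to the under-branch; virtual crossings are ignored. Gauss diagrams are considered up to orientation (and base point) preserving homeomorphism. A Gauss diagram determines a virtual diagram up to virtual moves, and long virtual knots are the same as based Gauss diagrams modulo the Gauss-diagram versions of the Reidemeister moves performed away from the base point. A diagram is identified with its based Gauss diagram. Map $p_r$: forgets the arrows of a Gauss diagram and keeps the signs of chords. Map $p_{ra}=\tau_1\circ p_r$, where $\tau_1$ exchanges $+$ and $-$ on all chords. Map $p$: for a based Gauss diagram $G$, call the first endpoint of a chord the endpoint met first when travelling along the oriented circle from the base point. The diagram $p(G)$ is the based circle with the same chords, with signs and arrows removed, where each chord is labelled $a$ if either (its sign is $+$ and its arrow points from the first endpoint to the second) or (its sign is $-$ and its arrow points from the second endpoint to the first), and is labelled $b$ otherwise. Map $p_a=\tau_0\circ p$, where $\tau_0$ exchanges $a$ and $b$ on all chords. Map $i$ (not to be confused with the homological index $i$): for a based chord diagram with chords labelled $a$ or $b$, $i$ replaces each label $a$ by the sign $+$ and each label $b$ by the sign $-$, giving a based chord diagram whose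 chords carry signs but no arrows. Map $i_a=\tau_1\circ i$. Khovanov homology (Manturov, coefficients $\mathbb{Z}_2$): let $D$ be a virtual knot diagram with writhe $w(D)$ (number of positive minus number of negative real crossings). A state assigns a positive or negative marker to every real crossing and smooths accordingly; the positive marker is the Kauffman $A$-smoothing (so the orientation-respecting smoothing is the one given by the positive marker at a positive crossing and by the negative marker at a negative crossing). An enhanced state $S$ is a state with a label $1$ or $x$ on each circle, where $\deg(1)=1$, $\deg(x)=-1$. Let $\sigma(S)$ be the number of positive minus the number of negative markers, $\tau(S)$ the sum of degrees of labels, $i(S)=(w(D)-\sigma(S))/2$ and $j(S)=w(D)+i(S)+\tau(S)$. $C^{i,j}(D)$ is the $\mathbb{Z}_2$-vector space with basis the enhanced states with $i(S)=i$, $j(S)=j$. The differential $d:C^{i,j}(D)\to C^{i+1,j}(D)$ is $d(S)=\sum_T (S:T)\,T$, a sum over changes of one positive marker to a negative one: if two circles merge, labels change by $m(1\otimes 1)=1$, $m(1\otimes x)=m(x\otimes 1)=x$, $m(x\otimes x)=0$; if one circle splits into two, by $\Delta(1)=1\otimes x+x\otimes 1$, $\Delta(x)=x\otimes x$; if the number of circles does not change, the contribution is zero; labels of other circles are unchanged. $KH^{i,j}(D)$ is the resulting homology, an invariant of virtual knots. For a long virtual knot $K$, $KH^{i,j}(K)$ is that of the virtual knot obtained by forgetting the base point. For a chord diagram $P$ with signs but no arrows, $KH^{i,j}(P)$ is $KH^{i,j}$ of any Gauss diagram obtained from $P$ by choosing arrows (and forgetting any base point); by a theorem of Manturov this does not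 depend on the choice. *)

(* Defs.v *)
From HB Require Import structures.
From Stdlib Require Import Relation_Operators.
From mathcomp Require Import all_boot all_order all_algebra.

Set Implicit Arguments.
Unset Strict Implicit.
Unset Printing Implicit Defensive.

Import GRing.Theory.
Local Open Scope ring_scope.

(* A based circle with chords is read from the base point along the
   orientation: it is the word of the chord endpoints met.  Chords are named by
   natural numbers, and each endpoint carries a decoration.  Words that differ
   by an injective renaming of the chords are the same diagram up to a
   homeomorphism preserving orientation and base point. *)

Definition two_ended (A : Type) (w : seq (nat * A)) : bool :=
  all (fun c => count_mem c (unzip1 w) == 2%N) (unzip1 w).

Definition constant_on_chords (A : Type) (B : eqType) (f : A -> B)
    (w : seq (nat * A)) : bool :=
  all (fun l => all (fun l' => (l.1 == l'.1) ==> (f l.2 == f l'.2)) w) w.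

Definition renaming (A : Type) (w w' : seq (nat * A)) : Prop :=
  exists2 f : nat -> nat, injective f & w' = [seq (f l.1, l.2) | l <- w].

(* Signs are booleans: [true] is +, [false] is -. *)
Definition sign := bool.

(* The decoration of an endpoint of a Gauss diagram is [(o, s)], where [o] tells
   whether the endpoint lies on the over-branch (so that the arrow starts
   there) and [s] is the sign of the chord. *)
Notation gauss_word := (seq (nat * (bool * sign))).

Definition gauss_ok (w : gauss_word) : bool :=
  [&& two_ended w, constant_on_chords snd w & uniq [seq (l.1, l.2.1) | l <- w]].

Record gauss_diagram := GaussDiagram {
  gd_word :> gauss_word;
  gd_ok : gauss_ok gd_word
}.

Definition cd_ok (A : eqType) (w : seq (nat * A)) : bool :=
  two_ended w && constant_on_chords id w.

(* No arrows: both endpoints of a chord carry the decoration of the chord. *)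
Record chord_diagram (A : eqType) := ChordDiagram {
  cd_word :> seq (nat * A);
  cd_wordP : cd_ok cd_word
}.

Inductive ab_label := LabelA | LabelB.

Definition is_a (x : ab_label) : bool := if x is LabelA then true else false.
Definition ab_of_bool (b : bool) : ab_label := if b then LabelA else LabelB.
Fact is_aK : cancel is_a ab_of_bool. Proof. by case. Qed.
HB.instance Definition _ := Equality.copy ab_label (can_type is_aK).


Notation signed_diagram := (chord_diagram (sign : eqType)).
Notation ab_diagram := (chord_diagram (ab_label : eqType)).

Fact cd_map_ok (A B : eqType) (g : A -> B) (P : chord_diagram A) :
  cd_ok [seq (l.1, g l.2) | l <- P].
Proof.
case: P => w /= /andP[w2 wc]; apply/andP; split.
  by rewrite /two_ended /unzip1 -map_comp.
rewrite /constant_on_chords all_map; apply: sub_all wc => l /= wl.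
by rewrite all_map; apply: sub_all wl => l' /= /implyP wl'; apply/implyP => /wl' /eqP ->.
Qed.

Definition cd_map (A B : eqType) (g : A -> B) (P : chord_diagram A) :
  chord_diagram B := ChordDiagram (cd_map_ok g P).

Fact gd_forget_ok (B : eqType) (f : nat -> B) (D : gauss_diagram) :
  cd_ok [seq (l.1, f l.1) | l <- D].
Proof.
case: D => w /= /and3P[w2 _ _]; apply/andP; split.
  by rewrite /two_ended /unzip1 -map_comp.
rewrite /constant_on_chords all_map; apply/allP => l _ /=.
by rewrite all_map; apply/allP => l' _ /=; apply/implyP => /eqP ->.
Qed.

(* [D] with signs and arrows removed and each chord [c] decorated by [f c]. *)
Definition gd_forget (B : eqType) (f : nat -> B) (D : gauss_diagram) :
  chord_diagram B := ChordDiagram (gd_forget_ok f D).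

Definition first_end (D : gauss_diagram) (c : nat) : nat * (bool * sign) :=
  nth (c, (true, true)) D (index c (unzip1 D)).
Definition gd_sign (D : gauss_diagram) (c : nat) : sign := (first_end D c).2.2.
(* The arrow of [c] points from its first endpoint to its second one. *)
Definition arrow_forward (D : gauss_diagram) (c : nat) : bool :=
  (first_end D c).2.1.

Definition tau1 : signed_diagram -> signed_diagram := cd_map negb.
Definition tau0 : ab_diagram -> ab_diagram :=
  cd_map (fun x => if x is LabelA then LabelB else LabelA).

Definition map_pr (D : gauss_diagram) : signed_diagram :=
  gd_forget (gd_sign D) D.
Definition map_pra : gauss_diagram -> signed_diagram := tau1 \o map_pr.

Definition map_p (D : gauss_diagram) : ab_diagram :=
  gd_forget (fun c =>
    if (gd_sign D c && arrow_forward D c) || (~~ gd_sign D c && ~~ arrow_forward D c)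
    then LabelA else LabelB) D.
Definition map_pa : gauss_diagram -> ab_diagram := tau0 \o map_p.

Definition map_i : ab_diagram -> signed_diagram :=
  cd_map (fun x => if x is LabelA then true else false).
Definition map_ia : ab_diagram -> signed_diagram := tau1 \o map_i.

(* Equality of maps, diagrams being considered up to homeomorphism. *)
Definition same_map (F G : gauss_diagram -> signed_diagram) : Prop :=
  forall D, renaming (F D) (G D).

(* Reidemeister moves on Gauss diagrams.  The words are not cyclic, so no move
   crosses the base point.  A valid second move involves two crossings of
   opposite signs, one strand passing over the other twice. *)

Definition r2_over (c d : nat) (s : sign) : gauss_word :=
  [:: (c, (true, s)); (d, (true, ~~ s))].
Definition r2_under (c d : nat) (s : sign) : gauss_word :=
  [:: (c, (false, s)); (d, (false, ~~ s))].

(* In the third move, let [t], [m], [b] be the directions of the top, middle and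
   bottom strands.  The signs [etm], [etb], [emb] of the three crossings are
   those of det(t,m), det(t,b), det(m,b), and may be arbitrary.  On one side of
   the move, a computation with three straight lines gives the orders: on top,
   [tm] before [tb] iff [etb] is +; in the middle, [tm] before [mb] iff [emb]
   is +; at the bottom, [tb] before [mb] iff the product of the three signs
   (a [(+)] of booleans) is +.  On the other side all three orders are
   reversed. *)
Definition ordered (b : bool) (w : gauss_word) : gauss_word :=
  if b then w else rev w.
Definition r3_top (tm tb : nat) (etm etb : sign) : gauss_word :=
  ordered etb [:: (tm, (true, etm)); (tb, (true, etb))].
Definition r3_middle (tm mb : nat) (etm emb : sign) : gauss_word :=
  ordered emb [:: (tm, (false, etm)); (mb, (true, emb))].
Definition r3_bottom (tb mb : nat) (etm etb emb : sign) : gauss_word :=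
  ordered (etm (+) etb (+) emb) [:: (tb, (false, etb)); (mb, (false, emb))].

(* The [perm_eq] premises let the strands occur in any order along the line. *)
Inductive reidemeister : gauss_word -> gauss_word -> Prop :=
| Reidemeister1 w1 w2 c o s :
    reidemeister (w1 ++ w2) (w1 ++ [:: (c, (o, s)); (c, (~~ o, s))] ++ w2)
| Reidemeister2_parallel w1 w2 w3 c d s A B :
    perm_eq [:: A; B] [:: r2_over c d s; r2_under c d s] ->
    reidemeister (w1 ++ w2 ++ w3) (w1 ++ A ++ w2 ++ B ++ w3)
| Reidemeister2_antiparallel w1 w2 w3 c d s A B :
    perm_eq [:: A; B] [:: r2_over c d s; rev (r2_under c d s)] ->
    reidemeister (w1 ++ w2 ++ w3) (w1 ++ A ++ w2 ++ B ++ w3)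
| Reidemeister3 w1 w2 w3 w4 tm tb mb etm etb emb A B C :
    perm_eq [:: A; B; C]
      [:: r3_top tm tb etm etb; r3_middle tm mb etm emb;
          r3_bottom tb mb etm etb emb] ->
    reidemeister (w1 ++ A ++ w2 ++ B ++ w3 ++ C ++ w4)
      (w1 ++ rev A ++ w2 ++ rev B ++ w3 ++ rev C ++ w4).

Definition long_equiv : gauss_diagram -> gauss_diagram -> Prop :=
  clos_refl_sym_trans gauss_diagram
    (fun D D' => renaming D D' \/ reidemeister D D').

Section QuotientSpace.
Local Open Scope quotient_scope.
Variables (K : fieldType) (V : vectType K) (U : {vspace V}).

Definition vquot : Type := Quotient.quot (pred_of_vspace U : zmodClosed V).
HB.instance Definition _ := GRing.Zmodule.on vquot.
HB.instance Definition _ := EqQuotient.on vquot.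

Definition vquot_scale (a : K) (x : vquot) : vquot := \pi_vquot (a *: repr x).

Fact vquot_piE (x y : V) : (\pi_vquot x = \pi_vquot y) <-> (x - y \in U).
Proof.
have -> : (x - y \in U) = (\pi_vquot x == \pi_vquot y) by exact: Quotient.idealrBE.
by split=> [->|/eqP].
Qed.

Fact vquot_piD (x y : V) : \pi_vquot (x + y) = \pi_vquot x + \pi_vquot y.
Proof. by rewrite Quotient.pi_add. Qed.

Fact vquot_pi_scale a (x : V) : vquot_scale a (\pi_vquot x) = \pi_vquot (a *: x).
Proof.
apply/vquot_piE; rewrite -scalerBr; apply: memvZ.
by apply/vquot_piE; rewrite reprK.
Qed.

Fact vquot_scaleA a b x : vquot_scale a (vquot_scale b x) = vquot_scale (a * b) x.
Proof.
by rewrite -[x]reprK (vquot_pi_scale b) (vquot_pi_scale a) vquot_pi_scale scalerA.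
Qed.
Fact vquot_scale1 : left_id 1 vquot_scale.
Proof. by move=> x; rewrite -[x]reprK vquot_pi_scale scale1r. Qed.
Fact vquot_scaleDr : right_distributive vquot_scale +%R.
Proof.
move=> a x y; rewrite -[x]reprK -[y]reprK -vquot_piD !(vquot_pi_scale a) -vquot_piD.
by rewrite scalerDr.
Qed.
Fact vquot_scaleDl x : {morph vquot_scale^~ x : a b / a + b}.
Proof.
move=> a b; rewrite -[x]reprK (vquot_pi_scale (a + b)) (vquot_pi_scale a).
by rewrite (vquot_pi_scale b) -vquot_piD scalerDl.
Qed.

HB.instance Definition _ := GRing.Zmodule_isLmodule.Build K vquot
  vquot_scaleA vquot_scale1 vquot_scaleDr vquot_scaleDl.

End QuotientSpace.

(* [Z / (Z :&: B)] *)
Definition subquotient (K : fieldType) (V : vectType K) (Z B : {vspace V}) :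
    lmodType K :=
  vquot (linfun (vsval : subvs_of Z -> V) @^-1: B)%VS.

Definition lmod_iso (K : fieldType) (U V : lmodType K) : Prop :=
  exists f : {linear U -> V}, bijective f.

(* Only the signs and the positions of the chords enter the complex, so it is
   built from the word of a signed diagram. *)

Section Khovanov.
Variable w : seq (nat * sign).

(* The endpoints cut the line into arcs: the [k]-th endpoint separates the arcs
   [k] and [k.+1].  Arcs [0] and [size w] meet at the base point. *)
Definition arc := 'I_(size w).+1.
Definition chord := seq_sub (unzip1 w).
Definition endpoint (c : chord) (k : 'I_(size w)) : bool :=
  nth 0%N (unzip1 w) k == ssval c.
Definition csign (c : chord) : sign := (ssval c, true) \in w.

(* [true] is the positive marker. *)
Definition state := {ffun chord -> bool}.

(* Arcs glued at the base point (forgetting it) or by the smoothing of a chord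
   with endpoints [k] and [l]: the smoothing respecting the orientation glues
   the arc entering [k] to the arc leaving [l]; the other one glues the two
   entering arcs together and the two leaving arcs together. *)
Definition glued (s : state) (x y : arc) : bool :=
  ((x == 0%N :> nat) && (y == size w :> nat)) ||
  [exists c : chord, exists k : 'I_(size w), exists l : 'I_(size w),
    [&& k != l, endpoint c k, endpoint c l &
      if s c == csign c then (x == k :> nat) && (y == l.+1 :> nat)
      else ((x == k :> nat) && (y == l :> nat))
           || ((x == k.+1 :> nat) && (y == l.+1 :> nat))]].

Definition same_circle (s : state) : rel arc :=
  connect [rel x y | glued s x y || glued s y x].

Definition circles (s : state) : {set {set arc}} :=
  [set [set y | same_circle s x y] | x : arc].

(* A labelling of the circles is a labelling of the arcs, constant on each
   circle; [true] is the label [1] and [false] is the label [x]. *)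
Definition enhanced_state :=
  {S : state * {ffun arc -> bool} |
    [forall x, forall y, same_circle S.1 x y ==> (S.2 x == S.2 y)]}.

Definition markers (S : enhanced_state) : state := (val S).1.
Definition labels (S : enhanced_state) : {ffun arc -> bool} := (val S).2.

Definition pm (b : bool) : int := if b then 1 else -1.

Definition writhe : int := \sum_(c : chord) pm (csign c).
Definition sigma (S : enhanced_state) : int := \sum_(c : chord) pm (markers S c).
Definition tau (S : enhanced_state) : int :=
  \sum_(C in circles (markers S)) pm [exists x in C, labels S x].
(* The difference is even, so the division is exact. *)
Definition hdeg (S : enhanced_state) : int := ((writhe - sigma S) %/ 2)%Z.
Definition qdeg (S : enhanced_state) : int := writhe + hdeg S + tau S.

(* Coefficients of [z] in [m (u (x) v)] and of [u (x) v] in [Delta z]. *)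
Definition m_coef (u v z : bool) : bool :=
  match u, v with
  | true, true => z
  | true, false | false, true => ~~ z
  | false, false => false
  end.
Definition Delta_coef (z u v : bool) : bool :=
  if z then u (+) v else ~~ u && ~~ v.

(* For either smoothing of [c], one of its two local branches contains the arc
   entering the first endpoint of [c], and the other branch contains the arc
   leaving that endpoint. *)
Definition arc_in (c : chord) : arc := inord (index (ssval c) (unzip1 w)).
Definition arc_out (c : chord) : arc := inord (index (ssval c) (unzip1 w)).+1.

(* The coefficient [(S : T)] for the change of marker at [c]. *)
Definition incident_at (c : chord) (S T : enhanced_state) : bool :=
  let x := arc_in c in let y := arc_out c in
  [&& markers S c,
      markers T == [ffun e => (e != c) && markers S e],
      [forall z, ~~ same_circle (markers S) z x && ~~ same_circle (markers S) z y
                 ==> (labels T z == labels S z)] &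
      match same_circle (markers S) x y, same_circle (markers T) x y with
      | false, true => m_coef (labels S x) (labels S y) (labels T x)
      | true, false => Delta_coef (labels S x) (labels T x) (labels T y)
      | _, _ => false
      end].

Definition chains := {ffun enhanced_state -> ('F_2 : fieldType)^o}.

Definition basis_chain (S : enhanced_state) : chains := [ffun T => (T == S)%:R].

Definition chains_deg (i j : int) : {vspace chains} :=
  <<[seq basis_chain T | T in [pred T : enhanced_state | (hdeg T == i) && (qdeg T == j)]]>>%VS.

Definition diff (x : chains) : chains :=
  [ffun T => \sum_(S : enhanced_state) \sum_(c : chord)
               (incident_at c S T)%:R * x S].

Fact diff_is_linear : linear diff.
Proof.
move=> a x y; apply/ffunP => T; rewrite !ffunE scaler_sumr -big_split /=.
apply: eq_bigr => S _; rewrite scaler_sumr -big_split /=.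
by apply: eq_bigr => c _; rewrite !ffunE mulrDr /GRing.scale /= mulrCA.
Qed.
HB.instance Definition _ := GRing.isLinear.Build 'F_2 chains chains _ diff diff_is_linear.

Definition KH_word (i j : int) : lmodType 'F_2 :=
  subquotient (lker (linfun diff) :&: chains_deg i j)%VS
              (linfun diff @: chains_deg (i - 1) j)%VS.

End Khovanov.

Definition KH (P : signed_diagram) (i j : int) : lmodType 'F_2 := KH_word P i j.

(* The homology of a Gauss diagram (and of the long virtual knot it represents,
   forgetting the base point) sees only the signs of its chords; so [KH P] is
   the homology of every Gauss diagram obtained from [P] by choosing arrows. *)
Definition KH_gauss (D : gauss_diagram) (i j : int) : lmodType 'F_2 :=
  KH_word [seq (l.1, l.2.2) | l <- D] i j.

Fact map_pr_word (D : gauss_diagram) :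
  cd_word (map_pr D) = [seq (l.1, l.2.2) | l <- D].
Proof.
rewrite /map_pr /=; apply/eq_in_map => l lD; congr (_, _); rewrite /gd_sign.
case: D lD => w /= wok lw; rewrite /first_end /=.
have lw1 : (index l.1 (unzip1 w) < size w)%N.
  by rewrite -(size_map fst) index_mem map_f.
have /and3P[_ /allP wc _] := wok.
have /allP/(_ l lw)/implyP := wc _ (mem_nth (l.1, (true, true)) lw1).
rewrite -(nth_map _ 0%N fst lw1) nth_index ?map_f // => /(_ (eqxx _)) /eqP.
by [].
Qed.

Fact KH_arrows (P : signed_diagram) (D : gauss_diagram) (i j : int) :
  cd_word (map_pr D) = P -> KH_gauss D i j = KH P i j.
Proof. by rewrite map_pr_word /KH_gauss /KH => ->. Qed.

Definition KH_iso (P Q : signed_diagram) : Prop :=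
  forall i j : int, lmod_iso (KH P i j) (KH Q i j).

Definition KH_gauss_iso (D D' : gauss_diagram) : Prop :=
  forall i j : int, lmod_iso (KH_gauss D i j) (KH_gauss D' i j).

(* Entry by entry isomorphism of the tuples of four homologies. *)
Definition KH4_iso (D D' : gauss_diagram) : Prop :=
  [/\ KH_iso (map_pr D) (map_pr D'),
      KH_iso (map_pra D) (map_pra D'),
      KH_iso ((map_i \o map_p) D) ((map_i \o map_p) D') &
      KH_iso ((map_ia \o map_p) D) ((map_ia \o map_p) D')].

(* Main.v *)
(* The four maps replace the sign [s] of a chord by [s (+) phi o], where [o] tells
   whether the chord starts on the over-branch and [phi : bool -> bool] is arbitrary.
   So it is enough to see that, for every [phi], the homology of the signed word
   does not change when the Gauss word undergoes a Reidemeister move.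

   The first and the second moves are Gaussian elimination of a contractible
   summand, as in the planar case: the differentials that vanish because they keep
   the number of circles do not occur between the states to be cancelled. For the
   third move the signs enter only through the marker of each crossing that cuts off
   the central triangle. For an arbitrary [phi] the signs need not come from a planar
   picture, but these three markers are never all equal, because the order of the
   three strands along the line is transitive. Up to a mirror image and a permutation
   of the strands this leaves one local picture, and its two sides reduce by Gaussian
   elimination to the same complex.

   Two linked positive chords give a nonzero class in degree [2]; after reversing
   the arrow of one of them, [i p] produces a word with one negative chord, which
   has no state in degree [2], although the signs of the two diagrams agree. *)

From HB Require Import structures.
From Stdlib Require Import Relation_Operators.
Require Import Defs.
From mathcomp Require Import all_boot all_order all_algebra.
From mathcomp Require Import zify ring.

Set Implicit Arguments.
Unset Strict Implicit.
Unset Printing Implicit Defensive.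

Import GRing.Theory.
Local Open Scope ring_scope.

(** * Homotopy equivalences of based complexes over F_2 *)

(** Signs given by an arbitrary [phi] need not change under a move as crossing signs do, so nothing
    is read off pictures. Complexes are built for abstract arc diagrams: a crossing is four arc ends
    and a marker, and two arcs are on one circle when all boolean labellings that respect the
    gluings agree on them. The obstacle is [d^2 = 0], since a change of marker may keep the number
    of circles. A parity count (every arc has two ends) shows that the two arcs of a strand at a
    crossing share a circle before or after the change. Labelled circles are then encoded as
    square-free polynomials, on which a differential is the identity or a sum of two partial
    derivatives; squares commute essentially because partial derivatives do. Homotopy equivalences
    given by matrices are used instead of isomorphisms of homology because they compose and can be
    transposed: the mirror image of a diagram has the dual complex, so each move is needed for one
    choice of markers only. Reversing a strand merely flips the marker of a crossing, which removes
    orientations from the local pictures. *)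

Lemma lmod_iso_refl (K : fieldType) (U : lmodType K) : lmod_iso U U.
Proof. by exists idfun; exists idfun. Qed.

Section SubquotientIso.
Variables (K : fieldType) (V V' : vectType K).
Variables (Z B : {vspace V}) (Z' B' : {vspace V'}).

Let U := (linfun (vsval : subvs_of Z -> V) @^-1: B)%VS.
Let U' := (linfun (vsval : subvs_of Z' -> V') @^-1: B')%VS.

(** The map is computed on chosen representatives, so its linearity is not visible from its
    definition; it follows from the formula on classes, which is also the only property used
    later. *)
Lemma subquotient_map (f : {linear V -> V'}) :
  (forall z, z \in Z -> f z \in Z') ->
  (forall z, z \in Z -> z \in B -> f z \in B') ->
  exists2 F : {linear subquotient Z B -> subquotient Z' B'}, True &
    forall z : subvs_of Z, F (\pi_(vquot U)%qT z) = \pi_(vquot U')%qT (vsproj Z' (f (vsval z))).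
Proof.
move=> fZ fB.
pose F (q : subquotient Z B) : subquotient Z' B' :=
  \pi_(vquot U')%qT (vsproj Z' (f (vsval (repr (q : vquot U))))).
have FE : forall z, F (\pi_(vquot U)%qT z) = \pi_(vquot U')%qT (vsproj Z' (f (vsval z))).
  move=> z; apply/vquot_piE; rewrite -!linearB -memv_preim lfunE /= vsprojK; last first.
    by rewrite -linearB fZ // memvB ?subvsP.
  rewrite -linearB; apply: fB; first by rewrite memvB ?subvsP.
  have /vquot_piE : \pi_(vquot U)%qT (repr (\pi_(vquot U)%qT z)) = \pi_(vquot U)%qT z by rewrite reprK.
  by rewrite -memv_preim lfunE.
have Flin : linear F.
  move=> a x y; rewrite -[x]reprK -[y]reprK.
  have -> : a *: (\pi_(vquot U)%qT (repr (x : vquot U)) : subquotient Z B) + \pi_(vquot U)%qT (repr (y : vquot U))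
     = \pi_(vquot U)%qT (a *: repr (x : vquot U) + repr (y : vquot U)).
    by rewrite vquot_piD -vquot_pi_scale.
  by rewrite !FE !linearP vquot_piD -vquot_pi_scale.
pose FL := GRing.isLinear.Build K _ _ _ F Flin.
pose FF : {linear subquotient Z B -> subquotient Z' B'} := HB.pack F FL.
by exists FF.
Qed.

End SubquotientIso.

Lemma subquotient_iso (K : fieldType) (V V' : vectType K)
    (Z B : {vspace V}) (Z' B' : {vspace V'})
    (f : {linear V -> V'}) (g : {linear V' -> V}) :
  (forall z, z \in Z -> f z \in Z') ->
  (forall z, z \in Z -> z \in B -> f z \in B') ->
  (forall z, z \in Z' -> g z \in Z) ->
  (forall z, z \in Z' -> z \in B' -> g z \in B) ->
  (forall z, z \in Z -> g (f z) - z \in B) ->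
  (forall z, z \in Z' -> f (g z) - z \in B') ->
  lmod_iso (subquotient Z B) (subquotient Z' B').
Proof.
move=> fZ fB gZ gB gf fg.
have [F _ FE] := subquotient_map fZ fB.
have [G _ GE] := subquotient_map gZ gB.
exists F; exists G => x; rewrite -[x]reprK; set z := repr _.
  have fz := fZ _ (subvsP z); have gfz := gZ _ fz.
  rewrite FE GE; apply/vquot_piE; rewrite -memv_preim lfunE /=.
  by rewrite (vsprojK fz) (vsprojK gfz); apply: gf; apply: subvsP.
have gz := gZ _ (subvsP z); have fgz := fZ _ gz.
rewrite GE FE; apply/vquot_piE; rewrite -memv_preim lfunE /=.
by rewrite (vsprojK gz) (vsprojK fgz); apply: fg; apply: subvsP.
Qed.

(** [dcoef x y] is the coefficient of [y] in the differential of [x]. No axiom is included: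
    [is_complex] is asked for only where an elimination is performed. *)
Record based_complex := BasedComplex {
  basis :> finType;
  hgr : basis -> int;
  qgr : basis -> int;
  dcoef : basis -> basis -> 'F_2
}.

Lemma addF2 (a : 'F_2) : a + a = 0.
Proof. by apply/val_inj; case: a => -[|[|]]. Qed.

Lemma addmx2 m n (M : 'M['F_2]_(m, n)) : M + M = 0.
Proof. by apply/matrixP => i j; rewrite !mxE addF2. Qed.

(** Rows index the source, so products of matrices compose maps from left to right. *)
Definition kmx (X Y : finType) (k : X -> Y -> 'F_2) : 'M['F_2]_(#|X|, #|Y|) :=
  \matrix_(i, j) k (enum_val i) (enum_val j).

Lemma kmxE (X Y : finType) (k : X -> Y -> 'F_2) x y :
  kmx k (enum_rank x) (enum_rank y) = k x y.
Proof. by rewrite mxE !enum_rankK. Qed.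

Lemma sum_enum_rank (X : finType) (F : 'I_#|X| -> 'F_2) :
  \sum_i F i = \sum_x F (enum_rank x).
Proof. by rewrite (reindex (@enum_rank X)) //; apply/onW_bij/enum_rank_bij. Qed.

Lemma kmx_mul (X Y Z : finType) (k : X -> Y -> 'F_2) (l : Y -> Z -> 'F_2) :
  kmx k *m kmx l = kmx (fun x z => \sum_y k x y * l y z).
Proof.
apply/matrixP => i j; rewrite !mxE sum_enum_rank; apply: eq_bigr => y _.
by rewrite !mxE !enum_rankK.
Qed.

Lemma kmx_add (X Y : finType) (k l : X -> Y -> 'F_2) :
  kmx k + kmx l = kmx (fun x y => k x y + l x y).
Proof. by apply/matrixP => i j; rewrite !mxE. Qed.

Lemma kmx1 (X : finType) : 1%:M = kmx (fun x y : X => (x == y)%:R).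
Proof.
by apply/matrixP => i j; rewrite !mxE (inj_eq enum_val_inj).
Qed.

Lemma kmx_tr (X Y : finType) (k : X -> Y -> 'F_2) :
  (kmx k)^T = kmx (fun y x => k x y).
Proof. by apply/matrixP => i j; rewrite !mxE. Qed.

Lemma eq_kmx (X Y : finType) (k l : X -> Y -> 'F_2) : k =2 l -> kmx k = kmx l.
Proof. by move=> kl; apply/matrixP => i j; rewrite !mxE kl. Qed.

Section Homogeneous.
Implicit Types X Y Z : based_complex.

Definition homog X Y (n : int) (M : 'M['F_2]_(#|X|, #|Y|)) :=
  forall i j, M i j != 0 ->
  hgr (enum_val j) = hgr (enum_val i) + n /\ qgr (enum_val j) = qgr (enum_val i).

Definition dmx X := kmx (@dcoef X).

Lemma homogM X Y Z m n (M : 'M_(#|X|, #|Y|)) (N : 'M_(#|Y|, #|Z|)) :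
  homog m M -> homog n N -> homog (m + n) (M *m N).
Proof.
move=> hM hN i j; rewrite mxE.
have [k /= k0 _|k0] := pickP [pred k | M i k * N k j != 0].
  move: k0; rewrite mulf_eq0 negb_or => /andP[/hM[hk qk] /hN[-> ->]].
  by rewrite hk qk addrA.
rewrite big1 ?eqxx // => k _; move: (k0 k) => /=.
by move/negbFE/eqP.
Qed.

Lemma homogD X Y n (M N : 'M_(#|X|, #|Y|)) :
  homog n M -> homog n N -> homog n (M + N).
Proof.
move=> hM hN i j; rewrite mxE.
by have [->|/hM //] := eqVneq (M i j) 0; rewrite add0r => /hN.
Qed.

Lemma homog0 X Y n : homog n (0 : 'M_(#|X|, #|Y|)).
Proof. by move=> i j; rewrite mxE eqxx. Qed.

Lemma homog1 X : homog 0 (1%:M : 'M_(#|X|, #|X|)).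
Proof. by move=> i j; rewrite mxE; have [->|] := eqVneq i j; rewrite ?eqxx // addr0. Qed.

Lemma homog_kmx X Y n (k : X -> Y -> 'F_2) :
  (forall x y, k x y != 0 -> hgr y = hgr x + n /\ qgr y = qgr x) ->
  homog n (kmx k).
Proof. by move=> hk i j; rewrite mxE => /hk. Qed.

Definition is_complex X := homog 1 (dmx X) /\ dmx X *m dmx X = 0.

(** The two chain maps preserve both degrees and the two homotopies lower [hgr] by one; signs
    disappear in characteristic 2. *)
Definition homotopy_equiv X Y : Prop :=
  exists f g h h',
    [/\ homog (X := X) (Y := Y) 0 f, homog (X := Y) (Y := X) 0 g,
        homog (X := X) (Y := X) (-1) h & homog (X := Y) (Y := Y) (-1) h'] /\
    [/\ dmx X *m f = f *m dmx Y, dmx Y *m g = g *m dmx X,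
        f *m g = 1%:M + dmx X *m h + h *m dmx X &
        g *m f = 1%:M + dmx Y *m h' + h' *m dmx Y].

Lemma homotopy_equiv_sym X Y : homotopy_equiv X Y -> homotopy_equiv Y X.
Proof. by case=> f [g [h [h' [[? ? ? ?] [? ? ? ?]]]]]; exists g, f, h', h. Qed.

Lemma homotopy_comp X Y Z (f : 'M_(#|X|, #|Y|)) (f' : 'M_(#|Y|, #|Z|)) g g' h k :
  dmx X *m f = f *m dmx Y -> dmx Y *m g = g *m dmx X ->
  f *m g = 1%:M + dmx X *m h + h *m dmx X ->
  f' *m g' = 1%:M + dmx Y *m k + k *m dmx Y ->
  (f *m f') *m (g' *m g) = 1%:M + dmx X *m (h + f *m k *m g) + (h + f *m k *m g) *m dmx X.
Proof.
move=> df dg fg fg'.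
have -> : f *m f' *m (g' *m g) = f *m (f' *m g') *m g by rewrite !mulmxA.
rewrite fg' !(mulmxDr, mulmxDl) mulmx1 fg !mulmxA df -!mulmxA -dg !mulmxA.
by rewrite -!addrA; do 2!congr (_ + _); rewrite addrCA.
Qed.

Lemma homotopy_equiv_trans X Y Z :
  homotopy_equiv X Y -> homotopy_equiv Y Z -> homotopy_equiv X Z.
Proof.
move=> [f [g [h [h' [[hf hg hh hh'] [df dg fg gf]]]]]].
move=> [f' [g' [k [k' [[hf' hg' hk hk'] [df' dg' fg' gf']]]]]].
exists (f *m f'), (g' *m g), (h + f *m k *m g), (k' + g' *m h' *m f').
split; split.
- by rewrite -[0]addr0; apply: homogM.
- by rewrite -[0]addr0; apply: homogM.
- apply: homogD => //; rewrite -[- _]addr0; apply: homogM => //.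
  by rewrite -[- _]add0r; apply: homogM.
- apply: homogD => //; rewrite -[- _]addr0; apply: homogM => //.
  by rewrite -[- _]add0r; apply: homogM.
- by rewrite mulmxA df -mulmxA df' mulmxA.
- by rewrite mulmxA dg' -mulmxA dg mulmxA.
- exact: homotopy_comp.
- exact: homotopy_comp.
Qed.

(** For the complex of a diagram this turns out to be the complex of the mirror image. *)
Definition dual X := BasedComplex (fun x : X => - hgr x) (fun x => - qgr x) (fun x y : X => dcoef y x).

Lemma dmx_dual X : dmx (dual X) = (dmx X)^T.
Proof. by rewrite /dmx kmx_tr. Qed.

Lemma homog_tr X Y n (M : 'M_(#|X|, #|Y|)) :
  homog n M -> homog (X := dual Y) (Y := dual X) n M^T.
Proof. by move=> hM i j; rewrite mxE /= => /hM[-> ->]; split=> //; rewrite opprD addrNK. Qed.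

Lemma homotopy_equiv_dual X Y : homotopy_equiv X Y -> homotopy_equiv (dual X) (dual Y).
Proof.
move=> [f [g [h [h' [[hf hg hh hh'] [df dg fg gf]]]]]].
exists g^T, f^T, h^T, h'^T; split; split; try exact: homog_tr; rewrite !dmx_dual -!trmx_mul.
- by rewrite dg.
- by rewrite df.
- by rewrite fg !linearD /= trmx1 addrAC.
- by rewrite gf !linearD /= trmx1 addrAC.
Qed.

Lemma dualK X : homotopy_equiv (dual (dual X)) X.
Proof.
exists 1%:M, 1%:M, 0, 0; split; split; try exact: homog0.
- by move=> i j; rewrite mxE /= !opprK; have [->|] := eqVneq i j; rewrite ?eqxx // addr0.
- by move=> i j; rewrite mxE /= !opprK; have [->|] := eqVneq i j; rewrite ?eqxx // addr0.
- by rewrite !dmx_dual trmxK mulmx1 mul1mx.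
- by rewrite !dmx_dual trmxK mulmx1 mul1mx.
- by rewrite mulmx0 mul0mx mulmx1 !addr0.
- by rewrite mulmx0 mul0mx mulmx1 !addr0.
Qed.

(** A bijection of generators is given as a relation, because the generators are dependent pairs and
    the matching only concerns the underlying markers and labels; an inverse function would have to
    rebuild the proofs. *)
Lemma homotopy_equiv_bij X Y (r : X -> Y -> bool) :
  (forall x, exists y, r x y) -> (forall y, exists x, r x y) ->
  (forall x y y', r x y -> r x y' -> y = y') ->
  (forall x x' y, r x y -> r x' y -> x = x') ->
  (forall x y, r x y -> hgr x = hgr y /\ qgr x = qgr y) ->
  (forall x y x' y', r x y -> r x' y' -> dcoef x x' = dcoef y y') ->
  homotopy_equiv X Y.
Proof.
move=> rX rY rI rJ rg rd; pose f := kmx (fun x y => (r x y)%:R : 'F_2).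
have sX x y (F : Y -> 'F_2) : r x y -> \sum_y' (r x y')%:R * F y' = F y.
  move=> rxy; rewrite (bigD1 y) //= rxy mul1r big1 ?addr0 // => y' ny.
  case rxy': (r x y'); last by rewrite mul0r.
  by case/eqP: ny; exact: rI rxy' rxy.
have sY x y (F : X -> 'F_2) : r x y -> \sum_x' F x' * (r x' y)%:R = F x.
  move=> rxy; rewrite (bigD1 x) //= rxy mulr1 big1 ?addr0 // => x' nx.
  case rxy': (r x' y); last by rewrite mulr0.
  by case/eqP: nx; exact: rJ rxy' rxy.
have fft : f *m f^T = 1%:M.
  rewrite /f kmx_tr kmx_mul kmx1; apply: eq_kmx => x x'; have [y xy] := rX x.
  rewrite (sX x y) //; congr (_%:R); have [<-|nx] := eqVneq x x'; first by rewrite xy.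
  by case x'y: (r x' y) => //; case/eqP: nx; exact: rJ xy x'y.
have ftf : f^T *m f = 1%:M.
  rewrite /f kmx_tr kmx_mul kmx1; apply: eq_kmx => y y'; have [x xy] := rY y.
  rewrite (eq_bigr (fun x => (r x y')%:R * (r x y)%:R)); last by move=> *; rewrite mulrC.
  rewrite (sY x y) //; congr (_%:R); have [<-|ny] := eqVneq y y'; first by rewrite xy.
  by case xy': (r x y') => //; case/eqP: ny; exact: rI xy xy'.
have df : dmx X *m f = f *m dmx Y.
  rewrite /f /dmx !kmx_mul; apply: eq_kmx => x y; have [y' xy'] := rX x.
  by have [x' x'y] := rY y; rewrite (sX x y') // (sY x' y) //; apply: rd.
exists f, f^T, 0, 0; split; split; try exact: homog0.
- apply: homog_kmx => x y; rewrite addr0; case xy: (r x y); rewrite ?eqxx //.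
  by have [-> ->] := rg _ _ xy.
- rewrite kmx_tr; apply: homog_kmx => y x; rewrite addr0; case xy: (r x y); rewrite ?eqxx //.
  by have [-> ->] := rg _ _ xy.
- by [].
- by rewrite -[LHS]mul1mx -ftf -!mulmxA (mulmxA f) -df -mulmxA fft mulmx1.
- by rewrite mulmx0 mul0mx !addr0 fft.
- by rewrite mulmx0 mul0mx !addr0 ftf.
Qed.

End Homogeneous.

(** * From homotopy equivalences to isomorphisms of homology *)

Section Homology.

Definition chain (X : finType) := {ffun X -> ('F_2 : fieldType)^o}.

Definition mact (X Y : finType) (M : 'M['F_2]_(#|X|, #|Y|)) (v : chain X) : chain Y :=
  [ffun y => \sum_x M (enum_rank x) (enum_rank y) * v x].

Lemma mact_linear X Y M : linear (@mact X Y M).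
Proof.
move=> a u v; apply/ffunP => y; rewrite !ffunE scaler_sumr -big_split /=.
by apply: eq_bigr => x _; rewrite !ffunE mulrDr /GRing.scale /= mulrCA.
Qed.
HB.instance Definition _ X Y M := GRing.isLinear.Build 'F_2 (chain X) (chain Y) _ (@mact X Y M) (@mact_linear X Y M).

Lemma mactM (X Y Z : finType) (M : 'M_(#|X|, #|Y|)) (N : 'M_(#|Y|, #|Z|)) v :
  mact (M *m N) v = mact N (mact M v).
Proof.
apply/ffunP => z; rewrite !ffunE.
under eq_bigr => x _ do rewrite mxE mulr_suml.
rewrite exchange_big sum_enum_rank /=; apply: eq_bigr => y _; rewrite ffunE mulr_sumr.
by apply: eq_bigr => x _; rewrite [RHS]mulrA [N _ _ * M _ _]mulrC.
Qed.

Lemma mactD (X Y : finType) (M N : 'M_(#|X|, #|Y|)) v :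
  mact (M + N) v = mact M v + mact N v.
Proof.
apply/ffunP => z; rewrite !ffunE -big_split /=.
by apply: eq_bigr => x _; rewrite mxE mulrDl.
Qed.

Lemma mact1 (X : finType) (v : chain X) : mact 1%:M v = v.
Proof.
apply/ffunP => y; rewrite !ffunE (bigD1 y) //= mxE eqxx mul1r big1 ?addr0 // => x nx.
by rewrite mxE (inj_eq enum_rank_inj) (negbTE nx) mul0r.
Qed.

(** Describing a graded piece by supports makes the comparison of homologies independent of the
    spanning families that define the chain groups. *)
Definition homogeneous_part (X : based_complex) (i j : int) (C : {vspace chain X}) :=
  forall v : chain X, (v \in C) <-> (forall x, v x != 0 -> hgr x = i /\ qgr x = j).

Lemma mact_homog (X Y : based_complex) n (M : 'M_(#|X|, #|Y|)) i j C C' (v : chain X) :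
  homog n M -> homogeneous_part i j C -> homogeneous_part (i + n) j C' ->
  v \in C -> mact M v \in C'.
Proof.
move=> hM hC hC' /hC vC; apply/hC' => y; rewrite ffunE.
have [x /= x0 _|x0] := pickP [pred x | M (enum_rank x) (enum_rank y) * v x != 0].
  move: x0; rewrite mulf_eq0 negb_or => /andP[/hM]; rewrite !enum_rankK => -[-> ->].
  by move=> /vC[-> ->].
rewrite big1 ?eqxx // => k _; move: (x0 k) => /=.
by move/negbFE/eqP.
Qed.

Lemma homology_iso (X Y : based_complex) (i j : int)
    (DX : 'Hom(chain X, chain X)) (DY : 'Hom(chain Y, chain Y)) CX BX CY BY :
  (forall v, DX v = mact (dmx X) v) -> (forall v, DY v = mact (dmx Y) v) ->
  homogeneous_part (X := X) i j CX -> homogeneous_part (X := X) (i - 1) j BX ->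
  homogeneous_part (X := Y) i j CY -> homogeneous_part (X := Y) (i - 1) j BY ->
  homotopy_equiv X Y ->
  lmod_iso (subquotient (lker DX :&: CX)%VS (DX @: BX)%VS)
           (subquotient (lker DY :&: CY)%VS (DY @: BY)%VS).
Proof.
move=> DXE DYE hCX hBX hCY hBY [f [g [h [h' [[hf hg hh hh'] [df dg fg gf]]]]]].
have step (X1 Y1 : based_complex) (f1 : 'M_(#|X1|, #|Y1|)) (D1 : 'Hom(chain X1, chain X1)) (D2 : 'Hom(chain Y1, chain Y1))
   C1 B1 C2 B2 : homog (X := X1) (Y := Y1) 0 f1 -> 
   (forall v, D1 v = mact (dmx X1) v) -> (forall v, D2 v = mact (dmx Y1) v) ->
   homogeneous_part (X := X1) i j C1 -> homogeneous_part (X := X1) (i - 1) j B1 ->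
   homogeneous_part (X := Y1) i j C2 -> homogeneous_part (X := Y1) (i - 1) j B2 ->
   dmx X1 *m f1 = f1 *m dmx Y1 ->
   (forall z, z \in (lker D1 :&: C1)%VS -> mact f1 z \in (lker D2 :&: C2)%VS) /\
   (forall z, z \in (lker D1 :&: C1)%VS -> z \in (D1 @: B1)%VS -> mact f1 z \in (D2 @: B2)%VS).
  move=> hf1 D1E D2E hC1 hB1 hC2 hB2 df1; split=> z.
    rewrite !memv_cap !memv_ker D1E D2E => /andP[/eqP dz zC]; apply/andP; split.
      by rewrite -mactM -df1 mactM dz linear0.
    by apply: (mact_homog hf1 hC1 _ zC); rewrite addr0.
  move=> _ /memv_imgP[u uB ->]; apply/memv_imgP; exists (mact f1 u).
    by apply: (mact_homog hf1 hB1 _ uB); rewrite addr0.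
  by rewrite D1E D2E -!mactM df1.
have htp (X1 : based_complex) (D1 : 'Hom(chain X1, chain X1)) C1 B1 (k h1 : 'M_(#|X1|, #|X1|)) :
   homog (X := X1) (Y := X1) (-1) h1 ->
   (forall v, D1 v = mact (dmx X1) v) ->
   homogeneous_part (X := X1) i j C1 -> homogeneous_part (X := X1) (i - 1) j B1 ->
   k = 1%:M + dmx X1 *m h1 + h1 *m dmx X1 ->
   forall z, z \in (lker D1 :&: C1)%VS -> mact k z - z \in (D1 @: B1)%VS.
  move=> hh1 D1E hC1 hB1 -> z; rewrite memv_cap memv_ker D1E => /andP[/eqP dz zC].
  apply/memv_imgP; exists (mact h1 z); first exact: (mact_homog hh1 hC1 hB1 zC).
  by rewrite !mactD mact1 !mactM dz linear0 addr0 addrC addKr D1E.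
have [fZ fB] := step X Y f DX DY CX BX CY BY hf DXE DYE hCX hBX hCY hBY df.
have [gZ gB] := step Y X g DY DX CY BY CX BX hg DYE DXE hCY hBY hCX hBX dg.
apply: (@subquotient_iso _ _ _ _ _ _ _ (mact f : {linear chain X -> chain Y}) (mact g : {linear chain Y -> chain X})) => //.
- by move=> z zZ /=; rewrite -mactM; apply: (htp _ _ _ _ _ _ hh DXE hCX hBX fg).
- by move=> z zZ /=; rewrite -mactM; apply: (htp _ _ _ _ _ _ hh' DYE hCY hBY gf).
Qed.

End Homology.

(* Gaussian elimination of the invertible block [d : P -> Q], with inverse
   [h : Q -> P]; [m] is the inclusion of the remaining generators. *)
Lemma cancel_mx n k (d h : 'M['F_2]_n) (m : 'M['F_2]_(k, n)) (e : 'M['F_2]_k) :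
  d *m d = 0 ->
  m *m m^T = 1%:M -> h *m h = 0 -> m *m h = 0 -> h *m m^T = 0 ->
  m^T *m m + h^T *m h + h *m h^T = 1%:M ->
  h^T *m h *m d *m (h *m h^T) = h^T ->
  e = m *m (d + d *m h *m d) *m m^T ->
  let f := (1%:M + h *m d) *m m^T in let g := m *m (1%:M + d *m h) in
  [/\ d *m f = f *m e, e *m g = g *m d, f *m g = 1%:M + d *m h + h *m d
    & g *m f = 1%:M].
Proof.
move=> dd mm hh0 mh hm0 part pq eE.
set pP := h^T *m h in part pq *; set pQ := h *m h^T in part pq *.
have [pPE pQE] : pP = h^T *m h /\ pQ = h *m h^T by [].
clearbody pP pQ.
have hQ : pQ *m h = h.
  have := congr1 (mulmx^~ h) part.
  by rewrite pPE !mulmxDl mul1mx -!mulmxA mh hh0 !mulmx0 !add0r.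
have hP : h *m pP = h by rewrite pPE mulmxA -pQE.
have P0 : pP *m (1%:M + d *m h) = 0.
  by rewrite mulmxDr mulmx1 mulmxA -{1}hQ mulmxA pq -pPE addmx2.
have Q0 : (1%:M + h *m d) *m pQ = 0.
  suff -> : (1%:M + h *m d) *m pQ = pQ + h *m (pP *m d *m pQ) by rewrite pq -pQE addmx2.
  by rewrite mulmxDl mul1mx !mulmxA hP.
have mtm : m^T *m m = 1%:M + pP + pQ.
  by rewrite -part -!addrA (addrCA pQ) addmx2 addr0 addmx2 addr0.
(* [m^T *m m] is the projector on the remaining generators. It may be inserted in a product whose
   left factor has no component in [Q] and whose right factor vanishes on [P]. *)
have mid W Z (M : 'M_(W, _)) (N : 'M_(_, Z)) :
    M *m pQ = 0 -> pP *m N = 0 -> M *m m^T *m (m *m N) = M *m N.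
  move=> MQ PN; rewrite mulmxA -(mulmxA M) mtm !(mulmxDr, mulmxDl) mulmx1 MQ mul0mx.
  by rewrite -(mulmxA M) PN mulmx0 !addr0.
have dhd1 : d + d *m h *m d = d *m (1%:M + h *m d) by rewrite mulmxDr mulmx1 mulmxA.
have dhd2 : d + d *m h *m d = (1%:M + d *m h) *m d by rewrite mulmxDl mul1mx.
split.
- rewrite eE -(mulmxA m) mid //; last by rewrite dhd2 !mulmxA P0 !mul0mx.
  rewrite dhd1 !mulmxA; congr (_ *m _ *m _).
  by rewrite mulmxDl mul1mx -mulmxA dd mulmx0 addr0.
- rewrite eE mid //; last by rewrite dhd1 -!mulmxA Q0 !mulmx0.
  rewrite dhd2 -!mulmxA; congr (_ *m (_ *m _)).
  by rewrite mulmxDr mulmx1 mulmxA dd mul0mx addr0.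
- rewrite mid // mulmxDl mul1mx mulmxDr mulmx1 !mulmxA -(mulmxA h) dd mulmx0 mul0mx addr0.
  by rewrite addrAC.
- rewrite -mulmxA (mulmxA (1%:M + d *m h)) (_ : _ *m (1%:M + h *m d) = 1%:M + d *m h + h *m d).
    rewrite !mulmxDl !mulmxDr mul1mx mm -!mulmxA hm0 !mulmx0 addr0.
    by rewrite (mulmxA m h) mh mul0mx addr0.
  by rewrite mulmxDr mulmx1 mulmxDl mul1mx -!mulmxA (mulmxA h h) hh0 mul0mx mulmx0 addr0.
Qed.

(* Each element of [Q] is paired by [r] with the unique element of [P] whose
   differential hits it. *)
Lemma homotopy_equiv_cancel (X Y : based_complex) (iota : Y -> X)
    (P Q : pred X) (r : X -> X -> bool) :
  is_complex X ->
  injective iota ->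
  (forall x, [|| P x, Q x | x \in codom iota]) ->
  (forall y, ~~ P (iota y) && ~~ Q (iota y)) ->
  (forall x, ~~ (P x && Q x)) ->
  (forall q p, r q p -> Q q && P p) ->
  (forall q, Q q -> exists p, r q p) ->
  (forall p, P p -> exists q, r q p) ->
  (forall q p p', r q p -> r q p' -> p = p') ->
  (forall q q' p, r q p -> r q' p -> q = q') ->
  (forall p q, P p -> Q q -> dcoef p q = (r q p)%:R) ->
  (forall y, hgr y = hgr (iota y) /\ qgr y = qgr (iota y)) ->
  (forall y y', dcoef y y' = dcoef (iota y) (iota y') +
     \sum_q \sum_p dcoef (iota y) q * (r q p)%:R * dcoef p (iota y')) ->
  homotopy_equiv X Y.
Proof.
move=> cX inj_i cover iM PQ rPQ rQ rP rI rJ rd ig iY.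
pose h := kmx (fun q p => (r q p)%:R : 'F_2).
pose m := kmx (fun y x => (iota y == x)%:R : 'F_2).
have hm : homog (X := Y) (Y := X) 0 m.
  apply: homog_kmx => y x; case: (eqVneq (iota y) x) => [<- _|]; rewrite ?eqxx // addr0.
  by have [a b] := ig y; split; rewrite ?a ?b.
(* The degree of [h] is forced, since a differential of degree one joins the two members of each
   matched pair. *)
have hh : homog (X := X) (Y := X) (-1) h.
  apply: homog_kmx => q p; case qp: (r q p); rewrite ?eqxx // => _.
  have /andP[Qq Pp] := rPQ _ _ qp.
  have [hX _] := cX; have := hX (enum_rank p) (enum_rank q).
  by rewrite /dmx kmxE rd // qp !enum_rankK => /(_ isT)[-> ->]; rewrite addrK.
have sumr1 q p (F : X -> 'F_2) : r q p -> \sum_x (r q x)%:R * F x = F p.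
  move=> rqp; rewrite (bigD1 p) //= rqp mul1r big1 ?addr0 // => p' np.
  by case rqp': (r q p'); rewrite ?mul0r //; case/eqP: np; exact: rI rqp' rqp.
have sumr2 q p (F : X -> 'F_2) : r q p -> \sum_x (r x p)%:R * F x = F q.
  move=> rqp; rewrite (bigD1 q) //= rqp mul1r big1 ?addr0 // => q' nq.
  by case rqp': (r q' p); rewrite ?mul0r //; case/eqP: nq; exact: rJ rqp' rqp.
have sumi y (F : X -> 'F_2) : \sum_x (iota y == x)%:R * F x = F (iota y).
  by rewrite (bigD1 (iota y)) //= eqxx mul1r big1 ?addr0 // => x; rewrite eq_sym => /negbTE->; rewrite mul0r.
have sumd1 p b (F : X -> 'F_2) : \sum_x ((p == x) && b)%:R * F x = b%:R * F p.
  rewrite (bigD1 p) //= eqxx big1 ?addr0 // => x.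
  by rewrite eq_sym => /negbTE->; rewrite mul0r.
have sumd2 q (F : X -> 'F_2) : \sum_x F x * ((x == q) && Q x)%:R = F q * (Q q)%:R.
  by rewrite (bigD1 q) //= eqxx big1 ?addr0 // => x /negbTE->; rewrite mulr0.
(* As [r] is a bijection from [Q] to [P], the two products of [h] with its transpose are the
   diagonal projectors on [Q] and on [P]. *)
have hhtE : h *m h^T = kmx (fun x y => ((x == y) && Q x)%:R).
  rewrite kmx_tr kmx_mul; apply: eq_kmx => x y.
  case Qx: (Q x); last first.
    rewrite andbF big1 // => p _; case xp: (r x p); rewrite ?mul0r //.
    by have /andP[] := rPQ _ _ xp; rewrite Qx.
  have [p xp] := rQ _ Qx; rewrite (sumr1 x p) // andbT; congr (_%:R).
  have [<-|nxy] := eqVneq x y; first by rewrite xp.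
  by case yp: (r y p) => //; case/eqP: nxy; exact: rJ xp yp.
have hthE : h^T *m h = kmx (fun x y => ((x == y) && P x)%:R).
  rewrite kmx_tr kmx_mul; apply: eq_kmx => x y.
  case Px: (P x); last first.
    rewrite andbF big1 // => q _; case xq: (r q x); rewrite ?mul0r //.
    by have /andP[] := rPQ _ _ xq; rewrite Px.
  have [q xq] := rP _ Px; rewrite (sumr2 q x) // andbT; congr (_%:R).
  have [<-|nxy] := eqVneq x y; first by rewrite xq.
  by case yq: (r q y) => //; case/eqP: nxy; exact: rI xq yq.
have mtmE : m^T *m m = kmx (fun x y => ((x == y) && (x \in codom iota))%:R).
  rewrite kmx_tr kmx_mul; apply: eq_kmx => x y.
  case xi: (x \in codom iota); last first.
    rewrite andbF big1 // => z _; case: eqVneq => [zx|]; rewrite ?mul0r //.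
    by rewrite -zx codom_f in xi.
  have /codomP[z xz] := xi; rewrite (bigD1 z) //= -xz eqxx mul1r andbT big1 ?addr0 // => z' nz.
  by case: eqVneq; rewrite ?mul0r // xz => /inj_i zz; rewrite zz eqxx in nz.
have mrow (W : finType) (l : X -> W -> 'F_2) : m *m kmx l = kmx (fun y => l (iota y)).
  by rewrite kmx_mul; apply: eq_kmx => y w; rewrite sumi.
have mcol (W : finType) (l : W -> X -> 'F_2) : kmx l *m m^T = kmx (fun w y => l w (iota y)).
  rewrite kmx_tr kmx_mul; apply: eq_kmx => w y.
  by under eq_bigr => x _ do rewrite mulrC; rewrite sumi.
have mm : m *m m^T = 1%:M.
  by rewrite mcol kmx1; apply: eq_kmx => y y'; rewrite (inj_eq inj_i).
have z0 (W Z : finType) (k : W -> Z -> 'F_2) : (forall w z, k w z = 0) -> kmx k = 0.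
  by move=> k0; apply/matrixP => i j; rewrite !mxE.
have hh0 : h *m h = 0.
  rewrite kmx_mul; apply: z0 => x y; rewrite big1 // => z _.
  case xz: (r x z); rewrite ?mul0r //; case zy: (r z y); rewrite ?mulr0 //.
  have /andP[_ Pz] := rPQ _ _ xz; have /andP[Qz _] := rPQ _ _ zy.
  by have := PQ z; rewrite Pz Qz.
have mh : m *m h = 0.
  rewrite mrow; apply: z0 => y p; case yp: (r _ p) => //.
  by have /andP[Qy _] := rPQ _ _ yp; have := iM y; rewrite Qy andbF.
have hm0 : h *m m^T = 0.
  rewrite mcol; apply: z0 => q y; case yp: (r q _) => //.
  by have /andP[_ Py] := rPQ _ _ yp; have := iM y; rewrite Py.
have part : m^T *m m + h^T *m h + h *m h^T = 1%:M.
  rewrite hhtE hthE mtmE !kmx_add kmx1; apply: eq_kmx => x y.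
  have [_|] := eqVneq x y; last by rewrite !addr0.
  have := cover x; have := PQ x; case Px: (P x); case Qx: (Q x) => //= _.
  - rewrite addr0; case: codomP => [[y' xy]|]; rewrite ?add0r //.
    by have := iM y'; rewrite -xy Px.
  - case: codomP => [[y' xy]|]; rewrite ?add0r ?addr0 //.
    by have := iM y'; rewrite -xy Qx andbF.
  - by move=> ->; rewrite !addr0.
have pq : h^T *m h *m dmx X *m (h *m h^T) = h^T.
  rewrite hhtE hthE /dmx !kmx_mul kmx_tr; apply: eq_kmx => p q.
  under eq_bigr => x _ do rewrite sumd1.
  rewrite sumd2.
  case Pp: (P p); case Qq: (Q q); rewrite /= ?mulr0 ?mul0r ?mulr1 ?mul1r ?rd //;
  by case qp: (r q p) => //; have := rPQ _ _ qp; rewrite Pp Qq.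
have dY : dmx Y = m *m (dmx X + dmx X *m h *m dmx X) *m m^T.
  rewrite /dmx /h !kmx_mul kmx_add mrow mcol; apply: eq_kmx => y y'.
  rewrite iY; congr (_ + _); rewrite exchange_big; apply: eq_bigr => p _ /=.
  by rewrite mulr_suml.
have [_ dd] := cX.
have [df eg fg gf] := cancel_mx dd mm hh0 mh hm0 part pq dY.
exists ((1%:M + h *m dmx X) *m m^T), (m *m (1%:M + dmx X *m h)), h, 0.
have [hd _] := cX.
have hmt : homog (X := X) (Y := Y) 0 m^T.
  by move=> i j; rewrite mxE => /hm[-> ->]; rewrite !addr0.
split; split=> //.
- rewrite -[0]addr0; apply: homogM => //.
  by apply: homogD; [exact: homog1 | rewrite -[0](addNr 1); apply: homogM].
- rewrite -[0]addr0; apply: homogM => //.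
  by apply: homogD; [exact: homog1 | rewrite -[0](subrr 1); apply: homogM].
- exact: homog0.
- by rewrite mulmx0 mul0mx !addr0.
Qed.

(** * Surgery on the circles of a state *)

Section Surgery.
Variable A : finType.
Implicit Types (E F : rel A) (l m : {ffun A -> bool}) (V : {set A}).

Definition is_equiv E := [/\ reflexive E, symmetric E & transitive E].

Definition respects E l := forall a b, E a b -> l a = l b.

Definition join E x y : rel A :=
  fun a b => [|| E a b, E a x && E b y | E a y && E b x].

(** [E] and [F] are the circles before and after a change of marker: they differ only by the way the
    circles through [x] and [y] are cut. The last clause excludes that [x] and [y] be separated on
    both sides; that they be joined on both sides is allowed, and is the case where the number of
    circles does not change. *)
Definition surgery E F x y :=
  [/\ is_equiv E, is_equiv F, join E x y =2 join F x y & E x y || F x y].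

Lemma surgery_sym E F x y : surgery E F x y -> surgery F E x y.
Proof. by case=> eE eF EF xy; split; [done|done|by move=> a b; rewrite EF|by rewrite orbC]. Qed.

Lemma equivE E x y a : is_equiv E -> E x y -> E a x = E a y.
Proof.
by case=> _ sE tE xy; apply/idP/idP => ax; apply: (tE _ _ _ ax); rewrite // sE.
Qed.

Lemma join_sub E x y a b : E a b -> join E x y a b.
Proof. by rewrite /join => ->. Qed.

Lemma join_id E x y : is_equiv E -> E x y -> join E x y =2 E.
Proof.
move=> eE xy a b; have [rE sE tE] := eE; rewrite /join !(sE b) -(equivE a eE xy).
apply/idP/idP => [|->] //; case/or3P => // /andP[ax bxy]; last exact: (tE _ _ _ ax bxy).
exact: (tE _ _ _ ax (tE _ _ _ xy bxy)).
Qed.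

Lemma surgery_joinE E F x y : surgery E F x y -> E x y -> E =2 join F x y.
Proof. by case=> eE _ EF _ xy a b; rewrite -EF join_id. Qed.

Lemma surgery_off E F x y a b :
  surgery E F x y -> ~~ E a x -> ~~ E a y -> E a b = F a b.
Proof.
case=> [[rE _ _] [rF _ _] EF _] ax ay.
have := EF a b; have := EF a x; rewrite /join rF (negbTE ax) (negbTE ay) /= !orbF andbT.
by move=> /esym/norP[/negbTE-> /norP[_ /negbTE->]]; rewrite !orbF.
Qed.

Definition inc E F x y l m : bool :=
  [forall z, ~~ E z x && ~~ E z y ==> (m z == l z)] &&
  match E x y, F x y with
  | false, true => m_coef (l x) (l y) (m x)
  | true, false => Delta_coef (l x) (m x) (m y)
  | _, _ => false
  end.

Definition class E a := [set b | E a b].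

Lemma mem_class E a b : (b \in class E a) = E a b.
Proof. by rewrite inE. Qed.

Lemma eq_class E a b : is_equiv E -> E a b -> class E a = class E b.
Proof.
move=> eE ab; apply/setP => c; rewrite !inE; have [_ sE _] := eE.
by rewrite sE (equivE c eE ab) sE.
Qed.

(* A labelling [l] of the circles becomes the function of [V] testing whether [V]
   meets the circles labelled [1] once and avoids the circles labelled [x]. In
   this form every differential is [par x] or [par x + par y], and such operators
   commute. *)
Definition nb E V a := #|V :&: class E a|.
Definition psi E l V := [forall a, nb E V a == l a :> nat].

Lemma psiP E l V : reflect (forall a, nb E V a = l a) (psi E l V).
Proof. by apply: (iffP forallP) => H a; apply/eqP. Qed.

Lemma eq_nb E V a b : is_equiv E -> E a b -> nb E V a = nb E V b.
Proof. by move=> eE ab; rewrite /nb (eq_class eE ab). Qed.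

(** If [f] lists the coefficients of a square-free polynomial in variables indexed by the arcs, this
    is the partial derivative with respect to [a]. In these terms [psi E l] is the product, over the
    circles labelled [1], of the sums of the variables of their arcs, a circle labelled [x]
    contributing the factor 1. *)
Definition par a (f : {set A} -> 'F_2) V : 'F_2 := (a \notin V)%:R * f (a |: V).

Lemma parC a b f V : par a (par b f) V = par b (par a f) V.
Proof.
rewrite /par !inE !negb_or setUCA (eq_sym b a) !mulrA -!natrM !mulnb.
by case: (a == b); case: (a \in V); case: (b \in V).
Qed.

Lemma par_psi E l a V : is_equiv E ->
  par a (fun W => (psi E l W)%:R) V = [forall b, (nb E V b + E b a == l b)%N]%:R.
Proof.
move=> eE; rewrite /par -natrM mulnb; congr (_%:R : 'F_2); congr nat_of_bool.
have nbU b : a \notin V -> nb E (a |: V) b = (nb E V b + E b a)%N.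
  move=> aV; rewrite /nb setIUl; case ba: (E b a).
    have -> : [set a] :&: class E b = [set a].
      by apply/setIidPl; rewrite sub1set mem_class.
    by rewrite cardsU1 inE (negbTE aV) /= addnC.
  have -> : [set a] :&: class E b = set0.
    by apply/setP => c; rewrite !inE; case: eqP => // ->; rewrite ba.
  by rewrite set0U addn0.
apply/idP/forallP => [/andP[aV /psiP H] b|H]; first by rewrite -nbU ?H.
have aV : a \notin V.
  apply: contraTN (H a) => aV; have [rE _ _] := eE; rewrite rE.
  have : (0 < nb E V a)%N by apply/card_gt0P; exists a; rewrite !inE aV rE.
  by case: (l a); rewrite /= ?eqb1; lia.
by rewrite aV; apply/psiP => b; rewrite nbU //; apply/eqP.
Qed.

(** The differential on polynomials. A split changes nothing, since the linear form of a circle is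
    the sum of those of its two parts. A merge is the sum of two derivatives: it sends a product of
    two forms to their sum, a single form to 1, and 1 to 0. When [x] and [y] were already on one
    circle the two derivatives cancel, so the case of an unchanged number of circles needs no
    separate formula. *)
Definition surger F x y (f : {set A} -> 'F_2) V : 'F_2 :=
  if F x y then par x f V + par y f V else f V.

Lemma par0 E l a b V : is_equiv E -> E a b ->
  par a (fun W => (psi E l W)%:R) V = par b (fun W => (psi E l W)%:R) V.
Proof.
move=> eE ab; rewrite !par_psi //; congr (_%:R : 'F_2); congr nat_of_bool.
by apply: eq_forallb => c; rewrite (equivE c eE ab).
Qed.

Lemma nb_join E F x y V : is_equiv E -> ~~ E x y -> F =2 join E x y ->
  nb F V x = (nb E V x + nb E V y)%N.
Proof.
move=> eE xy FE; have [rE sE tE] := eE.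
have -> : nb F V x = #|(V :&: class E x) :|: (V :&: class E y)|.
  rewrite /nb -setIUr; congr #|pred_of_set _|; congr (_ :&: _); apply/setP => z.
  by rewrite !inE FE /join rE (negbTE xy) /= orbF (sE z).
rewrite cardsU; suff -> : V :&: class E x :&: (V :&: class E y) = set0 by rewrite cards0 subn0.
apply/setP => z; rewrite !inE; apply/negP => /andP[/andP[_ xz] /andP[_ yz]].
by case/negP: xy; apply: (tE _ _ _ xz); rewrite sE.
Qed.

Lemma nb_off E F x y V a :
  surgery E F x y -> ~~ E a x -> ~~ E a y -> nb E V a = nb F V a.
Proof.
move=> S ax ay; rewrite /nb; congr #|pred_of_set _|; congr (_ :&: _).
by apply/setP => z; rewrite !inE (surgery_off _ S).
Qed.

(** The only labelling that [V] can satisfy: a sum over labellings weighted by [psi] reduces to this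
    term. *)
Definition trace F V : {ffun A -> bool} := [ffun a => nb F V a != 0%N].

Lemma trace_respects F V : is_equiv F -> respects F (trace F V).
Proof. by move=> eF a b ab; rewrite !ffunE (eq_nb V eF ab). Qed.

Lemma psi_trace F m V : psi F m V -> m = trace F V.
Proof. by move=> /psiP H; apply/ffunP => a; rewrite ffunE H; case: (m a). Qed.

(** The coefficients of [m] and [Delta] agree with the polynomial form. The three cases are those
    allowed by [surgery]: unchanged number of circles, split, merge. *)
Lemma psi_inc E F x y l V : surgery E F x y -> respects E l ->
  (inc E F x y l (trace F V) && psi F (trace F V) V)%:R
  = surger F x y (fun W => (psi E l W)%:R) V :> 'F_2.
Proof.
move=> S lE; have [eE eF EF xyor] := S; have [rE sE tE] := eE; have [rF sF tF] := eF.
rewrite /surger /inc; case Exy: (E x y); case Fxy: (F x y); rewrite ?Exy ?Fxy // in xyor *.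
- rewrite andbF (par0 _ _ eE Exy); exact/esym/addF2.
(* A split: the points of [V] on the old circle are distributed between its two halves, and at most
   one such point is allowed. *)
- congr (_%:R : 'F_2); congr nat_of_bool.
  have nx : nb E V x = (nb F V x + nb F V y)%N.
    by apply: nb_join (negbT Fxy) _ => //; exact: surgery_joinE.
  have offx a : ~~ E a x -> ~~ E a y by rewrite (equivE a eE Exy).
  have noff a : ~~ E a x -> nb E V a = nb F V a by move=> ax; rewrite (nb_off V S) ?offx.
  have two a : E a x -> F a x || F a y.
    by rewrite (surgery_joinE S Exy) /join rF Fxy andbF andbT.
  have sub a b : F a b -> E a b by rewrite (surgery_joinE S Exy); exact: join_sub.
  apply/idP/psiP => [/andP[/andP[/forallP off D] /psiP pF] a|pE].
    case ax: (E a x).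
      rewrite (eq_nb V eE ax) nx !pF (lE _ _ ax); move: D; rewrite /Delta_coef.
      by case: (l x); case: (trace _ _ x); case: (trace _ _ y).
    by rewrite noff ?ax // pF; have := off a; rewrite ax offx ?ax //= => /eqP->.
  have px := pE x; rewrite nx in px; apply/andP; split; [apply/andP; split|].
  - apply/forallP => z; apply/implyP => /andP[zx _]; rewrite ffunE -noff // pE.
    by case: (l z).
  - by rewrite /Delta_coef !ffunE; case: (l x) px; case: (nb F V x) => [|[|?]]; case: (nb F V y) => [|[|?]].
  - apply/psiP => a; rewrite ffunE; suff : (nb F V a <= 1)%N by case: (nb _ _ _) => [|[|?]].
    case ax: (E a x); last by rewrite -noff ?ax // pE; case: (l a).
    case/orP: (two a ax) => /(eq_nb V eF) ->; by case: (l x) px; lia.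
- have nx : nb F V x = (nb E V x + nb E V y)%N.
    by apply: nb_join (negbT Exy) _ => //; apply: surgery_joinE => //; exact: surgery_sym.
  have FE : F =2 join E x y by apply: surgery_joinE => //; exact: surgery_sym.
  have xny a : E a x -> E a y = false.
    by move=> ax; apply/negP => ay; move: Exy; rewrite -(equivE x eE ay) sE ax.
  have Fx a : E a x -> F a x by rewrite FE => ?; apply: join_sub.
  have Fy a : E a y -> F a x by move=> ay; rewrite FE /join rE ay !orbT.
  rewrite !par_psi //.
  (* A merge: the two derivatives are never both 1 at [V], since they require different numbers of
     points on the circle of [x]; so their sum in [F_2] is a disjunction. *)
  have F2or (b1 b2 b3 : bool) : ~~ (b2 && b3) -> b1 = b2 || b3 ->
     b1%:R = b2%:R + b3%:R :> 'F_2.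
    by case: b1; case: b2; case: b3 => //= _ _; rewrite ?addr0 ?add0r.
  apply: F2or.
  + apply/negP => /andP[/forallP/(_ x) H1 /forallP/(_ x) H2].
    by move: H1 H2; rewrite rE Exy; lia.
  + apply/idP/idP => [/andP[/andP[/forallP off mc] /psiP pF]|].
      have offN a : ~~ E a x -> ~~ E a y -> nb E V a = l a.
        move=> ax ay; rewrite (nb_off V S) // pF.
        by have := off a; rewrite ax ay => /eqP->.
      have := pF x; rewrite nx; move: mc.
      case: (boolP ((nb E V x == 0%N) && l x && (nb E V y == l y :> nat))).
        move=> /andP[/andP[/eqP n0 lx] /eqP ny] _ _; apply/orP; left.
        apply/forallP => a; case ax: (E a x).
          by rewrite (eq_nb V eE ax) n0 (lE _ _ ax) lx.
        case ay: (E a y); first by rewrite (eq_nb V eE ay) ny addn0 (lE _ _ ay).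
        by rewrite offN ?ax ?ay // addn0.
      case: (boolP ((nb E V y == 0%N) && l y && (nb E V x == l x :> nat))).
        move=> /andP[/andP[/eqP n0 ly] /eqP nx'] _ _ _; apply/orP; right.
        apply/forallP => a; case ay: (E a y).
          by rewrite (eq_nb V eE ay) n0 (lE _ _ ay) ly.
        case ax: (E a x); first by rewrite (eq_nb V eE ax) nx' addn0 (lE _ _ ax).
        by rewrite offN ?ax ?ay // addn0.
      move=> H1 H2 mc px; exfalso; move: H1 H2 mc px; rewrite /m_coef.
      by case: (l x); case: (l y); case: (trace F V x); case: (nb E V x) => [|[|?]]; case: (nb E V y) => [|[|?]].
    have [Exx Eyy Eyx] : [/\ E x x, E y y & E y x = false] by rewrite !rE sE.
    case/orP => /forallP H; have := H x; have := H y;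
      rewrite ?Exx ?Eyy ?Exy ?Eyx => Hy Hx.
    * have trx : trace F V x = l y.
        by rewrite ffunE nx; case: (l x) Hx Hy; case: (l y); lia.
      have Nx : nb F V x = l y by rewrite nx; case: (l x) Hx Hy; case: (l y); lia.
      have offN a : ~~ E a x -> ~~ E a y -> nb F V a = l a.
        by move=> ax ay; rewrite -(nb_off V S) //; have := H a; rewrite (negbTE ax) addn0 => /eqP.
      apply/andP; split; [apply/andP; split|].
      - apply/forallP => z; apply/implyP => /andP[zx zy].
        by rewrite ffunE offN //; case: (l z).
      - by rewrite trx; case: (l x) Hx; case: (l y) => //; lia.
      - apply/psiP => a; rewrite ffunE; suff : (nb F V a <= 1)%N by case: (nb _ _ _) => [|[|?]].
        case ax: (E a x); first by rewrite (eq_nb V eF (Fx _ ax)) Nx; case: (l y).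
        case ay: (E a y); first by rewrite (eq_nb V eF (Fy _ ay)) Nx; case: (l y).
        by rewrite offN ?ax ?ay //; case: (l a).
    * have trx : trace F V x = l x.
        by rewrite ffunE nx; case: (l x) Hx Hy; case: (l y); lia.
      have Nx : nb F V x = l x by rewrite nx; case: (l x) Hx Hy; case: (l y); lia.
      have offN a : ~~ E a x -> ~~ E a y -> nb F V a = l a.
        by move=> ax ay; rewrite -(nb_off V S) //; have := H a; rewrite (negbTE ay) addn0 => /eqP.
      apply/andP; split; [apply/andP; split|].
      - apply/forallP => z; apply/implyP => /andP[zx zy].
        by rewrite ffunE offN //; case: (l z).
      - by rewrite trx; case: (l y) Hy; case: (l x) => //; lia.
      - apply/psiP => a; rewrite ffunE; suff : (nb F V a <= 1)%N by case: (nb _ _ _) => [|[|?]].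
        case ax: (E a x); first by rewrite (eq_nb V eF (Fx _ ax)) Nx; case: (l x).
        case ay: (E a y); first by rewrite (eq_nb V eF (Fy _ ay)) Nx; case: (l x).
        by rewrite offN ?ax ?ay //; case: (l a).
Qed.

End Surgery.

(** * Two changes of marker commute *)

Section Square.
Variable A : finType.
Implicit Types (E F : rel A) (l m : {ffun A -> bool}) (V : {set A}).

Lemma join_exchange E x y z w : is_equiv E -> ~~ E z w -> join E x y z w -> 
  (E z x && E w y) || (E z y && E w x).
Proof. by case=> _ sE _ /negbTE zw; rewrite /join zw !(sE w). Qed.

Lemma join_swap E x y z w : is_equiv E -> ~~ E x y ->
  ~~ E z w -> join E x y z w -> join E z w x y.
Proof.
move=> eE xy zw /(join_exchange eE zw); have [_ sE _] := eE; rewrite /join !(sE x) !(sE y).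
by case/orP=> /andP[-> ->]; rewrite ?orbT.
Qed.

Section Commute.
(** The first index tells whether the change at [x], [y] has been made, the second one whether the
    change at [z], [w] has. The condition on [f] says that a derivative depends only on the circle
    of the variable. *)
Variables (E00 E10 E01 E11 : rel A) (x y z w : A).
Hypothesis c0 : surgery E00 E10 x y.
Hypothesis e0 : surgery E00 E01 z w.
Hypothesis e1 : surgery E10 E11 z w.
Hypothesis c1 : surgery E01 E11 x y.
Variable f : {set A} -> 'F_2.
Hypothesis f_inv : forall a b, E00 a b -> par a f =1 par b f.

Let parD a (g h : {set A} -> 'F_2) V :
  par a (fun W => g W + h W) V = par a g V + par a h V.
Proof. by rewrite /par mulrDr. Qed.

Let par0' a (g : {set A} -> 'F_2) V : g =1 (fun=> 0) -> par a g V = 0.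
Proof. by move=> g0; rewrite /par g0 mulr0. Qed.

Let zero a b : E00 a b -> forall V, par a f V + par b f V = 0.
Proof. by move=> /f_inv ab V; rewrite ab addF2. Qed.

Lemma eq_surger F a b (g h : {set A} -> 'F_2) : g =1 h -> surger F a b g =1 surger F a b h.
Proof. by move=> gh V; rewrite /surger /par !gh. Qed.

(** Both sides vanish: each of the pairs [x], [y] and [z], [w] already lies on one circle of [E00],
    so on either side a sum of two equal derivatives is applied to [f]. *)
Lemma surger_comm_half : E11 x y -> E11 z w -> ~~ E10 x y ->
  surger E11 z w (surger E10 x y f) =1 surger E11 x y (surger E01 z w f).
Proof.
move=> xy11 zw11 xy10 V.
have [eE00 eE10 _ _] := c0; have [_ eE11 _ _] := e1; have [_ eE01 _ _] := e0.
have xy00 : E00 x y by have [_ _ _] := c0; rewrite (negbTE xy10) orbF.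
have zw00 : E00 z w.
  rewrite (surgery_joinE c0 xy00) join_swap //.
    apply: contraTN xy11 => zw10; rewrite -(join_id eE11 zw11 x y).
    have [_ _ H _] := e1; rewrite -H (join_id eE10 zw10); exact: xy10.
  by have [_ _ H _] := e1; rewrite H; apply: join_sub.
rewrite /surger xy11 zw11 (negbTE xy10) (zero zw00); case: (E01 z w); last by rewrite (zero xy00).
by rewrite !par0' ?addr0 // => W; rewrite (zero zw00).
Qed.

(** The change at [z], [w] is the identity along both paths, and the derivatives at [x] and [y] are
    applied once on each side. *)
Lemma surger_comm_half' : E11 x y -> ~~ E11 z w ->
  surger E11 z w (surger E10 x y f) =1 surger E11 x y (surger E01 z w f).
Proof.
move=> xy11 zw11 V.
have [eE00 eE10 _ _] := c0; have [_ eE11 _ zwor] := e1; have [_ eE01 _ _] := e0.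
have zw10 : E10 z w by rewrite (negbTE zw11) orbF in zwor.
have E10E := surgery_joinE e1 zw10.
have xy10 : E10 x y by rewrite E10E; apply: join_sub.
rewrite /surger xy11 xy10 (negbTE zw11); case zw01: (E01 z w) => //.
have E11E := surgery_joinE (surgery_sym c1) xy11.
by case/negP: zw11; rewrite E11E; apply: join_sub.
Qed.

(** Each path ends with a split, so one side is the sum of the derivatives at [x] and [y], the other
    that at [z] and [w]. Either both pairs are joined in [E00] and both sums vanish, or both pairs
    link the same two circles and the sums agree term by term. *)
Lemma surger_comm_half'' : ~~ E11 x y -> ~~ E11 z w -> E10 x y ->
  surger E11 z w (surger E10 x y f) =1 surger E11 x y (surger E01 z w f).
Proof.
move=> xy11 zw11 xy10 V.
have [eE00 eE10 _ xyor] := c0; have [_ eE11 _ zwor] := e1; have [_ eE01 _ zwor'] := e0.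
have zw10 : E10 z w by rewrite (negbTE zw11) orbF in zwor.
have xy01 : E01 x y by have [_ _ _] := c1; rewrite (negbTE xy11) orbF.
have zw01 : E01 z w.
  rewrite (surgery_joinE c1 xy01); apply: join_swap => //.
  by rewrite -(surgery_joinE e1).
rewrite /surger (negbTE xy11) (negbTE zw11) xy10 zw01.
case xy00: (E00 x y).
  have zw00 : E00 z w by rewrite (surgery_joinE c0 xy00); apply: join_sub.
  by rewrite (zero xy00) (zero zw00).
have zw00 : ~~ E00 z w.
  apply: contraFN xy00 => zw00; rewrite (surgery_joinE e0 zw00).
  exact: join_sub.
have : join E00 x y z w.
  by have [_ _ H _] := c0; rewrite H; apply: join_sub.
case/(join_exchange eE00 zw00)/orP => /andP[/f_inv H1 /f_inv H2]; rewrite -H1 -H2 //.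
by rewrite addrC.
Qed.

End Commute.

(** If both pairs are joined at all stages that count, this is the commutation of partial
    derivatives. The other configurations are degenerate, up to exchanging the two changes. *)
Lemma surger_comm (E00 E10 E01 E11 : rel A) x y z w (f : {set A} -> 'F_2) :
  surgery E00 E10 x y -> surgery E00 E01 z w ->
  surgery E10 E11 z w -> surgery E01 E11 x y ->
  (forall a b, E00 a b -> par a f =1 par b f) ->
  surger E11 z w (surger E10 x y f) =1 surger E11 x y (surger E01 z w f).
Proof.
move=> c0 e0 e1 c1 fi V.
case xy11: (E11 x y); case zw11: (E11 z w).
- case xy10: (E10 x y); last by apply: (surger_comm_half c0); rewrite ?xy10.
  case zw01: (E01 z w); last by symmetry; apply: (surger_comm_half e0); rewrite ?zw01.
  rewrite /surger xy11 zw11 xy10 zw01.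
  have parD a (g h : {set A} -> 'F_2) : par a (fun W => g W + h W) V = par a g V + par a h V.
    by rewrite /par mulrDr.
  by rewrite !parD !(parC z) !(parC w) addrACA.
- by apply: (surger_comm_half' c0); rewrite ?zw11.
- by symmetry; apply: (surger_comm_half' e0); rewrite ?xy11.
case xy10: (E10 x y); first by apply: (surger_comm_half'' c0); rewrite ?xy11 ?zw11.
case zw01: (E01 z w).
  by symmetry; apply: (surger_comm_half'' e0); rewrite ?xy11 ?zw11.
by rewrite /surger xy11 zw11 xy10 zw01.
Qed.

End Square.

(** * Sums of the degrees of labels *)

Section Tau.
Variable A : finType.
Implicit Types (E F : rel A) (l m : {ffun A -> bool}).

Definition rel_classes E : {set {set A}} := [set class E a | a : A].

Definition deg E l : int := \sum_(C in rel_classes E) pm [exists a in C, l a].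

Lemma exists_class E l a : is_equiv E -> respects E l ->
  [exists b in class E a, l b] = l a.
Proof.
move=> [rE _ _] lE; apply/existsP/idP => [[b /andP[]]|la].
  by rewrite mem_class => /lE->.
by exists a; rewrite mem_class rE.
Qed.

(** No relation is imposed between the labels of the circles involved, so that a split is covered
    too, as a merge from [F] to [E]. The circles away from [x] and [y] cancel from the identity. *)
Lemma deg_join E F x y l m : is_equiv E -> is_equiv F -> ~~ E x y -> F =2 join E x y ->
  respects E l -> respects F m ->
  (forall z, ~~ E z x -> ~~ E z y -> m z = l z) ->
  deg F m + pm (l x) + pm (l y) = deg E l + pm (m x).
Proof.
move=> eE eF xy FE lE mF off; have [rE sE tE] := eE; have [rF sF tF] := eF.
have Fxy : F x y by rewrite FE /join !rE orbT.
have S : surgery E F x y.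
  split=> //; last by rewrite Fxy orbT.
  by move=> a b; rewrite (join_id eF Fxy).
pose R := rel_classes E :\ class E x :\ class E y.
have inR C : C \in R -> exists2 a, C = class E a & ~~ E a x && ~~ E a y.
  rewrite !inE => /and3P[Cy Cx /imsetP[a _ Ca]]; exists a => //.
  apply/andP; split; apply/negP => ax.
    by case/eqP: Cx; rewrite Ca; apply: eq_class.
  by case/eqP: Cy; rewrite Ca; apply: eq_class.
have Rcl a : ~~ E a x -> ~~ E a y -> class E a = class F a.
  by move=> ax ay; apply/setP => b; rewrite !mem_class (surgery_off _ S).
have FR : rel_classes F = class F x |: R.
  apply/setP => C; apply/idP/idP.
    case/imsetP => a _ ->; rewrite in_setU1.
    case ax: (E a x); first by rewrite (eq_class eF (_ : F a x)) ?eqxx // FE join_sub.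
    case ay: (E a y).
      by rewrite (eq_class eF (_ : F a x)) ?eqxx // FE /join ay rE !orbT.
    rewrite -Rcl ?ax ?ay // !inE.
    apply/orP; right; apply/and3P; split; last by apply/imsetP; exists a.
      apply: contraFN ay => /eqP/setP/(_ y); rewrite !mem_class rE; by [].
    by apply: contraFN ax => /eqP/setP/(_ x); rewrite !mem_class rE.
  rewrite in_setU1 => /predU1P[->|/inR[a -> /andP[ax ay]]]; first by apply/imsetP; exists x.
  by rewrite Rcl //; apply/imsetP; exists a.
have xR : class F x \notin R.
  apply/negP => /inR[a Ea /andP[ax _]]; move: (mem_class F x x).
  by rewrite Ea mem_class (negbTE ax) rF.
have ER : rel_classes E = class E x |: (class E y |: R).
  have yx : class E y \in rel_classes E :\ class E x.
    rewrite !inE; apply/andP; split; last by apply/imsetP; exists y.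
    by apply: contra xy => /eqP/setP/(_ y); rewrite !mem_class rE => /esym.
  rewrite /R setD1K // setD1K //; by apply/imsetP; exists x.
have yR : class E y \notin R by rewrite !inE eqxx.
have xyR : class E x \notin class E y |: R.
  rewrite in_setU1 negb_or; apply/andP; split.
    by apply: contra xy => /eqP/setP/(_ y); rewrite !mem_class rE.
  by rewrite !inE eqxx /= andbF.
rewrite /deg FR ER !big_setU1 //= !exists_class //.
suff -> : \sum_(C in R) pm [exists a in C, m a] = \sum_(C in R) pm [exists a in C, l a] by ring.
apply: eq_bigr => C /inR[a -> /andP[ax ay]].
by rewrite (exists_class a eE lE) Rcl // (exists_class a eF mF) off.
Qed.

(** Both [m] and [Delta] have degree -1, which the gain of one in homological degree compensates in
    the quantum degree. *)
Lemma inc_deg E F x y l m : surgery E F x y -> respects E l -> respects F m ->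
  inc E F x y l m -> deg F m = deg E l - 1.
Proof.
move=> S lE mF /andP[/forallP off]; have [eE eF _ _] := S.
case Exy: (E x y); case Fxy: (F x y) => // D.
  have offF z : ~~ F z x -> ~~ F z y -> l z = m z.
    move=> zx zy; have := off z; rewrite !(surgery_joinE S Exy) /join (negbTE zx) (negbTE zy) /=.
    by move=> /eqP.
  have /eqP := deg_join eF eE (negbT Fxy) (surgery_joinE S Exy) mF lE offF.
  move: D; rewrite /Delta_coef; case: (l x); case: (m x); case: (m y) => //= _; lia.
have offE z : ~~ E z x -> ~~ E z y -> m z = l z.
  by move=> zx zy; have := off z; rewrite zx zy => /eqP.
have /eqP := deg_join eE eF (negbT Exy) (surgery_joinE (surgery_sym S) Fxy) lE mF offE.
move: D; rewrite /m_coef; case: (l x); case: (l y); case: (m x) => //= _; lia.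
Qed.

End Tau.

Section Transversal.
Variable A : finType.
Implicit Types (E F : rel A) (l m : {ffun A -> bool}) (V : {set A}).

(** A transversal of the circles labelled [1]. It gives a monomial that occurs in the polynomial of
    [l] and of no other labelling, so evaluating there extracts one coefficient. *)
Lemma psi_exists E l : is_equiv E -> respects E l -> exists V, psi E l V.
Proof.
move=> eE lE; have [rE sE tE] := eE.
pose rep a := odflt a [pick b | E a b].
have Erep a : E a (rep a) by rewrite /rep; case: pickP => //= /(_ a); rewrite rE.
have rep_eq a b : E a b -> rep a = rep b.
  move=> ab; rewrite /rep (eq_pick (Q := E b)).
    by case: pickP => //= /(_ b); rewrite rE.
  by move=> c; rewrite /= sE (equivE c eE ab) sE.
exists [set a | l a && (rep a == a)]; apply/psiP => a; rewrite /nb.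
case la: (l a).
  apply/eqP/cards1P; exists (rep a); apply/setP => b; rewrite !inE.
  apply/andP/eqP => [[/andP[_ /eqP rb] ab]|->]; first by rewrite (rep_eq _ _ ab) rb.
  by rewrite Erep -(lE _ _ (Erep a)) la -(rep_eq _ _ (Erep a)) eqxx.
apply/eqP; rewrite cards_eq0; apply/eqP/setP => b; rewrite !inE.
by case ab: (E a b); rewrite ?andbF // -(lE _ _ ab) la.
Qed.

Lemma sum_inc_psi E F x y l V (okF : pred {ffun A -> bool}) :
  surgery E F x y -> respects E l -> (forall m, okF m <-> respects F m) ->
  \sum_(m | okF m) (inc E F x y l m)%:R * (psi F m V)%:R
  = surger F x y (fun W => (psi E l W)%:R) V :> 'F_2.
Proof.
move=> S lE okFP; rewrite -(psi_inc V S lE); have [_ eF _ _] := S.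
rewrite (bigD1 (trace F V)) /=; last by apply/okFP/trace_respects.
rewrite -natrM mulnb big1 ?addr0 // => m /andP[_ mt].
rewrite -natrM mulnb; case pm: (psi F m V); rewrite ?andbF //.
by rewrite (psi_trace pm) eqxx in mt.
Qed.

Lemma surger_sum F x y (J : finType) (p : pred J) (c : J -> 'F_2) (f : J -> {set A} -> 'F_2) V :
  surger F x y (fun W => \sum_(j | p j) c j * f j W) V =
  \sum_(j | p j) c j * surger F x y (f j) V.
Proof.
rewrite /surger /par; case: ifP => // _; rewrite !mulr_sumr -big_split /=.
by apply: eq_bigr => j _; rewrite mulrDr !(mulrCA (c j)).
Qed.

(** Both composites are evaluated at a transversal of [n], which turns the coefficients at [n] into
    values of iterated [surger] and the claim into [surger_comm]. *)
Lemma inc_square E00 E10 E01 E11 x y z w (ok10 ok01 : pred {ffun A -> bool}) l n :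
  surgery E00 E10 x y -> surgery E00 E01 z w ->
  surgery E10 E11 z w -> surgery E01 E11 x y ->
  (forall m, ok10 m <-> respects E10 m) -> (forall m, ok01 m <-> respects E01 m) ->
  respects E00 l -> respects E11 n ->
  \sum_(m | ok10 m) (inc E00 E10 x y l m)%:R * (inc E10 E11 z w m n)%:R =
  \sum_(m | ok01 m) (inc E00 E01 z w l m)%:R * (inc E01 E11 x y m n)%:R :> 'F_2.
Proof.
move=> c0 e0 e1 c1 ok10P ok01P lE nE.
have [eE00 eE11] : is_equiv E00 /\ is_equiv E11 by case: c0 e1 => ? _ _ _ [].
have [V nV] := psi_exists eE11 nE.
pose ok11 m := [forall a, forall b, E11 a b ==> (m a == m b)].
have ok11P m : ok11 m <-> respects E11 m.
  split=> [H a b ab|H].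
    by have /forallP/(_ a)/forallP/(_ b) := H; rewrite ab => /eqP.
  by apply/forallP => a; apply/forallP => b; apply/implyP => /H ->.
(* Among the labellings of the circles of [E11], only [n] is seen by [V]. *)
have at_n (f : {ffun A -> bool} -> 'F_2) : \sum_(m | ok11 m) f m * (psi E11 m V)%:R = f n.
  rewrite (bigD1 n) /= ?nV ?mulr1; last exact: (proj2 (ok11P n) nE).
  rewrite big1 ?addr0 // => m /andP[_ mn].
  case mV: (psi E11 m V); rewrite ?mulr0 //.
  by rewrite (psi_trace nV) (psi_trace mV) eqxx in mn.
have half (E : rel A) a b a' b' (ok : pred {ffun A -> bool}) : surgery E00 E a b -> surgery E E11 a' b' ->
    (forall m, ok m <-> respects E m) ->
    \sum_(m | ok m) (inc E00 E a b l m)%:R * (inc E E11 a' b' m n)%:R =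
    surger E11 a' b' (surger E a b (fun W => (psi E00 l W)%:R)) V.
  move=> S1 S2 okP.
  transitivity (surger E11 a' b' (fun W => \sum_(m | ok m) (inc E00 E a b l m)%:R * (psi E m W)%:R) V); last first.
    by apply: eq_surger => W; apply: sum_inc_psi.
  rewrite surger_sum; apply: eq_bigr => m /okP mE; congr (_ * _).
  by rewrite -(sum_inc_psi V S2 mE ok11P) (at_n (fun m' => (inc E E11 a' b' m m')%:R)).
rewrite (half _ _ _ _ _ _ c0 e1) // (half _ _ _ _ _ _ e0 c1) //.
by apply: (surger_comm c0 e0 e1 c1) => a b ab W; apply: par0.
Qed.

End Transversal.

(** * The cube of an arc diagram *)

(* A crossing [(k, (a, a'), (b, b'))] of two strands, one made of the arcs [a]
   and [a'], the other of [b] and [b']: the marker [k] glues [a] to [b'] and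
   [a'] to [b], the other marker glues [a] to [b] and [a'] to [b']. *)
Definition crossing (A : Type) : Type := bool * (A * A) * (A * A).

Record arc_diagram (A I : Type) := ArcDiagram {
  base_l : A;
  base_r : A;
  cr : I -> crossing A
}.

Section ArcDiagram.
Variables (A I : finType) (D : arc_diagram A I).
Implicit Types (s t : {ffun I -> bool}) (l m : {ffun A -> bool}).

Definition smoothed (X : crossing A) (b : bool) (l : A -> bool) : bool :=
  let: (k, (a, a'), (c, c')) := X in
  if b == k then (l a == l c') && (l a' == l c) else (l a == l c) && (l a' == l c').

Definition compat s l : bool :=
  (l (base_l D) == l (base_r D)) && [forall c, smoothed (cr D c) (s c) l].

(** Circles without paths: being on one circle means not being separated by any compatible
    labelling. A change of diagram then only requires labellings to be extended or restricted. *)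
Definition eqv s : rel A := fun a b => [forall l, compat s l ==> (l a == l b)].

Definition cx c : A := (cr D c).1.2.1.
Definition cy c : A := (cr D c).1.2.2.

(** Each arc has two ends, at crossings or at the base point, so each label is counted an even
    number of times once the two ends at the base point agree. This is the global property of words
    behind [d^2 = 0]. *)
Definition evenly_crossed := forall l, l (base_l D) = l (base_r D) ->
  \big[addb/false]_c (l (cr D c).1.2.1 (+) l (cr D c).1.2.2 (+) l (cr D c).2.1 (+) l (cr D c).2.2) = false.

Lemma eqvP s a b : reflect (forall l, compat s l -> l a = l b) (eqv s a b).
Proof. by apply: (iffP forallP) => H l; [move=> /(implyP (H l))/eqP | apply/implyP => /H ->]. Qed.

Lemma eqv_equiv s : is_equiv (eqv s).
Proof.
split.
- by move=> a; apply/eqvP.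
- by move=> a b; apply/eqvP/eqvP => H l /H ->.
- by move=> b a c /eqvP ab /eqvP bc; apply/eqvP => l cl; rewrite ab // bc.
Qed.

Lemma compat_respects s l : compat s l <-> respects (eqv s) l.
Proof.
split=> [cl a b /eqvP H|H]; first exact: H.
have H' a b : (forall l', compat s l' -> l' a = l' b) -> l a == l b by move=> /eqvP/H ->.
apply/andP; split; first by apply: H' => l' /andP[/eqP].
apply/forallP => c; rewrite /smoothed; case Dc: (cr D c) => [[k [a a']] [b b']].
case sk: (s c == k); apply/andP; split; apply: H' => l' /andP[_ /forallP/(_ c)];
  by rewrite /smoothed Dc sk => /andP[/eqP ? /eqP ?].
Qed.

Lemma joinP s x y a b :
  reflect (forall l, compat s l -> l x = l y -> l a = l b) (join (eqv s) x y a b).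
Proof.
have eE := eqv_equiv s; have [rE sE tE] := eE.
apply: (iffP idP) => [H l /compat_respects lE xy|H].
  by case/or3P: H => [/lE //|/andP[/lE-> /lE->]|/andP[/lE-> /lE->]].
pose l : {ffun A -> bool} := [ffun z => join (eqv s) x y a z].
have lE : respects (eqv s) l.
  move=> z z' zz'; rewrite !ffunE /join (equivE a eE zz') !(sE z) !(sE z').
  by rewrite (equivE x eE zz') (equivE y eE zz').
have := H l (proj2 (compat_respects s l) lE); rewrite !ffunE => ab.
rewrite -ab; first by rewrite /join rE.
rewrite /join !rE (sE y x) !andbT.
by case: (eqv s a x); case: (eqv s a y); case: (eqv s x y).
Qed.

(** Joining the two arcs of the first strand makes both smoothings of [c] impose the same condition,
    whence equal joins. That these arcs are never separated both before and after comes from the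
    parity of the ends. *)
Lemma eqv_surgery s t c : evenly_crossed ->
  (forall e, e != c -> t e = s e) -> t c = ~~ s c ->
  surgery (eqv s) (eqv t) (cx c) (cy c).
Proof.
move=> par ts tc; split; try exact: eqv_equiv.
  have E l : l (cx c) = l (cy c) -> compat s l = compat t l.
    move=> xy; rewrite /compat; congr (_ && _); apply: eq_forallb => e.
    have [->|/ts -> //] := eqVneq e c.
    move: xy; rewrite /cx /cy /smoothed tc; case: (cr D c) => [[k [a a']] [b b']] /= <-.
    by case: (s c); case: k => /=; rewrite andbC.
  by move=> a b; apply/joinP/joinP => H l cl xy; apply: H => //; [rewrite E | rewrite -E].
apply/negPn; rewrite negb_or; apply/negP => /andP[/forallPn[l] + /forallPn[m]].
rewrite !negb_imply => /andP[/andP[/eqP l0 /forallP cl] lxy] /andP[/andP[/eqP m0 /forallP cm] mxy].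
(* [K] is the intersection of the two sides cut out by the separating labellings [l] and [m]. At [c]
   it contains exactly one of the four ends; at every other crossing the smoothing is common to [l]
   and [m], so the ends in [K] come in pairs. The total is odd, a contradiction. *)
pose K : {ffun A -> bool} := [ffun a => (l a (+) l (cy c)) && (m a (+) m (cy c))].
have := par K; rewrite !ffunE l0 m0 => /(_ erefl); rewrite (bigD1 c) //=.
rewrite big1 ?addbF => [|e ec].
  have := cl c; have := cm c; move: lxy mxy; rewrite /K /cx /cy /smoothed tc !ffunE.
  case: (cr D c) => [[k [a a']] [b b']] /=.
  by case: (s c); case: k => /=; case: (l a); case: (l a'); case: (l b); case: (l b');
    case: (m a); case: (m a'); case: (m b); case: (m b').
have := cl e; have := cm e; rewrite /K /smoothed ts // !ffunE.
case: (cr D e) => [[k [a a']] [b b']] /=.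
by case: ifP => _ /andP[/eqP-> /eqP->] /andP[/eqP-> /eqP->];
  case: (_ && _); case: (_ && _).
Qed.

Definition state_basis := {S : {ffun I -> bool} * {ffun A -> bool} | compat S.1 S.2}.

Implicit Types S T U : state_basis.

Definition lower c s : {ffun I -> bool} := [ffun e => (e != c) && s e].
Definition step c s t : bool := s c && (t == lower c s).

Definition inc_at c S T : bool :=
  step c (val S).1 (val T).1 &&
  inc (eqv (val S).1) (eqv (val T).1) (cx c) (cy c) (val S).2 (val T).2.

Definition negs s : nat := \sum_c (~~ s c : nat).

(** [n0] and [n1] stand for the number of negative crossings and the writhe. They are parameters
    because the marker [k] of an abstract crossing depends on the directions given to its strands,
    and is not a sign. *)
Definition cube (n0 n1 : int) : based_complex :=
  BasedComplex (fun S : state_basis => (negs (val S).1)%:Z - n0)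
    (fun S : state_basis => n1 + ((negs (val S).1)%:Z - n0) + deg (eqv (val S).1) (val S).2)
    (fun S T : state_basis => \sum_c (inc_at c S T)%:R).

Lemma step_surgery c s t : evenly_crossed -> step c s t ->
  surgery (eqv s) (eqv t) (cx c) (cy c).
Proof.
move=> par /andP[sc /eqP->]; apply: eqv_surgery => // [e ec|]; rewrite ffunE ?ec ?eqxx //.
by rewrite sc.
Qed.

Lemma step_negs c s t : step c s t -> negs t = (negs s).+1.
Proof.
move=> /andP[sc /eqP->]; rewrite /negs (bigD1 c) //= ffunE eqxx [in RHS](bigD1 c) //= sc.
rewrite add0n add1n; congr _.+1; apply: eq_bigr => e ec; by rewrite ffunE ec.
Qed.

Lemma cube_homog n0 n1 S T : evenly_crossed ->
  (dcoef (b := cube n0 n1) S T) != 0 -> hgr (b := cube n0 n1) T = hgr (b := cube n0 n1) S + 1 /\ qgr (b := cube n0 n1) T = qgr (b := cube n0 n1) S.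
Proof.
move=> par /=; have [c ST|none] := pickP [pred c | inc_at c S T]; last first.
  by rewrite big1 ?eqxx // => c _; have /= -> := none c.
have /andP[st iST] := ST.
have dST := inc_deg (step_surgery par st) (proj1 (compat_respects _ _) (valP S))
  (proj1 (compat_respects _ _) (valP T)) iST.
by rewrite dST (step_negs st) intS => _; split; ring.
Qed.

Lemma sum_basis s (F : {ffun A -> bool} -> 'F_2) (G : state_basis -> 'F_2) :
  (forall U, (val U).1 = s -> G U = F (val U).2) -> (forall U, (val U).1 != s -> G U = 0) ->
  \sum_U G U = \sum_(m | compat s m) F m.
Proof.
move=> GF G0; rewrite (bigID (fun U : state_basis => (val U).1 == s)) /= addrC big1 ?add0r; last first.
  by move=> U; apply: G0.
rewrite [RHS](reindex_omap (fun U : state_basis => (val U).2) (fun m => insub (s, m))) /=; last first.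
  by move=> m cm; case: insubP => [U _ /= ->|] //; rewrite cm.
apply: eq_big => [U|U /eqP us]; last exact: GF.
apply/eqP/andP => [us|[]].
  by rewrite -us (valP U) -surjective_pairing valK.
by case: insubP => //= U' _ U's _ /eqP[<-]; rewrite U's.
Qed.

Lemma lowerC c e s : lower c (lower e s) = lower e (lower c s).
Proof. by apply/ffunP => x; rewrite !ffunE andbCA. Qed.

Lemma double_step c e S T : evenly_crossed ->
  \sum_U (inc_at c S U)%:R * (inc_at e U T)%:R =
  \sum_U (inc_at e S U)%:R * (inc_at c U T)%:R :> 'F_2.
Proof.
move=> par; have [<- //|ce] := eqVneq c e.
set s := (val S).1; set t := (val T).1.
case: (boolP [&& s c, s e & t == lower e (lower c s)]) => [/and3P[sc se /eqP tE]|nost]; last first.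
  rewrite !big1 // => U _; rewrite -natrM mulnb; case: andP => //; case=> /andP[/andP[a1 /eqP u1] _] /andP[/andP[a2 /eqP u2] _];
    case/negP: nost; rewrite /s /t u2 u1 a1 lowerC ?eqxx ?andbT;
    by move: a2; rewrite u1 ffunE => /andP[_ ->].
have stepc : step c s (lower c s) by rewrite /step sc eqxx.
have stepe : step e s (lower e s) by rewrite /step se eqxx.
have stepce : step e (lower c s) t by rewrite /step ffunE se eq_sym ce tE eqxx.
have stepec : step c (lower e s) t by rewrite /step ffunE sc ce tE lowerC eqxx.
have half a b : step a s (lower a s) -> step b (lower a s) t ->
   \sum_U (inc_at a S U)%:R * (inc_at b U T)%:R =
   \sum_(m | compat (lower a s) m) (inc (eqv s) (eqv (lower a s)) (cx a) (cy a) (val S).2 m)%:R *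
     (inc (eqv (lower a s)) (eqv t) (cx b) (cy b) m (val T).2)%:R :> 'F_2.
  move=> sa sb; apply: (@sum_basis (lower a s)) => U us.
    by rewrite /inc_at us sa sb.
  rewrite /inc_at; case sU: (step a _ _); rewrite ?mul0r //.
  by case/andP: sU => _ /eqP uE; rewrite uE eqxx in us.
rewrite !half //; apply: inc_square; try (exact: step_surgery); try (by move=> m; apply: compat_respects).
- exact/compat_respects/(valP S).
- exact/compat_respects/(valP T).
Qed.

Lemma sum_sym0 (J : finType) (G : J -> J -> 'F_2) :
  (forall i j, G i j = G j i) -> \sum_i \sum_j G i j = \sum_i G i i.
Proof.
move=> sG; rewrite pair_big /= (bigID (fun p => p.1 == p.2)) /=.
have -> : \sum_(p | p.1 != p.2) G p.1 p.2 = 0.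
  rewrite (bigID (fun p => (enum_rank p.1 < enum_rank p.2)%N)) /=.
  have swapK : involutive (fun p : J * J => (p.2, p.1)) by case.
  rewrite [X in _ + X](reindex_inj (inv_inj swapK)) /= -[RHS](addF2 (\sum_(p | (p.1 != p.2) && (enum_rank p.1 < enum_rank p.2)%N) G p.1 p.2)).
  congr (_ + _); apply: eq_big => [[i j]|[i j] _] /=; last exact: sG.
  rewrite -leqNgt leq_eqVlt (eq_sym j i); case: eqVneq => //= ij.
  by rewrite -(inj_eq enum_rank_inj) in ij; rewrite (negbTE (ij : _ != _ :> nat)).
rewrite addr0 (reindex (fun i => (i, i))) /=; last first.
  by exists fst => [i|[i j]] //; rewrite inE /= => /eqP ->.
by apply: eq_bigl => i; rewrite eqxx.
Qed.

(** Squares commute, so the terms with two distinct crossings cancel in pairs modulo 2; the diagonal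
    terms vanish because a marker cannot be lowered twice. *)
Lemma cube_complex n0 n1 : evenly_crossed -> is_complex (cube n0 n1).
Proof.
move=> par; split; first by apply: homog_kmx => S T; apply: cube_homog.
rewrite kmx_mul; apply/matrixP => i j; rewrite !mxE.
move: (enum_val i) (enum_val j) => S T /=.
under eq_bigr => U _ do rewrite mulr_suml; rewrite exchange_big /=.
transitivity (\sum_c \sum_e \sum_U (inc_at c S U)%:R * (inc_at e U T)%:R : 'F_2).
  apply: eq_bigr => c _; rewrite exchange_big /=; apply: eq_bigr => U _.
  by rewrite mulr_sumr.
rewrite sum_sym0; last by move=> c e; apply: double_step.
rewrite big1 // => c _; rewrite big1 // => U _; rewrite -natrM mulnb.
by case: andP => //; case=> /andP[/andP[_ /eqP uE] _] /andP[/andP[uc _] _]; rewrite uE ffunE eqxx in uc.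
Qed.

End ArcDiagram.

Section IncLemmas.
Variable A : finType.
Implicit Types (E F : rel A) (l m : {ffun A -> bool}).

Lemma eq_inc E E' F F' x y l m : E =2 E' -> F =2 F' -> inc E F x y l m = inc E' F' x y l m.
Proof.
by move=> EE FF; rewrite /inc EE FF; congr (_ && _); apply: eq_forallb => z; rewrite !EE.
Qed.

Lemma inc_repr E F x y x' y' l m : is_equiv E -> is_equiv F -> respects E l -> respects F m ->
  E x x' -> E y y' -> F x x' -> F y y' -> inc E F x y l m = inc E F x' y' l m.
Proof.
move=> eE eF lE mF Ex Ey Fx Fy; have [_ sE _] := eE; have [_ sF _] := eF.
rewrite /inc; congr (_ && _).
  by apply: eq_forallb => z; rewrite (equivE z eE Ex) (equivE z eE Ey).
rewrite (lE _ _ Ex) (lE _ _ Ey) (mF _ _ Fx) (mF _ _ Fy).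
by rewrite (equivE x eE Ey) sE (equivE y' eE Ex) sE (equivE x eF Fy) sF (equivE y' eF Fx) sF.
Qed.

Lemma inc_swap E F x y l m : is_equiv E -> is_equiv F -> respects E l -> respects F m ->
  inc E F x y l m = inc E F y x l m.
Proof.
move=> [_ sE _] [_ sF _] lE mF; rewrite /inc (sE x) (sF x); congr (_ && _).
  by apply: eq_forallb => z; rewrite andbC.
case Eyx: (E y x); case Fyx: (F y x) => //.
  by rewrite (lE _ _ Eyx) /Delta_coef; case: (l x); rewrite 1?addbC 1?andbC.
by rewrite (mF _ _ Fyx) /m_coef; case: (l x); case: (l y).
Qed.

(** This lets the other strand of a crossing be taken as reference: its arcs are glued to those of
    the first strand in one order before the change and in the opposite order after it. *)
Lemma inc_cross E F x y x' y' l m : is_equiv E -> is_equiv F -> respects E l -> respects F m ->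
  E x x' -> E y y' -> F x y' -> F y x' -> inc E F x y l m = inc E F x' y' l m.
Proof.
move=> eE eF lE mF Ex Ey Fx Fy; have [_ sE _] := eE; have [_ sF _] := eF.
rewrite /inc; congr (_ && _).
  by apply: eq_forallb => z; rewrite (equivE z eE Ex) (equivE z eE Ey).
rewrite (lE _ _ Ex) (lE _ _ Ey) (mF _ _ Fx) (mF _ _ Fy).
rewrite (equivE x eE Ey) sE (equivE y' eE Ex) sE (equivE x eF Fy) sF (equivE x' eF Fx).
case: (E x' y'); case Fxy: (F x' y') => //.
  by rewrite /Delta_coef; case: (l x'); rewrite 1?addbC 1?andbC.
by rewrite (mF _ _ Fxy).
Qed.

(** Exchanging [1] and [x] identifies the Frobenius algebra with its dual, so that [Delta] becomes
    the transpose of [m]. *)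
Lemma inc_dual E F x y l m : surgery E F x y -> respects E l -> respects F m ->
  inc F E x y [ffun a => ~~ m a] [ffun a => ~~ l a] = inc E F x y l m.
Proof.
move=> S lE mF; rewrite /inc; congr (_ && _).
  apply: eq_forallb => z; rewrite !ffunE (inj_eq negb_inj) eq_sym.
  congr (_ ==> _); apply/idP/idP => /andP[zx zy].
    by rewrite -!(surgery_off _ (surgery_sym S) zx zy) zx zy.
  by rewrite -!(surgery_off _ S zx zy) zx zy.
rewrite !ffunE; case Exy: (E x y); case Fxy: (F x y) => //.
  by rewrite (lE _ _ Exy) /m_coef /Delta_coef; case: (l y); case: (m x); case: (m y).
by rewrite (mF _ _ Fxy) /m_coef /Delta_coef; case: (m y); case: (l x); case: (l y).
Qed.

(** [1] is the unit of [m], so merging a circle labelled [1] leaves the other labels as they are.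
    With its dual for the counit, this provides the invertible blocks of all the eliminations. *)
Lemma inc_merge_unit E F x o l m : surgery E F x o -> respects E l -> respects F m ->
  ~~ E x o -> l o -> inc E F x o l m = [forall z, ~~ E z o ==> (m z == l z)].
Proof.
move=> S lE mF Exo lo; have [eE eF _] := S; rewrite (negbTE Exo) /= => Fxo.
have [rE sE tE] := eE.
rewrite /inc (negbTE Exo) Fxo lo; apply/andP/forallP => [[/forallP off mc] z|H].
  apply/implyP => zo; case zx: (E z x); last by have := off z; rewrite zx zo.
  have Fzx : F z x by rewrite (surgery_joinE (surgery_sym S) Fxo); apply: join_sub.
  by rewrite (mF _ _ Fzx) (lE _ _ zx); move: mc; rewrite /m_coef; case: (l x); case: (m x).
split; first by apply/forallP => z; apply/implyP => /andP[_ zo]; have := H z; rewrite zo.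
have := H x; rewrite Exo /= => /eqP->; by rewrite /m_coef; case: (l x).
Qed.

Lemma inc_split_counit E F x o l m : surgery E F x o -> respects E l -> respects F m ->
  ~~ F x o -> ~~ m o -> inc E F x o l m = [forall z, ~~ F z o ==> (m z == l z)].
Proof.
move=> S lE mF Fxo mo; rewrite -inc_dual // inc_merge_unit //.
- by apply: eq_forallb => z; rewrite !ffunE (inj_eq negb_inj) eq_sym.
- exact: surgery_sym.
- by move=> a b /mF ab; rewrite !ffunE ab.
- by move=> a b /lE ab; rewrite !ffunE ab.
- by rewrite ffunE.
Qed.

End IncLemmas.

Section Pull.
Variables (A C : finType) (f : C -> A).
Implicit Types (E F : rel A) (l m : {ffun A -> bool}).

Definition pull E : rel C := fun a b => E (f a) (f b).
Definition pullf l : {ffun C -> bool} := [ffun c => l (f c)].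

(** An arc outside the image of [f] imposes nothing if its label does not change, or if it shares a
    circle with an arc of the image both before and after. This compares differentials of diagrams
    that have only some arcs in common. *)
Lemma inc_pull E F x y l m cx cy :
  is_equiv E -> is_equiv F -> respects E l -> respects F m ->
  (forall z, (exists c, E z (f c) /\ F z (f c)) \/ m z = l z) ->
  E x (f cx) -> F x (f cx) -> E y (f cy) -> F y (f cy) ->
  inc E F x y l m = inc (pull E) (pull F) cx cy (pullf l) (pullf m).
Proof.
move=> eE eF lE mF cov Ex Fx Ey Fy; rewrite (inc_repr eE eF lE mF Ex Ey Fx Fy).
rewrite /inc /pull !ffunE; congr (_ && _); apply/forallP/forallP => H z.
  by have := H (f z); rewrite !ffunE.
have [[c [Ez Fz]]|->] := cov z; last by rewrite eqxx implybT.
have [_ sE _] := eE; rewrite (lE _ _ Ez) (mF _ _ Fz).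
by rewrite !(sE z) !(equivE _ eE Ez) !(sE _ (f c)); have := H c; rewrite !ffunE.
Qed.

Lemma deg_pull E l : is_equiv E -> respects E l -> (forall z, exists c, E z (f c)) ->
  deg (pull E) (pullf l) = deg E l.
Proof.
move=> eE lE cov; have [rE sE tE] := eE.
pose h (X : {set C}) : {set A} := [set a | [exists c in X, E (f c) a]].
have hcl c : h (class (pull E) c) = class E (f c).
  apply/setP => a; rewrite !inE; apply/existsP/idP => [[c' /andP[]]|ca].
    by rewrite mem_class => cc' c'a; apply: (tE _ _ _ cc').
  by exists c; rewrite mem_class /pull rE.
have epull : is_equiv (pull E).
  by split; [move=> c; apply: rE | move=> c c'; apply: sE | move=> c c' c''; apply: tE].
rewrite /deg.
have -> : rel_classes E = h @: rel_classes (pull E).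
  apply/setP => X; apply/imsetP/imsetP => [[a _ ->]|[Y /imsetP[c _ ->] ->]].
    have [c ac] := cov a; exists (class (pull E) c); first by apply/imsetP; exists c.
    by rewrite hcl; apply: eq_class.
  by exists (f c) => //; rewrite hcl.
have hinj : {in rel_classes (pull E) &, injective h}.
  move=> X Y /imsetP[c _ ->] /imsetP[c' _ ->]; rewrite !hcl => /setP/(_ (f c')).
  by rewrite !mem_class rE => cc'; apply: eq_class.
rewrite (big_imset _ hinj) /=; apply: eq_bigr => X /imsetP[c _ ->]; rewrite hcl !exists_class ?ffunE //.
by move=> a b ab; rewrite !ffunE; apply: lE.
Qed.

End Pull.

Lemma eq_deg (A : finType) (E E' : rel A) l : E =2 E' -> deg E l = deg E' l.
Proof.
move=> EE; rewrite /deg; suff -> : rel_classes E = rel_classes E' by [].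
by apply: eq_imset => a; apply/setP => b; rewrite !mem_class EE.
Qed.

Lemma state_basis_eq (A I : finType) (D : arc_diagram A I) (S T : state_basis D) :
  (val S).1 = (val T).1 -> (val S).2 = (val T).2 -> S = T.
Proof.
by move=> H1 H2; apply/val_inj; rewrite [val S]surjective_pairing H1 H2 -surjective_pairing.
Qed.

(** * Mirror images and duality *)

Section Mirror.
Variables (A I : finType).
Implicit Type D : arc_diagram A I.

Definition mirror D := ArcDiagram (base_l D) (base_r D) (fun c =>
  let: (k, p, q) := cr D c in (~~ k, p, q)).

Lemma mirror_even D : evenly_crossed D -> evenly_crossed (mirror D).
Proof.
move=> par l /par pl; rewrite -[RHS]pl; apply: eq_bigr => c _ /=.
by case: (cr D c) => [[k [? ?]] [? ?]].
Qed.

Definition negf (J : finType) (s : {ffun J -> bool}) : {ffun J -> bool} := [ffun c => ~~ s c].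

Lemma negfK (J : finType) : involutive (@negf J).
Proof. by move=> s; apply/ffunP => c; rewrite !ffunE negbK. Qed.

Lemma mirror_compat D s l : compat (mirror D) (negf s) l = compat D s l.
Proof.
rewrite /compat; congr (_ && _); apply: eq_forallb => c /=; rewrite ffunE.
by case: (cr D c) => [[k [? ?]] [? ?]] /=; rewrite (inj_eq negb_inj).
Qed.

Lemma compat_negf D s l : compat D s (negf l) = compat D s l.
Proof.
rewrite /compat !ffunE (inj_eq negb_inj); congr (_ && _); apply: eq_forallb => c.
by case: (cr D c) => [[k [? ?]] [? ?]] /=; rewrite !ffunE !(inj_eq negb_inj).
Qed.

Lemma mirror_eqv D s : eqv (mirror D) (negf s) =2 eqv D s.
Proof.
by move=> a b; apply/eqvP/eqvP => H l cl; apply: H; rewrite ?mirror_compat // -mirror_compat.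
Qed.

Lemma mirror_step (c : I) (s t : {ffun I -> bool}) : step c (negf s) (negf t) = step c t s.
Proof.
apply/andP/andP => -[]; rewrite ?ffunE => sc /eqP H.
  split; first by have := congr1 (fun h : {ffun _ -> _} => h c) H; rewrite !ffunE eqxx /= => /negbFE.
  apply/eqP/ffunP => e; have := congr1 (fun h : {ffun _ -> _} => h e) H; rewrite !ffunE.
  by have [->|_] := eqVneq e c; [rewrite (negbTE sc) | move/negb_inj].
split; first by rewrite H !ffunE eqxx.
apply/eqP/ffunP => e; rewrite H !ffunE; have [->|_] := eqVneq e c; by rewrite ?sc.
Qed.

Lemma deg_negf (E : rel A) l : is_equiv E -> respects E l -> deg E (negf l) = - deg E l.
Proof.
move=> eE lE; rewrite /deg -sumrN; apply: eq_bigr => C /imsetP[a _ ->].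
rewrite !exists_class // ?ffunE; first by case: (l a).
by move=> b c bc; rewrite !ffunE (lE _ _ bc).
Qed.

Lemma negs_negf (s : {ffun I -> bool}) : (negs (negf s))%:Z = #|I|%:Z - (negs s)%:Z.
Proof.
apply/eqP; rewrite -subr_eq opprK -PoszD /negs -big_split /= -sum1_card.
by apply/eqP; congr Posz; apply: eq_bigr => c _; rewrite ffunE; case: (s c).
Qed.

(** All markers and all labels are exchanged. Positive and negative crossings are exchanged as well,
    hence the new shifts; the differentials are transposed by [inc_dual]. *)
Lemma cube_mirror D n0 n1 : evenly_crossed D ->
  homotopy_equiv (cube (mirror D) (#|I|%:Z - n0) (- n1)) (dual (cube D n0 n1)).
Proof.
move=> par.
apply: (@homotopy_equiv_bij (cube (mirror D) _ _) (dual (cube D n0 n1)) (fun (S : state_basis (mirror D)) (T : state_basis D) =>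
  ((val S).1 == negf (val T).1) && ((val S).2 == negf (val T).2))).
- move=> S; have ok : compat D (negf (val S).1) (negf (val S).2).
    by rewrite compat_negf -mirror_compat negfK (valP S).
  by exists (exist (fun S => compat D S.1 S.2) (negf (val S).1, negf (val S).2) ok); rewrite /= !negfK !eqxx.
- move=> T; have ok : compat (mirror D) (negf (val T).1) (negf (val T).2).
    by rewrite mirror_compat compat_negf (valP T).
  by exists (exist (fun S => compat (mirror D) S.1 S.2) (negf (val T).1, negf (val T).2) ok); rewrite /= !eqxx.
- move=> S T T' /andP[/eqP S1 /eqP S2] /andP[/eqP S1' /eqP S2'].
  rewrite S1 in S1'; rewrite S2 in S2'.
  by apply: state_basis_eq; apply: (can_inj (@negfK _)).
- move=> S S' T /andP[/eqP S1 /eqP S2] /andP[/eqP S1' /eqP S2'].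
  by apply: state_basis_eq; rewrite ?S1 ?S2 ?S1' ?S2'.
- move=> S T /andP[/eqP S1 /eqP S2] /=; rewrite S1 S2 negs_negf.
  rewrite (eq_deg _ (mirror_eqv _ _)) deg_negf; [|exact: eqv_equiv|exact/compat_respects/(valP T)].
  by split; ring.
- move=> S T S' T' /andP[/eqP S1 /eqP S2] /andP[/eqP S1' /eqP S2'] /=.
  apply: eq_bigr => c _; congr (_%:R : 'F_2); congr nat_of_bool; rewrite /inc_at S1 S2 S1' S2' mirror_step.
  case st: (step c _ _) => //=.
  have surg := step_surgery par st.
  have -> : cx (mirror D) c = cx D c by rewrite /cx /=; case: (cr D c) => [[k [? ?]] [? ?]].
  have -> : cy (mirror D) c = cy D c by rewrite /cy /=; case: (cr D c) => [[k [? ?]] [? ?]].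
  rewrite (eq_inc _ _ _ _ (mirror_eqv _ _) (mirror_eqv _ _)) inc_dual //.
    exact/compat_respects/(valP T').
  exact/compat_respects/(valP T).
Qed.

End Mirror.

Lemma homotopy_equiv_mirror (A I A' I' : finType) (D : arc_diagram A I) (D' : arc_diagram A' I') n0 n1 n0' n1' :
  evenly_crossed D -> evenly_crossed D' ->
  homotopy_equiv (cube (mirror D) (#|I|%:Z - n0) (- n1)) (cube (mirror D') (#|I'|%:Z - n0') (- n1')) ->
  homotopy_equiv (cube D n0 n1) (cube D' n0' n1').
Proof.
move=> par par' H.
apply: homotopy_equiv_trans (homotopy_equiv_sym (dualK _)) _.
apply: homotopy_equiv_trans (dualK _); apply: homotopy_equiv_dual.
apply: homotopy_equiv_trans (homotopy_equiv_sym (cube_mirror n0 n1 par)) _.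
exact: homotopy_equiv_trans H (cube_mirror n0' n1' par').
Qed.

(** * Changing the presentation of a crossing *)

Section SameCrossing.
Variables (A I : finType).
Implicit Type D : arc_diagram A I.

Definition ends_parity (X : crossing A) (l : A -> bool) :=
  l X.1.2.1 (+) l X.1.2.2 (+) l X.2.1 (+) l X.2.2.

(** Besides equal smoothings and parities, the reference strand of [X'] has to be a strand of [X],
    in either direction, because the differential is read at the arcs of that strand. *)
Definition same_crossing (X X' : crossing A) :=
  [/\ forall b (l : A -> bool), smoothed X b l = smoothed X' b l,
      forall l, ends_parity X l = ends_parity X' l &
  [\/ X'.1.2 = X.1.2, X'.1.2 = (X.1.2.2, X.1.2.1), X'.1.2 = X.2 | X'.1.2 = (X.2.2, X.2.1)]].

Lemma eqv_smoothed D s c : exists E : rel A, E = eqv D s /\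
  let: (k, (a, a'), (b, b')) := cr D c in
  if s c == k then E a b' && E a' b else E a b && E a' b'.
Proof.
exists (eqv D s); split=> //; case Dc: (cr D c) => [[k [a a']] [b b']].
by case: ifP => sk; apply/andP; split; apply/eqvP => l /andP[_ /forallP/(_ c)];
  rewrite /smoothed Dc sk => /andP[/eqP ? /eqP ?].
Qed.

Lemma cube_same D D' n0 n1 : evenly_crossed D ->
  base_l D' = base_l D -> base_r D' = base_r D ->
  (forall c, same_crossing (cr D c) (cr D' c)) ->
  homotopy_equiv (cube D n0 n1) (cube D' n0 n1).
Proof.
move=> par b0 b1 DD.
have cE s l : compat D' s l = compat D s l.
  rewrite /compat b0 b1; congr (_ && _); apply: eq_forallb => c.
  by have [-> _ _] := DD c.
have eE s : eqv D' s =2 eqv D s by move=> a b; apply: eq_forallb => l; rewrite cE.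
apply: (@homotopy_equiv_bij (cube D _ _) (cube D' _ _)
  (fun (S : state_basis D) (T : state_basis D') => val S == val T)).
- move=> S; have ok : compat D' (val S).1 (val S).2 by rewrite cE (valP S).
  by exists (exist (fun S => compat D' S.1 S.2) (val S) ok).
- move=> S; have ok : compat D (val S).1 (val S).2 by rewrite -cE (valP S).
  by exists (exist (fun S => compat D S.1 S.2) (val S) ok).
- by move=> S T T' /eqP ST /eqP ST'; apply/val_inj; rewrite -ST.
- by move=> S S' T /eqP ST /eqP ST'; apply/val_inj; rewrite ST.
- by move=> S T /eqP ST /=; rewrite ST (eq_deg _ (eE _)).
move=> S T S' T' /eqP ST /eqP ST' /=; apply: eq_bigr => c _; congr (_%:R : 'F_2); congr nat_of_bool.
rewrite /inc_at -ST -ST'; case st: (step c _ _) => //=.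
rewrite (eq_inc _ _ _ _ (eE _) (eE _)).
have lS := proj1 (compat_respects _ _ _) (valP S); have lS' := proj1 (compat_respects _ _ _) (valP S').
have eS := eqv_equiv D (val S).1; have eS' := eqv_equiv D (val S').1.
have [_ sE _] := eS; have [_ sF _] := eS'.
have [E [EE sm]] := eqv_smoothed D (val S).1 c; have [F [FF sm']] := eqv_smoothed D (val S').1 c.
have s'c : (val S').1 c = ~~ (val S).1 c.
  by case/andP: st => -> /eqP ->; rewrite ffunE eqxx.
rewrite s'c in sm'; rewrite -EE -FF in lS lS' eS eS' sE sF *.
have [_ _] := DD c; rewrite /cx /cy; case: (cr D c) sm sm' => [[k [a a']] [b b']] /= sm sm'.
case; case: (cr D' c) => [[k' [c1 c2]] [c3 c4]] /= [-> ->] //.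
- exact: inc_swap.
- move: sm sm'; case: (_ c); case: k => /= /andP[H1 H2] /andP[H3 H4].
  + by rewrite inc_swap //; apply: inc_cross.
  + by apply: inc_cross.
  + by apply: inc_cross.
  + by rewrite inc_swap //; apply: inc_cross.
- move: sm sm'; case: (_ c); case: k => /= /andP[H1 H2] /andP[H3 H4].
  + by apply: inc_cross.
  + by rewrite inc_swap //; apply: inc_cross.
  + by rewrite inc_swap //; apply: inc_cross.
  + by apply: inc_cross.
Qed.

Lemma even_same D D' :
  base_l D' = base_l D -> base_r D' = base_r D ->
  (forall c, same_crossing (cr D c) (cr D' c)) -> evenly_crossed D -> evenly_crossed D'.
Proof.
move=> b0 b1 DD even l; rewrite b0 b1 => /even H; rewrite -[RHS]H; apply: eq_bigr => c _.
by have [_ H' _] := DD c; have := H' l; rewrite /ends_parity => ->.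
Qed.

Lemma same_crossing_refl X : same_crossing X X.
Proof. by split=> //; apply: Or41. Qed.

Lemma same_crossing_swap k (a a' b b' : A) : same_crossing (k, (a, a'), (b, b')) (k, (b, b'), (a, a')).
Proof.
split=> [m l|l|]; last exact: Or43.
  by rewrite /= ![l a == _]eq_sym ![l a' == _]eq_sym; case: ifP => // _; rewrite andbC.
by rewrite /ends_parity /=; case: (l a); case: (l a'); case: (l b); case: (l b').
Qed.

Definition flip (x : bool) (p : A * A) := if x then (p.2, p.1) else p.

(** Reversing one strand exchanges the two smoothings. So strands may be directed at will in local
    pictures, at the cost of adding the flips to the marker. *)
Lemma same_crossing_flip x y k (a a' b b' : A) :
  same_crossing (k (+) x (+) y, flip x (a, a'), flip y (b, b')) (k, (a, a'), (b, b')).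
Proof.
split=> [m l|l|].
- case: x; case: y; rewrite /= ?addbT ?addbF ?negbK //; case: m; case: k => //=; by rewrite andbC.
- by case: x; case: y; rewrite /ends_parity /=; case: (l a); case: (l a'); case: (l b); case: (l b').
- by case: x; [apply: Or42 | apply: Or41].
Qed.

End SameCrossing.

Section Reduced.
Variables (X : based_complex) (P Q : pred X) (r : X -> X -> bool).

(** Correction created by an elimination: enter [Q], return to [P] against a cancelled differential,
    and leave. *)
Definition zigzag (x y : X) : 'F_2 := \sum_q \sum_p dcoef x q * (r q p)%:R * dcoef p y.

Definition reduced := BasedComplex (fun x : {x : X | ~~ P x && ~~ Q x} => hgr (val x))
  (fun x => qgr (val x)) (fun x y => dcoef (val x) (val y) + zigzag (val x) (val y)).

Lemma reduced_equiv :
  is_complex X ->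
  (forall x, ~~ (P x && Q x)) ->
  (forall q p, r q p -> Q q && P p) ->
  (forall q, Q q -> exists p, r q p) ->
  (forall p, P p -> exists q, r q p) ->
  (forall q p p', r q p -> r q p' -> p = p') ->
  (forall q q' p, r q p -> r q' p -> q = q') ->
  (forall p q, P p -> Q q -> dcoef p q = (r q p)%:R) ->
  homotopy_equiv X reduced.
Proof.
move=> cX PQ rPQ rQ rP rI rJ rd.
apply: (@homotopy_equiv_cancel X reduced val P Q r) => //.
- exact: val_inj.
- move=> x; case Px: (P x) => //; case Qx: (Q x) => //=.
  have ok : ~~ P x && ~~ Q x by rewrite Px Qx.
  by apply/codomP; exists (Sub x ok : reduced); rewrite SubK.
- by move=> y; apply: (valP y).
Qed.

End Reduced.

Lemma stepP (I : finType) (c : I) (s t : {ffun I -> bool}) :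
  reflect [/\ s c, t c = false & forall e, e != c -> t e = s e] (step c s t).
Proof.
apply: (iffP andP) => [[sc /eqP->]|[sc tc ts]].
  by split=> // [|e ec]; rewrite ffunE ?eqxx ?ec.
by split=> //; apply/eqP/ffunP => e; rewrite ffunE; have [->|/ts] := eqVneq e c.
Qed.

Lemma dcoef_step (A I : finType) (D : arc_diagram A I) n0 n1 (S T : cube D n0 n1) c :
  step c (val S).1 (val T).1 ->
  dcoef S T = (inc (eqv D (val S).1) (eqv D (val T).1) (cx D c) (cy D c) (val S).2 (val T).2)%:R.
Proof.
move=> st; rewrite /= (bigD1 c) //= big1 => [|e ec].
  by rewrite addr0 /inc_at st.
rewrite /inc_at; case st': (step e _ _) => //=.
have /stepP[_ _ ts] := st; have /stepP[se te _] := st'.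
by rewrite ts // se in te.
Qed.

Lemma dcoef_nostep (A I : finType) (D : arc_diagram A I) n0 n1 (S T : cube D n0 n1) :
  (forall c, ~~ step c (val S).1 (val T).1) -> dcoef S T = 0.
Proof. by move=> no; rewrite /= big1 // => c _; rewrite /inc_at (negbTE (no c)). Qed.

Lemma dcoef_neq0 (A I : finType) (D : arc_diagram A I) n0 n1 (S T : cube D n0 n1) :
  dcoef S T != 0 -> exists2 c, step c (val S).1 (val T).1 &
    inc (eqv D (val S).1) (eqv D (val T).1) (cx D c) (cy D c) (val S).2 (val T).2.
Proof.
have [c /= /andP[st i] _|none] := pickP [pred c | inc_at c S T]; first by exists c.
by rewrite /= big1 ?eqxx // => c _; have /= -> := none c.
Qed.

(** * Local changes of an arc diagram *)

Section Local.
Variables (A I : finType) (D : arc_diagram A I) (loc : pred I) (inner : pred A).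
Implicit Types (s t : {ffun I -> bool}) (l m : {ffun A -> bool}).

Definition outer s l :=
  (l (base_l D) == l (base_r D)) && [forall c, ~~ loc c ==> smoothed (cr D c) (s c) l].

Definition agree l m := [forall a, ~~ inner a ==> (l a == m a)].
Definition same_out s t := [forall c, ~~ loc c ==> (s c == t c)].

Definition external_crossing (X : crossing A) :=
  [&& ~~ inner X.1.2.1, ~~ inner X.1.2.2, ~~ inner X.2.1 & ~~ inner X.2.2].
(** The crossings outside [loc] and the base point avoid the inner arcs, so inner labels may be
    changed under the control of the crossings in [loc] alone. *)
Definition external :=
  [/\ ~~ inner (base_l D), ~~ inner (base_r D) & forall c, ~~ loc c -> external_crossing (cr D c)].

Lemma agreeP l m : reflect (forall a, ~~ inner a -> l a = m a) (agree l m).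
Proof.
apply: (iffP forallP) => H a; first by move=> na; have /implyP/(_ na)/eqP := H a.
by apply/implyP => /H ->.
Qed.

Lemma agree_sym l m : agree l m = agree m l.
Proof. by apply/agreeP/agreeP => H a /H ->. Qed.

Lemma same_outP s t : reflect (forall c, ~~ loc c -> s c = t c) (same_out s t).
Proof.
apply: (iffP forallP) => H a; first by move=> na; have /implyP/(_ na)/eqP := H a.
by apply/implyP => /H ->.
Qed.

Lemma compat_outer s l :
  compat D s l = outer s l && [forall c, loc c ==> smoothed (cr D c) (s c) l].
Proof.
rewrite /compat /outer -andbA; congr (_ && _).
apply/forallP/andP => [H|[/forallP H1 /forallP H2] c].
  by split; apply/forallP => c; rewrite H implybT.
by have := H1 c; have := H2 c; case: (loc c).
Qed.

Lemma outer_ext s t l m : external -> agree l m -> same_out s t -> outer s l = outer t m.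
Proof.
move=> [b0 b1 ext] /agreeP lm /same_outP st; rewrite /outer !lm //; congr (_ && _).
apply: eq_forallb => c; case lc: (loc c) => //=; rewrite st ?lc //.
have := ext c; rewrite lc => /(_ isT)/and4P[].
by case: (cr D c) => [[k [a a']] [b b']] /= ? ? ? ?; rewrite !lm.
Qed.

Definition patch l (f : A -> bool) : {ffun A -> bool} := [ffun a => if inner a then f a else l a].

Lemma agree_patch l f : agree l (patch l f).
Proof. by apply/agreeP => a /negbTE na; rewrite ffunE na. Qed.

Lemma patch_out l f a : ~~ inner a -> patch l f a = l a.
Proof. by move=> /negbTE na; rewrite ffunE na. Qed.

Lemma patch_in l f a : inner a -> patch l f a = f a.
Proof. by move=> na; rewrite ffunE na. Qed.

End Local.

Definition map_crossing (A B : Type) (g : A -> B) (X : crossing A) : crossing B :=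
  (X.1.1, (g X.1.2.1, g X.1.2.2), (g X.2.1, g X.2.2)).

(* [D0] is [D] with the crossings in [loc] removed: [g] collapses the arcs of
   [D], and [k] is a section of [g] that avoids the inner arcs. *)
Section Collapse.
Variables (A I A0 I0 : finType) (D : arc_diagram A I) (D0 : arc_diagram A0 I0).
Variables (loc : pred I) (inner : pred A) (j : I0 -> I) (g : A -> A0) (k : A0 -> A).
Hypothesis j_inj : injective j.
Hypothesis locP : forall c, ~~ loc c = (c \in codom j).
Hypothesis D0_cr : forall i, cr D0 i = map_crossing g (cr D (j i)).
Hypothesis D0_base : base_l D0 = g (base_l D) /\ base_r D0 = g (base_r D).
Hypothesis ext : external D loc inner.
Hypothesis gk : cancel k g.
Hypothesis k_out : forall a, ~~ inner (k a).

(** The states [M] that survive an elimination all have the markers [beta] in [loc], which smooth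
    [D] into [D0]. The hypotheses say that their outer labels come from labels of [D0] ([fib]), that
    all of these occur ([build]), that they determine the state ([det]), and that an inner arc is
    attached to an outer one or has a constant label on [M] ([cov]). *)
Variable beta : I -> bool.
Definition frozen_out (s : {ffun I -> bool}) := forall c, loc c -> s c = beta c.

Variable M : pred (state_basis D).
Hypothesis M_frozen : forall S, M S -> frozen_out (val S).1.
Hypothesis fib : forall s l, frozen_out s -> compat D s l ->
  forall a, ~~ inner a -> l a = l (k (g a)).
Hypothesis build : forall s (l0 : {ffun A0 -> bool}), frozen_out s ->
  outer D loc s [ffun a => l0 (g a)] ->
  exists S : state_basis D, [/\ M S, (val S).1 = s & forall a, ~~ inner a -> (val S).2 a = l0 (g a)].
Hypothesis det : forall S T, M S -> M T -> (val S).1 = (val T).1 ->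
  agree inner (val S).2 (val T).2 -> (val S).2 = (val T).2.
Hypothesis cov : forall z, inner z ->
  (exists2 c, ~~ inner c & forall s l, frozen_out s -> compat D s l -> l z = l c) \/
  (forall S T, M S -> M T -> (val S).2 z = (val T).2 z).

Definition corresponds (S0 : state_basis D0) (S : state_basis D) :=
  [forall i, (val S).1 (j i) == (val S0).1 i] &&
  [forall a, ~~ inner a ==> ((val S).2 a == (val S0).2 (g a))].

Implicit Types (S T : state_basis D).

Lemma correspondsP (S0 : state_basis D0) S : reflect
  ((forall i, (val S).1 (j i) = (val S0).1 i) /\ (forall a, ~~ inner a -> (val S).2 a = (val S0).2 (g a)))
  (corresponds S0 S).
Proof.
apply: (iffP andP) => -[H1 H2]; split.
- by move=> i; apply/eqP; apply: (forallP H1).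
- by move=> a na; apply/eqP; apply: (implyP (forallP H2 a)).
- by apply/forallP => i; rewrite H1.
- by apply/forallP => a; apply/implyP => na; rewrite H2.
Qed.

Lemma out_j i : ~~ loc (j i).
Proof. by rewrite locP codom_f. Qed.

Lemma outer_collapse (s : {ffun I -> bool}) (l : {ffun A -> bool}) (s0 : {ffun I0 -> bool}) (l0 : {ffun A0 -> bool}) :
  (forall i, s (j i) = s0 i) -> (forall a, ~~ inner a -> l a = l0 (g a)) ->
  outer D loc s l = compat D0 s0 l0.
Proof.
move=> ss ll; have [b0 b1 ec] := ext; have [D0b0 D0b1] := D0_base.
rewrite /outer /compat D0b0 D0b1 !ll //; congr (_ && _).
have sm i : smoothed (cr D (j i)) (s (j i)) l = smoothed (cr D0 i) (s0 i) l0.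
  rewrite ss D0_cr; have := ec _ (out_j i); case: (cr D (j i)) => [[k' [a a']] [b b']].
  by move=> /and4P[/= ? ? ? ?]; rewrite !ll.
apply/forallP/forallP => H c; first by rewrite -sm; have := H (j c); rewrite out_j.
by apply/implyP; rewrite locP => /codomP[i ->]; rewrite sm.
Qed.

Lemma eqv_collapse s (s0 : {ffun I0 -> bool}) a b : frozen_out s -> (forall i, s (j i) = s0 i) ->
  ~~ inner a -> ~~ inner b -> eqv D s a b = eqv D0 s0 (g a) (g b).
Proof.
move=> fs ss na nb; apply/eqvP/eqvP => H l cl.
  have [|S [_ S1 S2]] := build (l0 := l) fs.
    by rewrite (@outer_collapse s _ s0 l) // => ? _; rewrite ffunE.
  by rewrite -!S2 //; apply: H; rewrite -S1 (valP S).
rewrite (fib fs cl na) (fib fs cl nb).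
have := H [ffun a => l (k a)]; rewrite !ffunE; apply.
rewrite -(@outer_collapse s l); [|by []|].
  by move: cl; rewrite (compat_outer D loc) => /andP[].
by move=> c nc; rewrite ffunE -(fib fs cl nc).
Qed.

Lemma corr_ex (S0 : state_basis D0) : exists2 S, M S & corresponds S0 S.
Proof.
pose s : {ffun I -> bool} := [ffun c => if [pick i | j i == c] is Some i then (val S0).1 i else beta c].
have ss i : s (j i) = (val S0).1 i.
  rewrite ffunE; case: pickP => [i' /eqP/j_inj -> //|/(_ i)]; by rewrite eqxx.
have fs : frozen_out s.
  move=> c lc; rewrite ffunE; case: pickP => // i /eqP ic.
  by have := out_j i; rewrite ic lc.
have [|S [MS S1 S2]] := build (l0 := (val S0).2) fs.
  rewrite (@outer_collapse s _ (val S0).1 (val S0).2) ?(valP S0) // => ? _; by rewrite ffunE.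
by exists S => //; apply/correspondsP; split=> [i|//]; rewrite S1.
Qed.

Lemma corr_ex0 S : M S -> exists S0 : state_basis D0, corresponds S0 S.
Proof.
move=> MS; pose s0 : {ffun I0 -> bool} := [ffun i => (val S).1 (j i)].
pose l0 : {ffun A0 -> bool} := [ffun a => (val S).2 (k a)].
have ll a : ~~ inner a -> (val S).2 a = l0 (g a).
  by move=> na; rewrite ffunE -(fib (M_frozen MS) (valP S) na).
have ok : compat D0 s0 l0.
  rewrite -(@outer_collapse (val S).1 (val S).2) //; last by move=> i; rewrite ffunE.
  by have := valP S; rewrite (compat_outer D loc) => /andP[].
exists (exist (fun p => compat D0 p.1 p.2) (s0, l0) ok); apply/correspondsP.
by split=> //= i; rewrite ffunE.
Qed.

Lemma corr_inj (S0 : state_basis D0) S T : M S -> M T -> corresponds S0 S -> corresponds S0 T -> S = T.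
Proof.
move=> MS MT /correspondsP[s1 l1] /correspondsP[s2 l2].
have ss : (val S).1 = (val T).1.
  apply/ffunP => c; case lc: (loc c); first by rewrite !M_frozen.
  by have := locP c; rewrite lc => /esym/codomP[i ->]; rewrite s1 s2.
by apply: state_basis_eq => //; apply: det => //; apply/agreeP => a na; rewrite l1 ?l2.
Qed.

Lemma corr_inj0 (S0 T0 : state_basis D0) S : corresponds S0 S -> corresponds T0 S -> S0 = T0.
Proof.
move=> /correspondsP[s1 l1] /correspondsP[s2 l2]; apply: state_basis_eq.
  by apply/ffunP => i; rewrite -s1 -s2.
by apply/ffunP => a; rewrite -[a]gk -l1 // -l2.
Qed.

(** Frozen markers leave no step at the crossings of [loc]. At the other crossings both coefficients
    are pulled back to the outer arcs, where the circles of the two diagrams coincide. *)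
Lemma dcoef_collapse n0 n1 n0' n1' (S T : cube D n0 n1) (S0 T0 : cube D0 n0' n1') :
  M S -> M T -> corresponds S0 S -> corresponds T0 T -> dcoef S T = dcoef S0 T0.
Proof.
move=> MS MT /correspondsP[s1 l1] /correspondsP[s2 l2] /=.
have fS := M_frozen MS; have fT := M_frozen MT.
rewrite (bigID loc) /= big1 ?add0r; last first.
  move=> c lc; rewrite /inc_at; case st: (step c _ _) => //.
  by have /stepP[sc tc _] := st; rewrite fS // -fT // tc in sc.
have locE : [pred c | ~~ loc c] =i j @: setT.
  move=> c; rewrite inE locP; apply/codomP/imsetP => [[i ->]|[i _ ->]]; by exists i.
rewrite (eq_bigl _ _ locE) big_imset /=; last by move=> ? ? _ _; apply: j_inj.
apply: eq_big => [i|i _]; first by rewrite inE.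
congr (_%:R : 'F_2); congr nat_of_bool; rewrite /inc_at.
have stE : step (j i) (val S).1 (val T).1 = step i (val S0).1 (val T0).1.
  apply/stepP/stepP => -[]; rewrite ?s1 ?s2 => H1 H2 H3; split=> //.
    by move=> e ei; rewrite -s1 -s2 H3 // (inj_eq j_inj).
  move=> c cj; case lc: (loc c); first by rewrite fS // -fT.
  have := locP c; rewrite lc => /esym/codomP[e ce]; rewrite ce s1 s2 H3 //.
  by apply: contra cj => /eqP <-; rewrite ce.
rewrite stE; case st: (step i _ _) => //=.
pose C := {a : A | ~~ inner a}.
have [b0 b1 ec] := ext.
have /and4P[nx ny _ _] := ec _ (out_j i).
pose x : C := exist (fun a => ~~ inner a) _ nx; pose y : C := exist (fun a => ~~ inner a) _ ny.
have [rS sS tS] := eqv_equiv D (val S).1; have [rT sT tT] := eqv_equiv D (val T).1.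
have [rS0 sS0 tS0] := eqv_equiv D0 (val S0).1; have [rT0 sT0 tT0] := eqv_equiv D0 (val T0).1.
have covD z : (exists c : C, eqv D (val S).1 z (val c) /\ eqv D (val T).1 z (val c)) \/
    (val T).2 z = (val S).2 z.
  case iz: (inner z); last by left; exists (exist (fun a => ~~ inner a) z (negbT iz)) => /=.
  have [[c nc H]|H] := cov iz; last by right; apply: H.
  left; exists (exist (fun a => ~~ inner a) c nc) => /=.
  by split; apply/eqvP => l cl; [apply: H fS cl | apply: H fT cl].
have covD0 z : (exists c : C, eqv D0 (val S0).1 z (g (val c)) /\ eqv D0 (val T0).1 z (g (val c))) \/
    (val T0).2 z = (val S0).2 z.
  by left; exists (exist (fun a => ~~ inner a) (k z) (k_out z)) => /=; rewrite gk.
have lS := proj1 (compat_respects _ _ _) (valP S); have lT := proj1 (compat_respects _ _ _) (valP T).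
have lS0 := proj1 (compat_respects _ _ _) (valP S0); have lT0 := proj1 (compat_respects _ _ _) (valP T0).
have cxE : cx D0 i = g (val x) by rewrite /cx D0_cr.
have cyE : cy D0 i = g (val y) by rewrite /cy D0_cr.
rewrite (inc_pull (f := val) (cx := x) (cy := y) (eqv_equiv _ _) (eqv_equiv _ _) lS lT covD) //.
rewrite (inc_pull (f := fun c : C => g (val c)) (cx := x) (cy := y) (eqv_equiv _ _) (eqv_equiv _ _) lS0 lT0 covD0) ?cxE ?cyE //.
have pE (U : state_basis D) (U0 : state_basis D0) : frozen_out (val U).1 -> (forall i, (val U).1 (j i) = (val U0).1 i) ->
    pull (val : C -> A) (eqv D (val U).1) =2 pull (fun c : C => g (val c)) (eqv D0 (val U0).1).
  by move=> fU ss a b; apply: eqv_collapse => //; [apply: (valP a)|apply: (valP b)].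
rewrite (eq_inc _ _ _ _ (pE _ _ fS s1) (pE _ _ fT s2)).
by congr inc; apply/ffunP => c; rewrite !ffunE ?l1 ?l2 //; apply: (valP c).
Qed.

(** Here every inner arc has to be attached to an outer one: a circle made of inner arcs only, as
    for a kink, would change the degree. *)
Lemma deg_collapse (S0 : state_basis D0) S :
  (forall z, inner z -> exists2 c, ~~ inner c & forall s l, frozen_out s -> compat D s l -> l z = l c) ->
  M S -> corresponds S0 S -> deg (eqv D (val S).1) (val S).2 = deg (eqv D0 (val S0).1) (val S0).2.
Proof.
move=> cov' MS /correspondsP[s1 l1]; pose C := {a : A | ~~ inner a}.
have fS := M_frozen MS.
have covD z : exists c : C, eqv D (val S).1 z (val c).
  case iz: (inner z); last by exists (exist (fun a => ~~ inner a) z (negbT iz)) => /=; apply/eqvP.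
  have [c nc H] := cov' _ iz; exists (exist (fun a => ~~ inner a) c nc); apply/eqvP => l cl; exact: H cl.
have covD0 z : exists c : C, eqv D0 (val S0).1 z (g (val c)).
  by exists (exist (fun a => ~~ inner a) (k z) (k_out z)) => /=; rewrite gk; apply/eqvP.
rewrite -(deg_pull (f := val) (eqv_equiv _ _) (proj1 (compat_respects _ _ _) (valP S)) covD).
rewrite -(deg_pull (f := fun c : C => g (val c)) (eqv_equiv _ _) (proj1 (compat_respects _ _ _) (valP S0)) covD0).
have pE : pull (val : C -> A) (eqv D (val S).1) =2 pull (fun c : C => g (val c)) (eqv D0 (val S0).1).
  by move=> a b; apply: eqv_collapse => //; [apply: (valP a)|apply: (valP b)].
rewrite (eq_deg _ pE).
by congr deg; apply/ffunP => c; rewrite !ffunE l1 //; apply: (valP c).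
Qed.

Lemma reduced_collapse n0 n1 n0' n1' (P Q : pred (cube D n0 n1))
    (r : cube D n0 n1 -> cube D n0 n1 -> bool) :
  (forall S : cube D n0 n1, ~~ P S && ~~ Q S = M S) ->
  (forall S T : cube D n0 n1, M S -> M T -> zigzag r S T = 0) ->
  (forall (S0 : state_basis D0) S, M S -> corresponds S0 S -> 
     hgr (S : cube D n0 n1) = hgr (S0 : cube D0 n0' n1') /\
     qgr (S : cube D n0 n1) = qgr (S0 : cube D0 n0' n1')) ->
  homotopy_equiv (reduced P Q r) (cube D0 n0' n1').
Proof.
move=> PQM zig gr.
apply: (@homotopy_equiv_bij (reduced P Q r) (cube D0 n0' n1') 
  (fun (S : {x : cube D n0 n1 | ~~ P x && ~~ Q x}) (S0 : state_basis D0) => corresponds S0 (val S))).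
- by move=> S; apply: corr_ex0; rewrite -PQM; apply: (valP S).
- move=> S0; have [S MS cS] := corr_ex S0; rewrite -PQM in MS.
  by exists (exist _ S MS).
- by move=> S S0 T0; apply: corr_inj0.
- move=> S T S0 H1 H2; apply/val_inj/(corr_inj _ _ H1 H2); rewrite -PQM.
    exact: (valP S).
  exact: (valP T).
- by move=> S S0; apply: gr; rewrite -PQM; apply: (valP S).
move=> S S0 T T0 cS cT.
have MS : M (val S) by rewrite -PQM; apply: (valP S).
have MT : M (val T) by rewrite -PQM; apply: (valP T).
by rewrite -(dcoef_collapse MS MT cS cT) /= zig // addr0.
Qed.

End Collapse.

(** * The first move *)

Section Transfer.
Variables (A I : finType) (D : arc_diagram A I) (loc : pred I) (inner : pred A).

(** With [D' = D] this chooses new markers and labels inside the region of a move; with distinct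
    diagrams it passes from one side of a move to the other. *)
Lemma transfer (D' : arc_diagram A I) (S : state_basis D) (beta : I -> bool) (f : A -> bool) :
  external D' loc inner -> outer D' loc =2 outer D loc ->
  (forall c, loc c -> smoothed (cr D' c) (beta c) (patch inner (val S).2 f)) ->
  exists T : state_basis D', [/\ same_out loc (val S).1 (val T).1,
    forall c, loc c -> (val T).1 c = beta c,
    agree inner (val S).2 (val T).2 & forall a, inner a -> (val T).2 a = f a].
Proof.
move=> ext oD sm; pose t : {ffun I -> bool} := [ffun c => if loc c then beta c else (val S).1 c].
have ok : compat D' t (patch inner (val S).2 f).
  rewrite (compat_outer D' loc); apply/andP; split.
    have := valP S; rewrite (compat_outer D loc) -oD => /andP[o _].
    rewrite -(outer_ext (s := (val S).1) (l := (val S).2) ext) ?agree_patch //.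
    by apply/same_outP => c lc; rewrite ffunE (negbTE lc).
  by apply/forallP => c; apply/implyP => lc; rewrite ffunE lc; apply: sm.
exists (exist (fun p => compat D' p.1 p.2) (t, patch inner (val S).2 f) ok); split=> /=.
- by apply/same_outP => c lc; rewrite ffunE (negbTE lc).
- by move=> c lc; rewrite ffunE lc.
- exact: agree_patch.
- by move=> a ia; rewrite patch_in.
Qed.

Lemma state_basis_loc (S T : state_basis D) :
  same_out loc (val S).1 (val T).1 -> (forall c, loc c -> (val S).1 c = (val T).1 c) ->
  agree inner (val S).2 (val T).2 -> (forall a, inner a -> (val S).2 a = (val T).2 a) -> S = T.
Proof.
move=> /same_outP so sl /agreeP ao ai; apply: state_basis_eq.
  by apply/ffunP => c; case lc: (loc c); [apply: sl | apply: so; rewrite lc].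
by apply/ffunP => a; case ia: (inner a); [apply: ai | apply: ao; rewrite ia].
Qed.

Lemma basis_respects (S : state_basis D) : respects (eqv D (val S).1) (val S).2.
Proof. exact/compat_respects/(valP S). Qed.

Lemma loc_smoothed (S : state_basis D) c : smoothed (cr D c) ((val S).1 c) (val S).2.
Proof. by have /andP[_ /forallP] := valP S. Qed.

(* A label that can be changed without touching the other arcs of [K] sits on a
   circle which is disjoint from [K]. *)
Lemma not_eqv_toggle (S : state_basis D) (f : A -> bool) o z :
  external D loc inner -> inner o -> ~~ inner z -> f o != (val S).2 o ->
  (forall c, loc c -> smoothed (cr D c) ((val S).1 c) (patch inner (val S).2 f)) ->
  eqv D (val S).1 o z = false.
Proof.
move=> ext io nz fo sm; apply/negP => /eqvP H.
have [T [ST TS /agreeP ag Ti]] := transfer ext (fun _ _ => erefl) sm.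
have H1 := H _ (valP S); have ts : (val T).1 = (val S).1.
  apply/ffunP => c; case lc: (loc c); first exact: TS.
  by move/same_outP: ST => ->; rewrite ?lc.
have := H (val T).2; rewrite -ts (valP T) => /(_ isT).
by rewrite Ti // -ag // -H1 => /eqP; rewrite (negbTE fo).
Qed.

Lemma inc_at_keeps (S T : state_basis D) o c : inc_at c S T -> 
  ~~ eqv D (val S).1 o (cx D c) -> ~~ eqv D (val S).1 o (cy D c) ->
  (val T).2 o = (val S).2 o.
Proof. by move=> /andP[_ /andP[/forallP/(_ o) + _]] ox oy; rewrite ox oy => /eqP. Qed.

End Transfer.

Lemma negs_option (I : finType) (s : {ffun option I -> bool}) :
  negs s = (~~ s None + negs [ffun i => s (Some i)])%N.
Proof.
rewrite /negs (bigD1 None) //=; congr (_ + _)%N.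
rewrite (reindex_omap Some id) /=; last by case.
by apply: eq_big => [i|i _]; rewrite ?eqxx // ffunE.
Qed.

Section R1.
Variables (A A0 I0 : finType) (D : arc_diagram A (option I0)) (D0 : arc_diagram A0 I0).
Variables (g : A -> A0) (k : A0 -> A) (a0 o a2 : A).
Hypothesis crN : cr D None = (true, (a0, o), (o, a2)).
Hypothesis a0o : a0 != o.
Hypothesis a2o : a2 != o.
Hypothesis D0_cr : forall i, cr D0 i = map_crossing g (cr D (Some i)).
Hypothesis D0_base : base_l D0 = g (base_l D) /\ base_r D0 = g (base_r D).
Let loc : pred (option I0) := fun c => c == None.
Let inner : pred A := pred1 o.
Hypothesis ext : external D loc inner.
Hypothesis gk : cancel k g.
Hypothesis k_out : forall a, k a != o.
Hypothesis ga : g a0 = g a2.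
Hypothesis fib : forall l : A -> bool, l a0 = l a2 -> forall a, a != o -> l a = l (k (g a)).
Hypothesis even : evenly_crossed D.
Variables (n0 n1 : int).

Local Notation X := (cube D n0 (n1 + 1)).
(* The states whose kink is a separate circle labelled [1] cancel the states in
   which this circle has been merged. *)
Let P (S : state_basis D) := (val S).1 None && (val S).2 o.
Let Q (S : state_basis D) := ~~ (val S).1 None.
Let M (S : state_basis D) := (val S).1 None && ~~ (val S).2 o.
Let r (q p : state_basis D) := [&& Q q, P p, same_out loc (val q).1 (val p).1 & agree inner (val q).2 (val p).2].

Let smN (S : state_basis D) :
  if (val S).1 None then (val S).2 a0 = (val S).2 a2 else (val S).2 a0 = (val S).2 o /\ (val S).2 o = (val S).2 a2.
Proof.
have := loc_smoothed S None; rewrite crN /smoothed eqb_id.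
by case: ifP => _ /andP[/eqP ? /eqP ?].
Qed.

Let circ (S : state_basis D) z : (val S).1 None -> z != o -> eqv D (val S).1 o z = false.
Proof.
move=> sN zo; apply: (not_eqv_toggle (loc := loc) (inner := inner) (f := fun _ => ~~ (val S).2 o)) => //.
- by rewrite /inner /= eqxx.
- by case: ((val S).2 o).
- move=> c /eqP ->; rewrite crN sN /= !ffunE /inner /= eqxx (negbTE a0o) (negbTE a2o).
  by have := smN S; rewrite sN => ->; rewrite !eqxx.
Qed.

Let rQP q p : r q p -> Q q && P p.
Proof. by case/and4P => -> ->. Qed.

(** The step at the kink merges a circle labelled [1], hence is invertible by the unit axiom. *)
Lemma R1_reduced : homotopy_equiv X (reduced (X := X) P Q r).
Proof.
have io : inner o by rewrite /inner /= eqxx.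
have refl2 : outer D loc =2 outer D loc by [].
apply: reduced_equiv.
- exact: cube_complex.
- by move=> S; rewrite /P /Q; case: ((val S).1 None); rewrite /= ?andbF.
- exact: rQP.
- move=> q Qq; have [|p [so pN ag po]] := transfer (S := q) (beta := fun _ => true) (f := fun _ => true) ext refl2.
    move=> c /eqP ->; rewrite crN /= !ffunE /inner /= eqxx (negbTE a0o) (negbTE a2o).
    by have := smN q; rewrite (negbTE Qq) => -[-> ->]; rewrite !eqxx.
  by exists p; rewrite /r Qq so ag /P pN ?po ?eqxx.
- move=> p Pp; have [|q [so qN ag qo]] := transfer (S := p) (beta := fun _ => false) (f := fun _ => (val p).2 a0) ext refl2.
    move=> c /eqP ->; rewrite crN /= !ffunE /inner /= eqxx (negbTE a0o) (negbTE a2o).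
    by have /andP[pN _] := Pp; have := smN p; rewrite pN => ->; rewrite !eqxx.
  exists q; rewrite /r Pp /Q qN //=; apply/andP; split.
    by apply/same_outP => c lc; move/same_outP: so => ->.
  by rewrite agree_sym.
- move=> q p p' /and4P[_ /andP[p1 p2] /same_outP so /agreeP ag] /and4P[_ /andP[p1' p2'] /same_outP so' /agreeP ag'].
  apply: (state_basis_loc (loc := loc) (inner := inner)).
  + by apply/same_outP => c lc; rewrite -so -?so'.
  + by move=> c /eqP->; rewrite p1 p1'.
  + by apply/agreeP => a na; rewrite -ag -?ag'.
  + by move=> a /eqP->; rewrite p2 p2'.
- move=> q q' p /and4P[q1 _ /same_outP so /agreeP ag] /and4P[q1' _ /same_outP so' /agreeP ag'].
  apply: (state_basis_loc (loc := loc) (inner := inner)).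
  + by apply/same_outP => c lc; rewrite so -?so'.
  + by move=> c /eqP->; rewrite (negbTE q1) (negbTE q1').
  + by apply/agreeP => a na; rewrite ag -?ag'.
  + move=> a /eqP->; have := smN q; have := smN q'; rewrite (negbTE q1) (negbTE q1').
    by move=> [<- _] [<- _]; rewrite ag ?ag'.
- move=> p q Pp Qq; rewrite /r Pp Qq !andTb.
  have /andP[pN po] := Pp.
  case so: (same_out loc (val q).1 (val p).1); last first.
    apply: dcoef_nostep => c; apply/negP => /stepP[pc qc E].
    have [cN|cN] := eqVneq c None; last first.
      by have := E None; rewrite eq_sym cN (negbTE Qq) pN => /(_ isT).
    by case/negP: so; apply/same_outP => e; rewrite /loc => eN; apply: E; rewrite cN.
  have st : step None (val p).1 (val q).1.
    apply/stepP; split=> //; first exact: negbTE.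
    by move=> e eN; move/same_outP: so => ->.
  rewrite (dcoef_step (n0 := n0) (n1 := n1 + 1) st) /cx /cy crN /=.
  have surg := step_surgery even st; rewrite /cx /cy crN /= in surg.
  have [_ sE _] := eqv_equiv D (val p).1.
  rewrite inc_merge_unit //; [|exact: basis_respects|exact: basis_respects|by rewrite sE circ].
  congr (_%:R : 'F_2); congr nat_of_bool; apply/forallP/agreeP => [H a na|H z].
    by have := H a; rewrite sE circ // => /eqP.
  case zo: (eqv D (val p).1 z o) => //=; apply/eqP/H.
  by apply: contraFN zo => /eqP->; apply/eqvP.
Qed.

Let fib1 s (l : {ffun A -> bool}) : frozen_out loc (fun _ => true) s -> compat D s l ->
  forall a, ~~ inner a -> l a = l (k (g a)).
Proof.
move=> fs cl; apply: fib.
have := cl; rewrite (compat_outer D loc) => /andP[_ /forallP/(_ None)].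
by rewrite /loc eqxx crN /= fs /loc ?eqxx // => /andP[/eqP].
Qed.

Let build1 s (l0 : {ffun A0 -> bool}) : frozen_out loc (fun _ => true) s ->
  outer D loc s [ffun a => l0 (g a)] ->
  exists S : state_basis D, [/\ M S, (val S).1 = s & forall a, ~~ inner a -> (val S).2 a = l0 (g a)].
Proof.
move=> fs os.
have ok : compat D s (patch inner [ffun a => l0 (g a)] (fun _ => false)).
  rewrite (compat_outer D loc); apply/andP; split.
    rewrite -(outer_ext (s := s) (l := [ffun a => l0 (g a)]) ext) ?agree_patch //.
    by apply/same_outP.
  apply/forallP => c; apply/implyP => /eqP ->; rewrite crN fs /loc //= !ffunE.
  by rewrite /inner /= (negbTE a0o) (negbTE a2o) ga !eqxx.
exists (exist (fun p => compat D p.1 p.2) (s, _) ok); split=> //=.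
  by rewrite /M /= fs /loc ?eqxx //= ffunE /inner /= eqxx.
by move=> a na; rewrite patch_out // ffunE.
Qed.

Let MF S : M S -> frozen_out loc (fun _ => true) (val S).1.
Proof. by move=> /andP[sN _] c /eqP->. Qed.

Let Some_inj : injective (@Some I0). Proof. by move=> i i' []. Qed.

Let locP c : ~~ loc c = (c \in codom (@Some I0)).
Proof.
case: c => [i|]; rewrite /loc /=; last by symmetry; apply/negP => /codomP[].
by symmetry; apply/codomP; exists i.
Qed.

Lemma reidemeister1_positive : homotopy_equiv X (cube D0 n0 n1).
Proof.
apply: homotopy_equiv_trans R1_reduced _.
have io : inner o by rewrite /inner /= eqxx.
apply: (reduced_collapse Some_inj locP D0_cr D0_base ext gk k_out MF fib1 build1) => //.
- move=> S T /andP[_ So] /andP[_ To] _ /agreeP ag; apply/ffunP => a.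
  by have [->|] := eqVneq a o; [rewrite (negbTE So) (negbTE To) | apply: ag].
- move=> z /eqP->; right => S T /andP[_ So] /andP[_ To].
  by rewrite (negbTE So) (negbTE To).
- by move=> S; rewrite /P /Q /M; case: (_ None); case: (_ o).
(* Leaving [p] for a surviving state would have to occur at another crossing and turn the label [1]
   of the kink circle into [x], although such a step does not touch this circle. *)
- move=> S T /andP[_ So] /andP[TN To]; rewrite /zigzag big1 // => q _; rewrite big1 // => p _.
  case rqp: (r q p); last by rewrite mulr0 mul0r.
  suff -> : dcoef p T = 0 by rewrite mulr0.
  apply/eqP/negPn/negP => /dcoef_neq0[c st i].
  have /and4P[_ /andP[pN po] _ _] := rqp.
  have cN : c != None.
    by apply/negP => /eqP cN; have /stepP[_ tc _] := st; rewrite cN TN in tc.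
  have [_ _ /(_ c cN)/and4P[nx ny _ _]] := ext.
  have iA : inc_at c p T by rewrite /inc_at st.
  by have := inc_at_keeps (o := o) iA; rewrite !circ // po (negbTE To) => /(_ isT isT).
move=> S0 S MS corr; have /correspondsP[ss ll] := corr.
have /andP[SN So] := MS.
have ngs : negs (val S).1 = negs (val S0).1.
  rewrite negs_option SN add0n; congr negs; by apply/ffunP => i; rewrite ffunE ss.
rewrite /= ngs; split=> //.
(* The additional circle is labelled [x], of degree -1; the shift [n1 + 1] makes up for it. *)
suff -> : deg (eqv D (val S).1) (val S).2 = deg (eqv D0 (val S0).1) (val S0).2 - 1 by ring.
(* With the other marker the kink circle is merged into its neighbour and all inner arcs are
   attached to outer ones, so this state can be compared with [D0] circle by circle. *)
pose t := lower None (val S).1.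
have st : step None (val S).1 t by rewrite /step SN eqxx.
have surg := step_surgery even st; rewrite /cx /cy crN /= in surg.
pose m := patch inner (val S).2 (fun _ => (val S).2 a0).
have tN : t None = false by rewrite ffunE eqxx.
have ok : compat D t m.
  rewrite (compat_outer D loc); apply/andP; split.
    have := valP S; rewrite (compat_outer D loc) => /andP[+ _].
    rewrite (outer_ext (t := t) (m := m) ext) ?agree_patch //.
    by apply/same_outP => c cN; rewrite ffunE cN.
  apply/forallP => c; apply/implyP => /eqP ->; rewrite crN tN /= !ffunE.
  rewrite /inner /= eqxx (negbTE a0o) (negbTE a2o).
  by have := smN S; rewrite SN => ->; rewrite !eqxx.
have Fao : eqv D t a0 o.
  by apply/eqvP => l /andP[_ /forallP/(_ None)]; rewrite crN tN /= => /andP[/eqP].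
have [eE eF _ _] := surg; have [_ sE _] := eE.
have Eao : ~~ eqv D (val S).1 a0 o by rewrite sE circ.
have FE := surgery_joinE (surgery_sym surg) Fao.
have lS := proj1 (compat_respects _ _ _) (valP S).
have mt := proj1 (compat_respects _ _ _) ok.
have := deg_join eE eF Eao FE lS mt.
have -> : m a0 = (val S).2 a0 by rewrite /m patch_out.
rewrite (negbTE So) /= => H.
suff <- : deg (eqv D t) m = deg (eqv D0 (val S0).1) (val S0).2.
  apply/eqP; rewrite -(inj_eq (addrI (pm ((val S).2 a0)))) addrC -H.
    by rewrite addrAC addrC addrA.
  move=> z za zo; rewrite patch_out //; apply: contra zo => /eqP->; exact/eqvP.
pose C := {a : A | ~~ inner a}.
have covD z : exists c : C, eqv D t z (val c).
  case iz: (inner z); last by exists (exist (fun a => ~~ inner a) z (negbT iz)) => /=; apply/eqvP.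
  exists (exist (fun a => ~~ inner a) a0 a0o) => /=; rewrite (eqP iz).
  by have [_ -> _] := eF.
have covD0 z : exists c : C, eqv D0 (val S0).1 z (g (val c)).
  by exists (exist (fun a => ~~ inner a) (k z) (k_out z)) => /=; rewrite gk; apply/eqvP.
rewrite -(deg_pull (f := val) eF mt covD).
rewrite -(deg_pull (f := fun c : C => g (val c)) (eqv_equiv _ _) (basis_respects (S := S0)) covD0).
have pE : pull (val : C -> A) (eqv D t) =2 pull (fun c : C => g (val c)) (eqv D0 (val S0).1).
  move=> a b; rewrite /pull FE /join ![eqv D _ _ o]sE !circ ?(valP a) ?(valP b) // andbF orbF.
  apply: (eqv_collapse locP D0_cr D0_base ext fib1 build1) => //; last 2 first.
  - exact: (valP a).
  - exact: (valP b).
  by move=> c /eqP->.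
rewrite (eq_deg _ pE).
by congr deg; apply/ffunP => c; rewrite !ffunE (negbTE (valP c)) ll //; apply: (valP c).
Qed.

End R1.

(** * The second move *)

Lemma surgery_swap (A : finType) (E F : rel A) x y : surgery E F x y -> surgery E F y x.
Proof.
have jC (G : rel A) a b : join G x y a b = join G y x a b.
  by rewrite /join; congr (_ || _); apply: orbC.
case=> eE eF EF xy; split=> //; first by move=> a b; rewrite -!jC.
by have [_ sE _] := eE; have [_ sF _] := eF; rewrite sE sF.
Qed.

Section R2.
Variables (A A0 I0 : finType) (D : arc_diagram A (option (option I0))) (D0 : arc_diagram A0 I0).
Variables (g : A -> A0) (k : A0 -> A) (a0 a1 a2 b0 b1 b2 : A).
Local Notation c := (None : option (option I0)).
Local Notation d := (Some None : option (option I0)).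
Hypothesis crc : cr D c = (true, (a0, a1), (b0, b1)).
Hypothesis crd : cr D d = (false, (a1, a2), (b1, b2)).
Hypothesis D0_cr : forall i, cr D0 i = map_crossing g (cr D (Some (Some i))).
Hypothesis D0_base : base_l D0 = g (base_l D) /\ base_r D0 = g (base_r D).
Let loc : pred (option (option I0)) := fun e => (e == c) || (e == d).
Let inner : pred A := pred2 a1 b1.
Hypothesis a1b1 : a1 != b1.
Hypothesis core : [&& ~~ inner a0, ~~ inner a2, ~~ inner b0 & ~~ inner b2].
Hypothesis ext : external D loc inner.
Hypothesis gk : cancel k g.
Hypothesis k_out : forall a, ~~ inner (k a).
Hypothesis ga : g a0 = g a2.
Hypothesis gb : g b0 = g b2.
Hypothesis fib : forall l : A -> bool, l a0 = l a2 -> l b0 = l b2 ->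
  forall a, ~~ inner a -> l a = l (k (g a)).
Hypothesis even : evenly_crossed D.
Variables (n0 n1 : int).

Local Notation X := (cube D (n0 + 1) n1).
Implicit Types (S T p q : state_basis D) (s t u : {ffun option (option I0) -> bool}).

Let locc S b b' := ((val S).1 c == b) && ((val S).1 d == b').
(* With markers [(0, 1)] the bigon is a separate circle. *)
Let P S := locc S true true || locc S false true && (val S).2 a1.
Let Q S := locc S false false || locc S false true && ~~ (val S).2 a1.
Let M S := locc S true false.
(** One equation describes two matchings, with markers at [(c, d)]: [(1, 1)] goes to [(0, 1)] with
    the bigon labelled [x], and [(0, 1)] with the bigon labelled [1] goes to [(0, 0)]. *)
Let r q p := [&& Q q, P p, (val q).1 d == (val p).1 c,
  same_out loc (val q).1 (val p).1 & agree inner (val q).2 (val p).2].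

Let sm S : let s := (val S).1 in let l := (val S).2 in
  (if s c then l a0 = l b1 /\ l a1 = l b0 else l a0 = l b0 /\ l a1 = l b1) /\
  (if s d then l a1 = l b1 /\ l a2 = l b2 else l a1 = l b2 /\ l a2 = l b1).
Proof.
have := loc_smoothed S c; have := loc_smoothed S d; rewrite crc crd /smoothed eqb_id eqbF_neg.
by case: ((val S).1 c); case: ((val S).1 d) => /andP[/eqP ? /eqP ?] /andP[/eqP ? /eqP ?].
Qed.

Let na0 : inner a0 = false. Proof. by case/and4P: core => /negbTE. Qed.
Let na2 : inner a2 = false. Proof. by case/and4P: core => _ /negbTE. Qed.
Let nb0 : inner b0 = false. Proof. by case/and4P: core => _ _ /negbTE. Qed.
Let nb2 : inner b2 = false. Proof. by case/and4P: core => _ _ _ /negbTE. Qed.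
Let na1 : inner a1 = true. Proof. by rewrite /inner /= eqxx. Qed.
Let nb1 : inner b1 = true. Proof. by rewrite /inner /= eqxx orbT. Qed.

Let b1a1 : (b1 == a1) = false. Proof. by rewrite eq_sym; apply: negbTE. Qed.

Let innerP a : inner a -> a = a1 \/ a = b1.
Proof. by case/pred2P; [left | right]. Qed.

Let make S (x y : bool) (u v : bool) :
  let l := (val S).2 in
  (if x then l a0 = v /\ u = l b0 else l a0 = l b0 /\ u = v) ->
  (if y then u = v /\ l a2 = l b2 else u = l b2 /\ l a2 = v) ->
  exists T : state_basis D, [/\ same_out loc (val S).1 (val T).1,
    (val T).1 c = x /\ (val T).1 d = y,
    agree inner (val S).2 (val T).2 & (val T).2 a1 = u /\ (val T).2 b1 = v].
Proof.
move=> l hx hy.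
have [|T [so sl ag Ti]] := transfer (S := S) (beta := fun e => if e == c then x else y)
  (f := fun a => if a == a1 then u else v) ext (fun _ _ => erefl).
  move=> e /orP[] /eqP -> /=; rewrite ?crc ?crd /= !ffunE ?na0 ?na2 na1 ?nb0 nb1 ?nb2 eqxx
    b1a1 -/l.
    by move: hx; case: x => -[-> ->]; rewrite !eqxx.
  by move: hy; case: y => -[-> ->]; rewrite !eqxx.
exists T; split=> //; first by rewrite !sl /loc.
by rewrite !Ti // eqxx b1a1.
Qed.

Let circ S z : locc S false true -> ~~ inner z -> eqv D (val S).1 a1 z = false.
Proof.
move=> /andP[/eqP sc /eqP sd] nz.
have := sm S; rewrite /= sc sd => -[[H1 H2] [H3 H4]].
apply: (not_eqv_toggle (loc := loc) (inner := inner) (f := fun _ => ~~ (val S).2 a1)) => //.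
  by case: ((val S).2 a1).
move=> e /orP[] /eqP ->; rewrite ?crc ?crd ?sc ?sd /= !ffunE ?na0 ?na2 ?na1 ?nb0 ?nb1 ?nb2.
  by rewrite H1 !eqxx.
by rewrite H4 !eqxx.
Qed.

Let eq_state S T : same_out loc (val S).1 (val T).1 -> (val S).1 c = (val T).1 c ->
  (val S).1 d = (val T).1 d -> agree inner (val S).2 (val T).2 ->
  (locc S false true -> (val S).2 a1 = (val T).2 a1) -> S = T.
Proof.
move=> so sc sd /[dup] ag /agreeP ag' H; apply: (state_basis_loc so _ ag).
  by move=> e /orP[] /eqP->.
have e0 : (val S).2 a0 = (val T).2 a0 by apply: ag'; rewrite na0.
have e2 : (val S).2 a2 = (val T).2 a2 by apply: ag'; rewrite na2.
have f0 : (val S).2 b0 = (val T).2 b0 by apply: ag'; rewrite nb0.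
have f2 : (val S).2 b2 = (val T).2 b2 by apply: ag'; rewrite nb2.
move: (sm S) (sm T) H e0 e2 f0 f2; rewrite /locc -sc -sd /=.
by case: ((val S).1 c); case: ((val S).1 d) => /= -[[? ?] [? ?]] [[? ?] [? ?]] H ? ? ? ? a /innerP[] ->;
  try have ? := H isT; congruence.
Qed.

Let same_out_sym s t : same_out loc s t = same_out loc t s.
Proof. by apply/same_outP/same_outP => H e /H ->. Qed.

Let trans_out s t u : same_out loc s t -> same_out loc s u -> same_out loc t u.
Proof. by move=> /same_outP H /same_outP H'; apply/same_outP => e le; rewrite -H -?H'. Qed.

Let trans_agree l m m' : agree inner l m -> agree inner l m' -> agree inner m m'.
Proof. by move=> /agreeP H /agreeP H'; apply/agreeP => e le; rewrite -H -?H'. Qed.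

Let step_out s t e : step e s t -> loc e -> same_out loc s t.
Proof.
by move=> /stepP[_ _ H] le; apply/same_outP => f; case: (eqVneq f e) => [-> | /H -> //]; rewrite le.
Qed.

Let step_c s t : s c -> t c = false -> s d = t d -> same_out loc s t -> step c s t.
Proof.
move=> sc tc sd /same_outP so; apply/stepP; split=> //.
by case=> [[e|]|] // _; rewrite ?so ?sd.
Qed.

Let step_d s t : s d -> t d = false -> s c = t c -> same_out loc s t -> step d s t.
Proof.
move=> sc tc sd /same_outP so; apply/stepP; split=> //.
by case=> [[e|]|] // _; rewrite ?so ?sd.
Qed.

Let eqv_ab S : locc S false true -> eqv D (val S).1 a1 b1.
Proof.
move=> /andP[/eqP sc _]; apply/eqvP => l /andP[_ /forallP/(_ c)].
by rewrite crc sc /= => /andP[_ /eqP].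
Qed.

Let circ_class S z : locc S false true -> eqv D (val S).1 z a1 = inner z.
Proof.
move=> lS; have [rE sE tE] := eqv_equiv D (val S).1; rewrite sE.
case iz: (inner z); last by rewrite circ ?iz.
by case: (innerP iz) => ->; rewrite ?rE ?eqv_ab.
Qed.

(** From [(1, 1)] the bigon is split off, an isomorphism onto its states labelled [x] by the counit
    axiom; towards [(0, 0)] it is merged, an isomorphism from its states labelled [1] by the unit
    axiom. *)
Lemma R2_reduced : homotopy_equiv X (reduced (X := X) P Q r).
Proof.
apply: reduced_equiv.
- exact: cube_complex.
- by move=> S; rewrite /P /Q /locc; case: ((val S).1 c); case: ((val S).1 d); case: ((val S).2 a1).
- by move=> q p /and3P[-> ->].
- move=> q Qq; have := sm q; have := Qq; rewrite /Q /locc.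
  case qc: ((val q).1 c); case qd: ((val q).1 d) => //= aq [[H1 H2] [H3 H4]].
    have [|p [so [pc pd] ag [pa pb]]] := @make q true true ((val q).2 a0) ((val q).2 a0) _ (conj erefl H4).
      by rewrite H1.
    by exists p; rewrite /r Qq so ag /P /locc pc pd qd.
  have [|p [so [pc pd] ag [pa pb]]] := @make q false true true true (conj H1 erefl).
    by split=> //; rewrite H4 -H2 H3.
  by exists p; rewrite /r Qq so ag /P /locc pc pd pa qd.
- move=> p Pp; have := sm p; have := Pp; rewrite /P /locc.
  case pc: ((val p).1 c); case pd: ((val p).1 d) => //= ap [[H1 H2] [H3 H4]].
    have [|q [so [qc qd] ag [qa qb]]] := @make p false true false false _ (conj erefl H4).
      by split=> //; rewrite H1 -H3 H2.
    exists q; rewrite /r Pp same_out_sym so agree_sym ag /Q /locc qc qd qa pc.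
    by [].
  have [||q [so [qc qd] ag [qa qb]]] := @make p false false ((val p).2 a2) ((val p).2 a2).
  + by [].
  + by [].
  by exists q; rewrite /r Pp same_out_sym so agree_sym ag /Q /locc qc qd pc.
- move=> q p p' /and5P[_ Pp /eqP c1 so ag] /and5P[_ Pp' /eqP c1' so' ag'].
  have cc : (val p).1 c = (val p').1 c by rewrite -c1.
  have dd S : P S -> (val S).1 d by rewrite /P /locc; case: ((val S).1 d); rewrite // !andbF.
  apply: eq_state => //; [exact: trans_out so so' | by rewrite (dd _ Pp) (dd _ Pp') | exact: trans_agree ag ag' |].
  move=> /andP[/eqP pc _]; have p'c : (val p').1 c = false by rewrite -cc.
  by move: (Pp) (Pp'); rewrite /P /locc pc p'c (dd _ Pp) (dd _ Pp') /= => -> ->.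
- move=> q q' p /and5P[Qq _ /eqP c1 so ag] /and5P[Qq' _ /eqP c1' so' ag'].
  have dd : (val q).1 d = (val q').1 d by rewrite c1.
  have cc S : Q S -> (val S).1 c = false by rewrite /Q /locc; case: ((val S).1 c).
  apply: eq_state => //; [|by rewrite (cc _ Qq) (cc _ Qq')| |].
  + by rewrite same_out_sym in so; rewrite same_out_sym in so'; apply: trans_out so so'.
  + by rewrite agree_sym in ag; rewrite agree_sym in ag'; apply: trans_agree ag ag'.
  move=> /andP[_ /eqP qd]; have q'd : (val q').1 d by rewrite -dd.
  by move: (Qq) (Qq'); rewrite /Q /locc qd q'd (cc _ Qq) (cc _ Qq') /= => /negbTE-> /negbTE->.
move=> p q Pp Qq; rewrite /r Pp Qq !andTb.
have pd : (val p).1 d by move: Pp; rewrite /P /locc; case: ((val p).1 d); rewrite // !andbF.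
have qc : (val q).1 c = false by move: Qq; rewrite /Q /locc; case: ((val q).1 c).
have [_ sE _] := eqv_equiv D (val p).1; have [_ sF _] := eqv_equiv D (val q).1.
case link: ((val q).1 d == (val p).1 c); last first.
  (* The markers at [(c, d)] go from [(0, 1)] to [(0, 1)], or from [(1, 1)] to [(0, 0)]. *)
  rewrite andFb; apply/eqP/negPn/negP => /dcoef_neq0[e st i]; have /stepP[pe qe E] := st.
  move: Pp Qq; rewrite /P /Q /locc qc pd; case pc: ((val p).1 c); case qd: ((val q).1 d);
    rewrite ?pc ?qd //= in link * => p1 q1.
    by case: (eqVneq e c) => [ec|ec]; [have := E d; rewrite ec pd qd => /(_ isT)
      | have := E c; rewrite eq_sym ec pc qc => /(_ isT)].
  have le : ~~ loc e by apply/negP => /orP[] /eqP ee; rewrite ee ?pc ?qd in pe qe.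
  have [_ _ /(_ e le)/and4P[nx ny _ _]] := ext.
  have iA : inc_at e p q by rewrite /inc_at st.
  have lp : locc p false true by rewrite /locc pc pd.
  have := inc_at_keeps (o := a1) iA; rewrite !circ //.
  by rewrite ?orbF in q1; rewrite p1 (negbTE q1) => /(_ isT isT).
rewrite andTb; case so: (same_out loc (val q).1 (val p).1); last first.
  apply: dcoef_nostep => e; apply/negP => st; have /stepP[pe qe E] := st.
  case le: (loc e); first by rewrite same_out_sym (step_out st le) in so.
  have Ec := E c; have Ed := E d; rewrite qc in Ec; rewrite pd in Ed.
  have ec : c != e by apply: contraFN le => /eqP <-.
  have ed : d != e by apply: contraFN le => /eqP <-.
  by move: link; rewrite -(Ec ec) (Ed ed).
rewrite andTb.
case pc: ((val p).1 c); rewrite pc in link;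
  rewrite /P /Q /locc ?pc pd qc (eqP link) /= in Pp Qq.
  have st : step c (val p).1 (val q).1 by apply: step_c; rewrite ?pd ?(eqP link) // same_out_sym.
  have surg := step_surgery even st; rewrite /cx /cy crc /= in surg.
  have lq : locc q false true by rewrite /locc qc link.
  rewrite (dcoef_step (n0 := n0 + 1) (n1 := n1) st) /cx /cy crc /=.
  rewrite inc_split_counit //; [|exact: basis_respects|exact: basis_respects|by rewrite circ_class ?na0].
  congr (_%:R : 'F_2); congr nat_of_bool; apply/forallP/agreeP => [H a na|H z].
    by have := H a; rewrite circ_class // na => /eqP.
  by rewrite circ_class //; apply/implyP => /H ->.
have st : step d (val p).1 (val q).1 by apply: step_d; rewrite ?pc ?(eqP link) // same_out_sym.
have surg := step_surgery even st; rewrite /cx /cy crd /= in surg.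
have lp : locc p false true by rewrite /locc pc pd.
rewrite (dcoef_step (n0 := n0 + 1) (n1 := n1) st) /cx /cy crd /=.
have [eE eF _ _] := surg.
rewrite inc_swap //; [|exact: basis_respects|exact: basis_respects].
have surg' := surgery_swap surg.
rewrite inc_merge_unit //; [|exact: basis_respects|exact: basis_respects|by rewrite circ_class ?na2].
congr (_%:R : 'F_2); congr nat_of_bool; apply/forallP/agreeP => [H a na|H z].
  by have := H a; rewrite circ_class // na => /eqP.
by rewrite circ_class //; apply/implyP => /H ->.
Qed.

(** The markers [(1, 0)], whose smoothings reconnect each strand across the bigon. *)
Let beta : option (option I0) -> bool := fun e => e == c.

Let frozen_cd s : frozen_out loc beta s -> s c /\ s d = false.
Proof. by move=> fs; rewrite !fs /loc ?eqxx. Qed.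

Let MF S : M S -> frozen_out loc beta (val S).1.
Proof. by move=> /andP[/eqP sc /eqP sd] e /orP[] /eqP ->. Qed.

Let compat_T s (l : {ffun A -> bool}) : frozen_out loc beta s -> compat D s l ->
  [/\ l a0 = l b1, l a1 = l b0, l a1 = l b2 & l a2 = l b1].
Proof.
move=> /frozen_cd[sc sd] /andP[_ /forallP H]; have := H c; have := H d.
by rewrite crc crd sc sd /= => /andP[/eqP ? /eqP ?] /andP[/eqP ? /eqP ?].
Qed.

Let fib2 s (l : {ffun A -> bool}) : frozen_out loc beta s -> compat D s l ->
  forall a, ~~ inner a -> l a = l (k (g a)).
Proof. by move=> fs /(compat_T fs)[? ? ? ?]; apply: fib; congruence. Qed.

Let build2 s (l0 : {ffun A0 -> bool}) : frozen_out loc beta s ->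
  outer D loc s [ffun a => l0 (g a)] ->
  exists S : state_basis D, [/\ M S, (val S).1 = s & forall a, ~~ inner a -> (val S).2 a = l0 (g a)].
Proof.
move=> fs os; have [sc sd] := frozen_cd fs.
have ok : compat D s (patch inner [ffun a => l0 (g a)] (fun a => if a == a1 then l0 (g b0) else l0 (g a0))).
  rewrite (compat_outer D loc); apply/andP; split.
    rewrite -(outer_ext (s := s) (l := [ffun a => l0 (g a)]) ext) ?agree_patch //.
    exact/same_outP.
  apply/forallP => e; apply/implyP => /orP[] /eqP ->; rewrite ?crc ?crd ?sc ?sd /= !ffunE;
    by rewrite ?na0 ?na2 na1 ?nb0 nb1 ?nb2 eqxx b1a1 ?ga ?gb !eqxx.
exists (exist (fun x => compat D x.1 x.2) (s, _) ok); split=> //=.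
  by rewrite /M /locc /= sc sd.
by move=> a na; rewrite patch_out // ffunE.
Qed.

Let j_inj : injective (fun i : I0 => Some (Some i)). Proof. by move=> i i' []. Qed.

Let locP e : ~~ loc e = (e \in codom (fun i : I0 => Some (Some i))).
Proof.
by case: e => [[i|]|]; rewrite /loc /=; symmetry; [apply/codomP; exists i | apply/negP => /codomP[] | apply/negP => /codomP[]].
Qed.

Let cov2 z : inner z ->
  exists2 e, ~~ inner e & forall s l, frozen_out loc beta s -> compat D s l -> l z = l e.
Proof.
case/innerP => ->; [exists b0 | exists a0]; rewrite ?na0 ?nb0 // => s l fs /(compat_T fs)[] //.
Qed.

Lemma reidemeister2_arcs : homotopy_equiv X (cube D0 n0 n1).
Proof.
apply: homotopy_equiv_trans R2_reduced _.
apply: (reduced_collapse j_inj locP D0_cr D0_base ext gk k_out MF fib2 build2).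
- move=> S T MS MT st ag; have /andP[/eqP sc /eqP sd] := MS; have /andP[/eqP tc /eqP td] := MT.
  by rewrite (@eq_state S T) // ?st ?sc ?sd //; [apply/same_outP | rewrite /locc sc].
- by move=> z /cov2; left.
- by move=> S; rewrite /P /Q /M /locc; case: ((val S).1 c); case: ((val S).1 d); case: ((val S).2 a1).
(* A step cannot raise a marker: from [(1, 0)] no state with [d] positive is reached, and [(1, 0)]
   is not reached from a state with [c] negative. One of the two occurs in every zigzag. *)
- move=> S T /andP[/eqP Sc /eqP Sd] /andP[/eqP Tc /eqP Td]; rewrite /zigzag big1 // => q _; rewrite big1 // => p _.
  case rqp: (r q p); last by rewrite mulr0 mul0r.
  have /and5P[_ Pp /eqP link _ _] := rqp.
  have pd : (val p).1 d by move: Pp; rewrite /P /locc; case: ((val p).1 d); rewrite // !andbF.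
  case pc: ((val p).1 c).
    suff -> : dcoef (b := X) S q = 0 by rewrite !mul0r.
    apply/eqP/negPn/negP => /dcoef_neq0[e /stepP[Se qe E] _].
    by case: (eqVneq e d) => [ed|ed]; [rewrite ed Sd in Se | have := E d; rewrite eq_sym ed link pc Sd => /(_ isT)].
  suff -> : dcoef (b := X) p T = 0 by rewrite mulr0.
  apply/eqP/negPn/negP => /dcoef_neq0[e /stepP[pe Te E] _].
  by case: (eqVneq e c) => [ec|ec]; [rewrite ec pc in pe | have := E c; rewrite eq_sym ec pc Tc => /(_ isT)].
move=> S0 S MS corr; have /correspondsP[ss ll] := corr.
have /andP[/eqP Sc /eqP Sd] := MS.
(* The negative marker at [d] accounts for the shift of [n0]. *)
have ngs : negs (val S).1 = (negs (val S0).1).+1.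
  rewrite negs_option Sc add0n negs_option ffunE Sd add1n; congr _.+1; congr negs.
  by apply/ffunP => i; rewrite !ffunE ss.
rewrite /= ngs (deg_collapse locP D0_cr D0_base ext gk k_out MF fib2 build2 cov2 MS corr).
by rewrite intS; split; ring.
Qed.

End R2.

(** * The third move *)

Section OutAgree.
Variables (A I : finType) (loc : pred I) (inner : pred A).
Implicit Types (s t u : {ffun I -> bool}) (l m : {ffun A -> bool}).

Lemma same_out_sym s t : same_out loc s t = same_out loc t s.
Proof. by apply/same_outP/same_outP => H e /H ->. Qed.

Lemma trans_out s t u : same_out loc s t -> same_out loc s u -> same_out loc t u.
Proof. by move=> /same_outP H /same_outP H'; apply/same_outP => e le; rewrite -H -?H'. Qed.

Lemma trans_agree l m m' : agree inner l m -> agree inner l m' -> agree inner m m'.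
Proof. by move=> /agreeP H /agreeP H'; apply/agreeP => e le; rewrite -H -?H'. Qed.

Lemma step_out s t e : step e s t -> loc e -> same_out loc s t.
Proof.
by move=> /stepP[_ _ H] le; apply/same_outP => f; case: (eqVneq f e) => [-> | /H -> //]; rewrite le.
Qed.

End OutAgree.

Section R3Local.
Variables (A I : finType) (tm tb mb : I) (t1 m1 b1 : A).
Hypothesis tmtb : tm != tb.
Hypothesis tmmb : tm != mb.
Hypothesis tbmb : tb != mb.
Hypothesis t1m1 : t1 != m1.
Hypothesis t1b1 : t1 != b1.
Hypothesis m1b1 : m1 != b1.

Definition loc3 : pred I := fun e => [|| e == tm, e == tb | e == mb].
Definition inner3 : pred A := fun a => [|| a == t1, a == m1 | a == b1].

Lemma loc3P e : loc3 e -> [\/ e = tm, e = tb | e = mb].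
Proof. by case/or3P => /eqP; [apply: Or31 | apply: Or32 | apply: Or33]. Qed.

Lemma inner3P a : inner3 a -> [\/ a = t1, a = m1 | a = b1].
Proof. by case/or3P => /eqP; [apply: Or31 | apply: Or32 | apply: Or33]. Qed.

Definition lab (s : {ffun I -> bool}) := (s tm, s tb, s mb).

(** Each strand is read from its outer arc towards its side [t1], [m1] or [b1] of the triangle,
    whatever its orientation. The marker opposite to the first component of a crossing cuts off the
    triangle; [tb] is the odd crossing. *)
Definition crossings3 (kappa : bool) (D : arc_diagram A I) (T T' M M' B B' : A) :=
  [/\ cr D tm = (kappa, (T, t1), (M, m1)), cr D tb = (~~ kappa, (T', t1), (B, b1))
    & cr D mb = (kappa, (M', m1), (B', b1))].

Section Half.
Variables (D : arc_diagram A I) (T T' M M' B B' : A).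
Hypothesis crD : crossings3 false D T T' M M' B B'.
Hypothesis core : [/\ ~~ inner3 T, ~~ inner3 T', ~~ inner3 M & ~~ inner3 M'] /\ (~~ inner3 B /\ ~~ inner3 B').
Hypothesis ext : external D loc3 inner3.
Hypothesis even : evenly_crossed D.
Variables (n0 n1 : int).
Implicit Types (S p q : state_basis D) (s : {ffun I -> bool}).
Local Notation X := (cube D n0 n1).

Definition glue3 s (l : A -> bool) :=
  [/\ if s tm then l T = l M /\ l t1 = l m1 else l T = l m1 /\ l t1 = l M,
      if s tb then l T' = l b1 /\ l t1 = l B else l T' = l B /\ l t1 = l b1 &
      if s mb then l M' = l B' /\ l m1 = l b1 else l M' = l b1 /\ l m1 = l B'].

Lemma compat_glue3 s (l : {ffun A -> bool}) : compat D s l -> glue3 s l.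
Proof.
have [H1 H2 H3] := crD; move=> /andP[_ /forallP H].
have := H tm; have := H tb; have := H mb; rewrite H1 H2 H3 /= eqb_id !eqbF_neg /glue3.
by do 3 (case: (s _); move=> /andP[/eqP ? /eqP ?]).
Qed.

Lemma make3 (D0 : arc_diagram A I) (S : state_basis D0) (x y z t m b : bool) :
  outer D loc3 =2 outer D0 loc3 ->
  let l := (val S).2 in
  (if x then l T = l M /\ t = m else l T = m /\ t = l M) ->
  (if y then l T' = b /\ t = l B else l T' = l B /\ t = b) ->
  (if z then l M' = l B' /\ m = b else l M' = b /\ m = l B') ->
  exists U : state_basis D, [/\ same_out loc3 (val S).1 (val U).1,
    lab (val U).1 = (x, y, z), agree inner3 (val S).2 (val U).2 &
    [/\ (val U).2 t1 = t, (val U).2 m1 = m & (val U).2 b1 = b]].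
Proof.
move=> oD l hx hy hz; have [H1 H2 H3] := crD.
have [[/negbTE nT /negbTE nT' /negbTE nM /negbTE nM'] [/negbTE nB /negbTE nB']] := core.
have it1 : inner3 t1 by rewrite /inner3 eqxx.
have im1 : inner3 m1 by rewrite /inner3 eqxx !orbT.
have ib1 : inner3 b1 by rewrite /inner3 eqxx !orbT.
have [m1t1 b1t1 b1m1] : [/\ m1 == t1 = false, b1 == t1 = false & b1 == m1 = false].
  by rewrite !(eq_sym m1) !(eq_sym b1) (negbTE t1m1) (negbTE t1b1) (negbTE m1b1).
have [tbtm mbtm mbtb] : [/\ tb == tm = false, mb == tm = false & mb == tb = false].
  by rewrite !(eq_sym tb) !(eq_sym mb) (negbTE tmtb) (negbTE tmmb) (negbTE tbmb).
have [|U [so sl ag Ui]] := transfer (D' := D) (S := S)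
  (beta := fun e => if e == tm then x else if e == tb then y else z)
  (f := fun a => if a == t1 then t else if a == m1 then m else b) ext oD.
  move=> e /loc3P[] ->; rewrite ?H1 ?H2 ?H3 /= !ffunE ?nT ?nT' ?nM ?nM' ?nB ?nB' ?it1 ?im1 ?ib1
    ?eqxx ?m1t1 ?b1t1 ?b1m1 ?tbtm ?mbtm ?mbtb -/l.
  - by move: hx; case: x => -[-> ->]; rewrite !eqxx.
  - by move: hy; case: y => -[-> ->]; rewrite !eqxx.
  - by move: hz; case: z => -[-> ->]; rewrite !eqxx.
exists U; split=> //.
  by rewrite /lab !sl /loc3 ?eqxx ?orbT // tbtm mbtm mbtb.
by rewrite !Ui // !eqxx m1t1 b1t1 b1m1.
Qed.

(* With markers [(1, 0, 1)] the central triangle is a separate circle. *)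
Definition P3 S := (lab (val S).1 == (true, true, true)) || (lab (val S).1 == (true, false, true)) && (val S).2 t1.
Definition Q3 S := (lab (val S).1 == (false, false, true)) || (lab (val S).1 == (true, false, true)) && ~~ (val S).2 t1.
(** As for the second move, one equation matches [(1, 1, 1)] with the triangle labelled [x], and the
    triangle labelled [1] with [(0, 0, 1)]. *)
Definition r3 q p := [&& Q3 q, P3 p, (val q).1 tm == (val p).1 tb,
  same_out loc3 (val q).1 (val p).1 & agree inner3 (val q).2 (val p).2].

Lemma circ3_class S a : lab (val S).1 = (true, false, true) -> forall o, inner3 o -> eqv D (val S).1 a o = inner3 a.
Proof.
case=> sm sb sz o io.
have gl l : compat D (val S).1 l -> [/\ l t1 = l m1, l t1 = l b1 & l m1 = l b1].
  by move=> /compat_glue3[]; rewrite sm sb sz => -[_ ?] [_ ?] [_ ?].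
case ia: (inner3 a).
  apply/eqvP => l /gl[? ? ?].
  by case: (inner3P ia) => ->; case: (inner3P io) => ->; congruence.
have [_ sE _] := eqv_equiv D (val S).1; rewrite sE.
have [H1 H2 H3] := crD.
have [[/negbTE nT /negbTE nT' /negbTE nM /negbTE nM'] [/negbTE nB /negbTE nB']] := core.
have it1 : inner3 t1 by rewrite /inner3 eqxx.
have im1 : inner3 m1 by rewrite /inner3 eqxx !orbT.
have ib1 : inner3 b1 by rewrite /inner3 eqxx !orbT.
apply: (not_eqv_toggle (loc := loc3) (inner := inner3) (f := fun _ => ~~ (val S).2 o)) => //.
- by rewrite ia.
- by case: ((val S).2 o).
have := compat_glue3 (valP S); rewrite /glue3 sm sb sz => -[[E1 _] [E2 _] [E3 _]].
by move=> e /loc3P[] ->; rewrite ?H1 ?H2 ?H3 ?sm ?sb ?sz /= !ffunE ?nT ?nT' ?nM ?nM' ?nB ?nB' ?it1 ?im1 ?ib1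
  ?E1 ?E2 ?E3 !eqxx.
Qed.

Lemma eq_state3 S S' : same_out loc3 (val S).1 (val S').1 -> lab (val S).1 = lab (val S').1 ->
  agree inner3 (val S).2 (val S').2 ->
  (lab (val S).1 = (true, false, true) -> (val S).2 t1 = (val S').2 t1) -> S = S'.
Proof.
move=> so [sa sb sc] /[dup] ag /agreeP ag' H; apply: (state_basis_loc so _ ag).
  by move=> e /loc3P[] ->.
have [[nT nT' nM nM'] [nB nB']] := core.
have gS := compat_glue3 (valP S); have gS' := compat_glue3 (valP S').
move: gS gS' H (ag' _ nT) (ag' _ nT') (ag' _ nM) (ag' _ nM') (ag' _ nB) (ag' _ nB').
rewrite /lab /glue3 -sa -sb -sc.
case: ((val S).1 tm); case: ((val S).1 tb); case: ((val S).1 mb) => /= -[[? ?] [? ?] [? ?]] [[? ?] [? ?] [? ?]] H ? ? ? ? ? ? a /inner3P[] ->;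
  by try have ? := H erefl; congruence.
Qed.

Lemma step3 (s t : {ffun I -> bool}) e : loc3 e -> s e -> t e = false ->
  (forall f, loc3 f -> f != e -> t f = s f) -> same_out loc3 s t -> step e s t.
Proof.
move=> le se te H /same_outP so; apply/stepP; split=> // f fe.
by case lf: (loc3 f); [apply: H | rewrite so ?lf].
Qed.

Lemma r3_inj q p p' : r3 q p -> r3 q p' -> p = p'.
Proof.
move=> /and5P[_ Pp /eqP c1 so ag] /and5P[_ Pp' /eqP c1' so' ag'].
have PE S : P3 S -> lab (val S).1 = (true, (val S).1 tb, true).
  by rewrite /P3 => /orP[/eqP E|/andP[/eqP E _]]; rewrite E; case: E => _ -> _.
have cc : (val p).1 tb = (val p').1 tb by rewrite -c1.
apply: eq_state3; [exact: trans_out so so' | by rewrite (PE p) // (PE p') // cc | exact: trans_agree ag ag' |].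
move=> lp; have lp' : lab (val p').1 = (true, false, true) by rewrite PE // -cc; have [_ -> _] := lp.
by move: Pp Pp'; rewrite /P3 lp lp' /= => -> ->.
Qed.

Lemma r3_inj' q q' p : r3 q p -> r3 q' p -> q = q'.
Proof.
move=> /and5P[Qq _ /eqP c1 so ag] /and5P[Qq' _ /eqP c1' so' ag'].
have QE S : Q3 S -> lab (val S).1 = ((val S).1 tm, false, true).
  by rewrite /Q3 => /orP[/eqP E|/andP[/eqP E _]]; rewrite E; case: E => -> _ _.
have cc : (val q).1 tm = (val q').1 tm by rewrite c1.
apply: eq_state3.
- by rewrite same_out_sym in so; rewrite same_out_sym in so'; apply: trans_out so so'.
- by rewrite (QE q) // (QE q') // cc.
- by rewrite agree_sym in ag; rewrite agree_sym in ag'; apply: trans_agree ag ag'.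
move=> lq; have lq' : lab (val q').1 = (true, false, true) by rewrite QE // -cc; have [-> _ _] := lq.
by move: Qq Qq'; rewrite /Q3 lq lq' /= => /negbTE-> /negbTE->.
Qed.

Lemma P3E S : P3 S -> [/\ (val S).1 tm, (val S).1 mb & (val S).1 tb = false -> (val S).2 t1].
Proof.
rewrite /P3 => /orP[/eqP[H1 H2 H3]|/andP[/eqP[H1 H2 H3] o]]; split=> //; rewrite ?H1 ?H3 //.
by rewrite H2.
Qed.

Lemma Q3E S : Q3 S -> [/\ (val S).1 tb = false, (val S).1 mb & (val S).1 tm -> (val S).2 t1 = false].
Proof.
rewrite /Q3 => /orP[/eqP[H1 H2 H3]|/andP[/eqP[H1 H2 H3] /negbTE o]]; split=> //; rewrite ?H2 ?H3 //.
by rewrite H1.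
Qed.

(** Smoothing [mb] positively turns the triangle into a bigon between [tm] and [tb], and the
    elimination is that of the second move. What remains is [(0, 1, 1)] and all the states with [mb]
    negative. *)
Lemma half_reduced : homotopy_equiv X (reduced (X := X) P3 Q3 r3).
Proof.
have oD : outer D loc3 =2 outer D loc3 by [].
have it1 : inner3 t1 by rewrite /inner3 eqxx.
have [[nT nT' nM nM'] [nB nB']] := core.
apply: reduced_equiv.
- exact: cube_complex.
- by move=> S; apply/negP => /andP[/P3E[a1 a2 a3] /Q3E[c1 c2 c3]]; have := a3 c1; rewrite c3.
- by move=> q p /and3P[-> ->].
- move=> q Qq; have [qb qz qo] := Q3E Qq; have := compat_glue3 (valP q).
  rewrite /glue3 qb qz; case qa: ((val q).1 tm) => -[[E1 F1] [E2 F2] [E3 F3]].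
    have [|||p [so lp ag _]] := @make3 D q true true true ((val q).2 B) ((val q).2 B) ((val q).2 B) oD.
    + by []. + by []. + by [].
    exists p; rewrite /r3 Qq so ag qa /P3 lp eqxx /=; by case: lp => _ -> _.
  have [|||p [so lp ag [pt pm pb]]] := @make3 D q true false true true true true oD.
  + by split=> //; rewrite E1 F3 -F2 F1. + by []. + by [].
  exists p; rewrite /r3 Qq so ag qa /P3 lp pt /=; by case: lp => _ -> _.
- move=> p Pp; have [pa pz po] := P3E Pp; have := compat_glue3 (valP p).
  rewrite /glue3 pa pz; case pb: ((val p).1 tb) => -[[E1 F1] [E2 F2] [E3 F3]].
    have [|||q [so lq ag [qt qm qb]]] := @make3 D p true false true false false false oD.
    + by []. + by split=> //; rewrite E2 -F3 -F1 F2. + by [].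
    exists q; rewrite /r3 Pp same_out_sym so agree_sym ag pb /Q3 lq qt /=; by case: lq => -> _ _.
  have [|||q [so lq ag [qt qm qb]]] := @make3 D p false false true ((val p).2 T) ((val p).2 T) ((val p).2 T) oD.
  + by []. + by []. + by [].
  exists q; rewrite /r3 Pp same_out_sym so agree_sym ag pb /Q3 lq /=; by case: lq => -> _ _.
- exact: r3_inj.
- exact: r3_inj'.
move=> p q Pp Qq; rewrite /r3 Pp Qq !andTb.
have [pa pz po] := P3E Pp; have [qb qz qo] := Q3E Qq.
have [_ sE _] := eqv_equiv D (val p).1; have [_ sF _] := eqv_equiv D (val q).1.
have [H1 H2 H3] := crD.
case link: ((val q).1 tm == (val p).1 tb); last first.
  rewrite andFb; apply/eqP/negPn/negP => /dcoef_neq0[e st i]; have /stepP[pe qe E] := st.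
  case pb: ((val p).1 tb); rewrite pb in link po.
    case qa: ((val q).1 tm); rewrite qa // in link.
    by case: (eqVneq e tm) => [ec|ec]; [have := E tb; rewrite ec eq_sym tmtb pb qb => /(_ isT)
      | have := E tm; rewrite eq_sym ec pa qa => /(_ isT)].
  case qa: ((val q).1 tm); rewrite qa // in link qo.
  have le : ~~ loc3 e by apply/negP => /loc3P[] ee; rewrite ee ?pa ?pb ?pz ?qa ?qb ?qz in pe qe.
  have [_ _ /(_ e le)/and4P[nx ny _ _]] := ext.
  have iA : inc_at e p q by rewrite /inc_at st.
  have lp : lab (val p).1 = (true, false, true) by rewrite /lab pa pb pz.
  have := inc_at_keeps (o := t1) iA; rewrite !(sE t1) !circ3_class // po // qo //.
  by move=> /(_ nx ny).
rewrite andTb; case so: (same_out loc3 (val q).1 (val p).1); last first.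
  apply: dcoef_nostep => e; apply/negP => st; have /stepP[pe qe E] := st.
  case le: (loc3 e); first by rewrite same_out_sym (step_out st le) in so.
  have Ea := E tm; have Eb := E tb; rewrite qb in Eb; rewrite pa in Ea.
  have ec : tm != e by apply: contraFN le => /eqP <-; rewrite /loc3 eqxx.
  have ed : tb != e by apply: contraFN le => /eqP <-; rewrite /loc3 eqxx orbT.
  by move: link; rewrite -(Eb ed) (Ea ec).
rewrite andTb.
case pb: ((val p).1 tb); rewrite pb in link po.
  have lq : lab (val q).1 = (true, false, true) by rewrite /lab qb qz (eqP link).
  have st : step tb (val p).1 (val q).1.
    apply: step3; rewrite ?pb ?qb 1?same_out_sym ?so /loc3 ?eqxx ?orbT //.
    by move=> f /loc3P[] ->; rewrite ?eqxx ?pa ?pz ?qz ?(eqP link).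
  have surg := step_surgery even st; rewrite /cx /cy H2 /= in surg.
  rewrite (dcoef_step (n0 := n0) (n1 := n1) st) /cx /cy H2 /=.
  rewrite inc_split_counit //; [|exact: basis_respects|exact: basis_respects|by rewrite circ3_class|by rewrite qo ?(eqP link)].
  congr (_%:R : 'F_2); congr nat_of_bool; apply/forallP/agreeP => [H a na|H z].
    by have := H a; rewrite circ3_class // na => /eqP.
  by rewrite circ3_class //; apply/implyP => /H ->.
have lp : lab (val p).1 = (true, false, true) by rewrite /lab pa pb pz.
have st : step tm (val p).1 (val q).1.
  apply: step3; rewrite ?pa ?(eqP link) 1?same_out_sym ?so /loc3 ?eqxx ?orbT //.
  by move=> f /loc3P[] ->; rewrite ?eqxx ?pb ?pz ?qz ?qb.
have surg := step_surgery even st; rewrite /cx /cy H1 /= in surg.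
rewrite (dcoef_step (n0 := n0) (n1 := n1) st) /cx /cy H1 /=.
rewrite inc_merge_unit //; [|exact: basis_respects|exact: basis_respects|by rewrite circ3_class|exact: po].
congr (_%:R : 'F_2); congr nat_of_bool; apply/forallP/agreeP => [H a na|H z].
  by have := H a; rewrite circ3_class // na => /eqP.
by rewrite circ3_class //; apply/implyP => /H ->.
Qed.

End Half.

End R3Local.

Section CoreEq.
Variables (A I : finType) (inner : pred A).

(** In both directions, this says that two states, possibly of different diagrams, connect the outer
    arcs in the same way. *)
Definition core_le (D1 D2 : arc_diagram A I) (s1 s2 : {ffun I -> bool}) :=
  forall l1, compat D1 s1 l1 -> exists2 l2, compat D2 s2 l2 & agree inner l1 l2.

Lemma core_le_eqv D1 D2 s1 s2 a b : core_le D1 D2 s1 s2 -> ~~ inner a -> ~~ inner b ->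
  eqv D2 s2 a b -> eqv D1 s1 a b.
Proof.
move=> le na nb /eqvP H; apply/eqvP => l1 /le[l2 c2 /agreeP ag].
by rewrite !ag // H.
Qed.

Definition core_eq D1 D2 s1 s2 := core_le D1 D2 s1 s2 /\ core_le D2 D1 s2 s1.

Lemma core_eq_eqv D1 D2 s1 s2 a b : core_eq D1 D2 s1 s2 -> ~~ inner a -> ~~ inner b ->
  eqv D1 s1 a b = eqv D2 s2 a b.
Proof. by move=> [le1 le2] na nb; apply/idP/idP; apply: core_le_eqv. Qed.

(* Arcs that are glued to the same outer arc before and after a surgery. *)
Definition anchored (D : arc_diagram A I) (s t : {ffun I -> bool}) z c :=
  [/\ ~~ inner c, eqv D s z c & eqv D t z c].

Definition covered D s t := forall z, exists c, anchored D s t z c.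

(** The two surgeries may occur at different crossings with different inner arcs; they are equal as
    soon as they can be read at the same outer arcs [cx] and [cy]. *)
Lemma inc_core (D1 D2 : arc_diagram A I) (S1 T1 : state_basis D1) (S2 T2 : state_basis D2) x1 y1 x2 y2 cx cy :
  core_eq D1 D2 (val S1).1 (val S2).1 -> core_eq D1 D2 (val T1).1 (val T2).1 ->
  covered D1 (val S1).1 (val T1).1 -> covered D2 (val S2).1 (val T2).1 ->
  agree inner (val S1).2 (val S2).2 -> agree inner (val T1).2 (val T2).2 ->
  anchored D1 (val S1).1 (val T1).1 x1 cx -> anchored D2 (val S2).1 (val T2).1 x2 cx ->
  anchored D1 (val S1).1 (val T1).1 y1 cy -> anchored D2 (val S2).1 (val T2).1 y2 cy ->
  inc (eqv D1 (val S1).1) (eqv D1 (val T1).1) x1 y1 (val S1).2 (val T1).2 =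
  inc (eqv D2 (val S2).1) (eqv D2 (val T2).1) x2 y2 (val S2).2 (val T2).2.
Proof.
move=> eS eT cov1 cov2 /agreeP aS /agreeP aT [nx x1S x1T] [_ x2S x2T] [ny y1S y1T] [_ y2S y2T].
pose C := {a : A | ~~ inner a}.
pose x : C := exist (fun a => ~~ inner a) cx nx; pose y : C := exist (fun a => ~~ inner a) cy ny.
have cvr D s t (l m : {ffun A -> bool}) : covered D s t -> forall z, (exists c : C, eqv D s z (val c) /\ eqv D t z (val c)) \/ m z = l z.
  by move=> cov z; have [c [nc c1 c2]] := cov z; left; exists (exist (fun a => ~~ inner a) c nc).
rewrite (inc_pull (f := val) (cx := x) (cy := y) (eqv_equiv _ _) (eqv_equiv _ _)
  (basis_respects (S := S1)) (basis_respects (S := T1)) (cvr _ _ _ _ _ cov1)) //.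
rewrite (inc_pull (f := val) (cx := x) (cy := y) (eqv_equiv _ _) (eqv_equiv _ _)
  (basis_respects (S := S2)) (basis_respects (S := T2)) (cvr _ _ _ _ _ cov2)) //.
have pE s1 s2 : core_eq D1 D2 s1 s2 -> pull (val : C -> A) (eqv D1 s1) =2 pull (val : C -> A) (eqv D2 s2).
  by move=> e a b; apply: core_eq_eqv e (valP a) (valP b).
rewrite (eq_inc _ _ _ _ (pE _ _ eS) (pE _ _ eT)).
by congr inc; apply/ffunP => c; rewrite !ffunE ?aS ?aT //; apply: (valP c).
Qed.

Lemma deg_core (D1 D2 : arc_diagram A I) (S1 : state_basis D1) (S2 : state_basis D2) :
  core_eq D1 D2 (val S1).1 (val S2).1 ->
  covered D1 (val S1).1 (val S1).1 -> covered D2 (val S2).1 (val S2).1 ->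
  agree inner (val S1).2 (val S2).2 ->
  deg (eqv D1 (val S1).1) (val S1).2 = deg (eqv D2 (val S2).1) (val S2).2.
Proof.
move=> eS cov1 cov2 /agreeP aS; pose C := {a : A | ~~ inner a}.
have cvr D s : covered D s s -> forall z, exists c : C, eqv D s z (val c).
  by move=> cov z; have [c [nc c1 _]] := cov z; exists (exist (fun a => ~~ inner a) c nc).
rewrite -(deg_pull (f := val) (eqv_equiv _ _) (basis_respects (S := S1)) (cvr _ _ cov1)).
rewrite -(deg_pull (f := val) (eqv_equiv _ _) (basis_respects (S := S2)) (cvr _ _ cov2)).
have pE : pull (val : C -> A) (eqv D1 (val S1).1) =2 pull (val : C -> A) (eqv D2 (val S2).1).
  by move=> a b; apply: core_eq_eqv eS (valP a) (valP b).
rewrite (eq_deg _ pE); congr deg.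
by apply/ffunP => c; rewrite !ffunE aS //; apply: (valP c).
Qed.

End CoreEq.

Lemma sum2_single (J : finType) (F : J -> J -> 'F_2) a b :
  (forall q p, (q, p) != (a, b) -> F q p = 0) -> \sum_q \sum_p F q p = F a b.
Proof.
by move=> F0; rewrite pair_big /= (bigD1 (a, b)) //= big1 ?addr0 // => -[q p] /F0.
Qed.

Section R3Zigzag.
Variables (A I : finType) (tm tb mb : I) (t1 m1 b1 : A).
Hypothesis tmtb : tm != tb.
Hypothesis tmmb : tm != mb.
Hypothesis tbmb : tb != mb.
Hypothesis t1m1 : t1 != m1.
Hypothesis t1b1 : t1 != b1.
Hypothesis m1b1 : m1 != b1.
Local Notation loc := (loc3 tm tb mb).
Local Notation inner := (inner3 t1 m1 b1).
Local Notation lab := (lab tm tb mb).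

Section Half.
Variables (D : arc_diagram A I) (T T' M M' B B' : A).
Hypothesis crD : crossings3 tm tb mb t1 m1 b1 false D T T' M M' B B'.
Hypothesis core : [/\ ~~ inner T, ~~ inner T', ~~ inner M & ~~ inner M'] /\ (~~ inner B /\ ~~ inner B').
Hypothesis ext : external D loc inner.
Hypothesis even : evenly_crossed D.
Variables (n0 n1 : int).
Implicit Types (S U p q : state_basis D) (s : {ffun I -> bool}).
Local Notation X := (cube D n0 n1).
Local Notation P := (P3 tm tb mb t1 (D := D)).
Local Notation Q := (Q3 tm tb mb t1 (D := D)).
Local Notation r := (r3 tm tb mb t1 m1 b1 (D := D)).

Definition rest S := ~~ P S && ~~ Q S.

Lemma restP S : rest S <-> lab (val S).1 = (false, true, true) \/ (val S).1 mb = false.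
Proof.
rewrite /rest /P3 /Q3 /lab.
case: ((val S).1 tm); case: ((val S).1 tb); case: ((val S).1 mb); case: ((val S).2 t1);
  (split; [move=> h; by [left | right] | by case=> [/eqP|]]).
Qed.

(** The only possible route is [(0, 1, 1)], then [(0, 0, 1)], back to [(1, 0, 1)] with the triangle
    labelled [1], then [(1, 0, 0)]. *)
Lemma zigzag_support S U : rest S -> rest U -> zigzag (X := X) r S U != 0 ->
  lab (val S).1 = (false, true, true) /\ lab (val U).1 = (true, false, false).
Proof.
move=> /restP HS /restP HU; rewrite /zigzag.
have [[q p] /= nz _|none] := pickP (fun x : state_basis D * state_basis D =>
   dcoef (b := X) S x.1 * (r x.1 x.2)%:R * dcoef (b := X) x.2 U != 0); last first.
  by rewrite big1 ?eqxx // => q _; rewrite big1 // => p _; have /negbFE/eqP := none (q, p).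
move: nz; rewrite !mulf_eq0 !negb_or => /andP[/andP[Sq qp] pU].
have {}qp : r q p by move: qp; case: (r q p); rewrite // eqxx.
have /and5P[Qq Pp /eqP link _ _] := qp.
have [qb qz _] := Q3E Qq; have [pa pz _] := P3E Pp.
have [e ste _] := dcoef_neq0 (n0 := n0) (n1 := n1) Sq; have [f stf _] := dcoef_neq0 (n0 := n0) (n1 := n1) pU.
have /stepP[Se qe E] := ste; have /stepP[pf Uf F] := stf.
have Sz : (val S).1 mb.
  by have [<-//|em] := eqVneq e mb; rewrite -E // eq_sym.
have {HS} HS : lab (val S).1 = (false, true, true) by case: HS => //; rewrite Sz.
have [Sa Sb _] := HS.
have eb : e = tb.
  by have [//|em] := eqVneq e tb; have := E tb; rewrite eq_sym em qb Sb => /(_ isT).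
have qa : (val q).1 tm = false by rewrite E ?Sa // eb.
have pb : (val p).1 tb = false by rewrite -link.
split=> //.
have Ub : (val U).1 tb = false.
  have [fb|fb] := eqVneq f tb; first by rewrite fb pb in pf.
  by rewrite F ?pb // eq_sym.
have Uz : (val U).1 mb = false by case: HU => // -[_]; rewrite Ub.
have fz : f = mb.
  by have [//|fm] := eqVneq f mb; have := F mb; rewrite eq_sym fm pz Uz => /(_ isT).
by rewrite /lab Ub Uz F ?pa // fz.
Qed.

Lemma make_occ U : lab (val U).1 = (true, false, false) ->
  exists U0 : state_basis D, [/\ same_out loc (val U).1 (val U0).1,
    lab (val U0).1 = (false, false, true) & agree inner (val U).2 (val U0).2].
Proof.
move=> [Ua Ub Uz]; have := compat_glue3 crD (valP U); rewrite /glue3 Ua Ub Uz => -[[E1 F1] [E2 F2] [E3 F3]].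
have [|||U0 [so lq ag _]] := make3 tmtb tmmb tbmb t1m1 t1b1 m1b1 crD core ext (S := U)
  (x := false) (y := false) (z := true) (t := (val U).2 T) (m := (val U).2 T) (b := (val U).2 T) (fun _ _ => erefl).
- by rewrite -E1.
- by split.
- by split=> //; rewrite E3 -F3 -F1 F2.
by exists U0.
Qed.

(** The last leg merges the triangle labelled [1], which does not change the outer labels. So [U]
    determines the middle of the zigzag, and only the coefficient of the first leg is left. *)
Lemma zigzag_eval S U U0 : lab (val S).1 = (false, true, true) -> lab (val U).1 = (true, false, false) ->
  same_out loc (val U).1 (val U0).1 -> lab (val U0).1 = (false, false, true) ->
  agree inner (val U).2 (val U0).2 ->
  zigzag (X := X) r S U = dcoef (b := X) S U0.
Proof.
move=> lS lU so0 l0 ag0.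
have [Ua Ub Uz] := lU; have [Sa Sb Sz] := lS.
have := compat_glue3 crD (valP U); rewrite /glue3 Ua Ub Uz => -[[E1 F1] [E2 F2] [E3 F3]].
have [|||p0 [so1 lp0 ag1 [pt pm pb]]] := make3 tmtb tmmb tbmb t1m1 t1b1 m1b1 crD core ext (S := U)
  (x := true) (y := false) (z := true) (t := true) (m := true) (b := true) (fun _ _ => erefl).
- by [].
- by [].
- by split=> //; rewrite E3 -F3 -F1 F2.
have rU0 : r U0 p0.
  have [_ pb0 _] := lp0; have [qa0 _ _] := l0.
  rewrite /r3 /Q3 /P3 l0 lp0 pt qa0 pb0 eqxx /= (trans_out so0 so1).
  exact: trans_agree ag0 ag1.
have d0 : dcoef (b := X) p0 U = 1.
  have [pa pb' pz] := lp0; have [_ _ H3] := crD.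
  have st : step mb (val p0).1 (val U).1.
    apply: (step3 (tm := tm) (tb := tb) (mb := mb)); rewrite ?pz ?Uz 1?same_out_sym ?so1 /loc3 ?eqxx ?orbT //.
    by move=> f /loc3P[] ->; rewrite ?eqxx ?pa ?pb' ?Ua ?Ub.
  have surg := step_surgery even st; rewrite /cx /cy H3 /= in surg.
  rewrite (dcoef_step (n0 := n0) (n1 := n1) st) /cx /cy H3 /=.
  have [[nT nT' nM nM'] _] := core.
  have im1 : inner m1 by rewrite /inner3 eqxx !orbT.
  rewrite inc_merge_unit //; try exact: basis_respects.
    rewrite (_ : [forall z, _]) //; apply/forallP => z.
    rewrite (circ3_class crD core ext z lp0 im1); apply/implyP => nz.
    by move/agreeP: ag1 => ->.
  by rewrite (circ3_class crD core ext M' lp0 im1).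
rewrite /zigzag (sum2_single (a := U0) (b := p0)) => [|q p qU0]; first by rewrite rU0 d0 !mulr1.
case qp: (r q p); last by rewrite mulr0 mul0r.
have [Sq|Sq] := eqVneq (dcoef (b := X) S q) 0; first by rewrite Sq !mul0r.
have [pU|pU] := eqVneq (dcoef (b := X) p U) 0; first by rewrite pU mulr0.
exfalso; case/negP: qU0; suff pp0 : p = p0.
  by rewrite pp0 in qp *; rewrite (r3_inj' crD core qp rU0).
have /and5P[Qq Pp /eqP link _ _] := qp.
have [qb qz _] := Q3E Qq; have [pa pz po] := P3E Pp.
have [f stf _] := dcoef_neq0 (n0 := n0) (n1 := n1) Sq; have [f' st i] := dcoef_neq0 (n0 := n0) (n1 := n1) pU.
have /stepP[Se qe E] := stf.
have fb : f = tb.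
  by have [//|em] := eqVneq f tb; have := E tb; rewrite eq_sym em qb Sb => /(_ isT).
have pb' : (val p).1 tb = false by rewrite -link E ?Sa // fb.
have lp : lab (val p).1 = (true, false, true) by rewrite /lab pa pb' pz.
have /stepP[_ _ F] := st.
have fm : f' = mb.
  by have [//|em] := eqVneq f' mb; have := F mb; rewrite eq_sym em pz Uz => /(_ isT).
have so : same_out loc (val p).1 (val U).1 by apply: step_out st _; rewrite fm /loc3 eqxx !orbT.
apply: (eq_state3 crD core).
- by rewrite same_out_sym in so; apply: trans_out so so1.
- by rewrite lp lp0.
- have [_ _ H3] := crD.
  have surg := step_surgery even st; move: i surg; rewrite fm /cx /cy H3 /= => i surg.
  have im1 : inner m1 by rewrite /inner3 eqxx !orbT.
  have := compat_glue3 crD (valP p); rewrite /glue3 pa pb' pz => -[[_ pt1] _ _].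
  move: i; rewrite inc_merge_unit //; try exact: basis_respects; last by rewrite -pt1 po.
    move/forallP=> H; apply: trans_agree ag1; apply/agreeP => a na.
    by have := H a; rewrite (circ3_class crD core ext a lp im1) na => /eqP.
  by have [[nT nT' nM nM'] _] := core; rewrite (circ3_class crD core ext M' lp im1).
- by move=> _; rewrite pt po.
Qed.

End Half.
End R3Zigzag.

Lemma core_eq_sym (A I : finType) (inner : pred A) (D1 D2 : arc_diagram A I) s1 s2 :
  core_eq inner D1 D2 s1 s2 -> core_eq inner D2 D1 s2 s1.
Proof. by case. Qed.

Lemma core_le_trans (A I : finType) (inner : pred A) (D1 D2 D3 : arc_diagram A I) s1 s2 s3 :
  core_le inner D1 D2 s1 s2 -> core_le inner D2 D3 s2 s3 -> core_le inner D1 D3 s1 s3.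
Proof.
move=> le1 le2 l1 /le1[l2 /le2[l3 c3 ag'] ag]; exists l3 => //.
by rewrite agree_sym in ag; apply: trans_agree ag ag'.
Qed.

Lemma core_eq_trans (A I : finType) (inner : pred A) (D1 D2 D3 : arc_diagram A I) s1 s2 s3 :
  core_eq inner D1 D2 s1 s2 -> core_eq inner D2 D3 s2 s3 -> core_eq inner D1 D3 s1 s3.
Proof. by case=> a b [c d]; split; [apply: core_le_trans a c | apply: core_le_trans d b]. Qed.

Section R3Pair.
Variables (A I : finType) (tm tb mb : I) (t1 m1 b1 : A).
Hypothesis tmtb : tm != tb.
Hypothesis tmmb : tm != mb.
Hypothesis tbmb : tb != mb.
Hypothesis t1m1 : t1 != m1.
Hypothesis t1b1 : t1 != b1.
Hypothesis m1b1 : m1 != b1.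
Local Notation loc := (loc3 tm tb mb).
Local Notation inner := (inner3 t1 m1 b1).
Local Notation lab := (lab tm tb mb).

Lemma lab_eq (s t : {ffun I -> bool}) : same_out loc s t -> lab s = lab t -> s = t.
Proof.
move=> /same_outP so [ea eb ec]; apply/ffunP => c; case lc: (loc c); last by apply: so; rewrite lc.
by case: (loc3P lc) => ->.
Qed.

(* When [mb] has the negative marker, the two sides of the move match once the
   crossings of the top strand are exchanged. For the other remaining markers the
   zigzag terms on one side are direct terms of the differential on the other. *)
Definition sw (x : bool * bool * bool) : bool * bool * bool :=
  if x.2 then x else (x.1.2, x.1.1, x.2).

Definition rho (D1 D2 : arc_diagram A I) (S : state_basis D1) (S' : state_basis D2) :=
  [&& same_out loc (val S).1 (val S').1, agree inner (val S).2 (val S').2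
    & lab (val S').1 == sw (lab (val S).1)].

Lemma swK : involutive sw. Proof. by case=> [[a b] []]. Qed.

Lemma rho_sym D1 D2 (S : state_basis D1) (S' : state_basis D2) : rho S S' = rho S' S.
Proof. by rewrite /rho same_out_sym agree_sym -(inj_eq (inv_inj swK)) swK eq_sym. Qed.

Local Notation rest D := (rest tm tb mb t1 (D := D)).

Lemma rho_rest D1 D2 (S : state_basis D1) (S' : state_basis D2) : rho S S' -> rest D1 S -> rest D2 S'.
Proof.
move=> /and3P[_ _ /eqP l'] /restP H; apply/restP.
case: H => [lS|Sz]; first by left; rewrite l' lS.
by right; move: l'; rewrite /lab /sw /= Sz => -[_ _ ->].
Qed.

Section Covers.
Variables (D : arc_diagram A I) (T T' M M' B B' : A).
Hypothesis crD : crossings3 tm tb mb t1 m1 b1 false D T T' M M' B B'.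
Hypothesis core : [/\ ~~ inner T, ~~ inner T', ~~ inner M & ~~ inner M'] /\ (~~ inner B /\ ~~ inner B').

Lemma glued3 s a b : (forall l : {ffun A -> bool}, glue3 tm tb mb t1 m1 b1 T T' M M' B B' s l -> l a = l b) -> eqv D s a b.
Proof. by move=> H; apply/eqvP => l /(compat_glue3 crD)/H. Qed.

Lemma covered_mk s t ct cm cb : anchored inner D s t t1 ct -> anchored inner D s t m1 cm ->
  anchored inner D s t b1 cb -> covered inner D s t.
Proof.
move=> Ht Hm Hb z; case iz: (inner z).
  by case: (inner3P iz) => ->; [exists ct | exists cm | exists cb].
by exists z; split; rewrite ?iz //; apply/eqvP.
Qed.

Lemma anchored_self s t a : ~~ inner a -> anchored inner D s t a a.
Proof. by move=> na; split=> //; apply/eqvP. Qed.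

Lemma anchor_t1_M (s t : {ffun I -> bool}) : s tm = false -> t tm = false -> anchored inner D s t t1 M.
Proof.
by move=> sa ta; have [[? ? ? ?] [? ?]] := core; split=> //; apply: glued3 => l; rewrite /glue3 ?sa ?ta => -[[_ ->]].
Qed.

Lemma anchor_m1_T (s t : {ffun I -> bool}) : s tm = false -> t tm = false -> anchored inner D s t m1 T.
Proof.
by move=> sa ta; have [[? ? ? ?] [? ?]] := core; split=> //; apply: glued3 => l; rewrite /glue3 ?sa ?ta => -[[->]].
Qed.

Lemma anchor_t1_B (s t : {ffun I -> bool}) : s tb -> t tb -> anchored inner D s t t1 B.
Proof.
by move=> sa ta; have [[? ? ? ?] [? ?]] := core; split=> //; apply: glued3 => l; rewrite /glue3 ?sa ?ta => -[_ [_ ->]].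
Qed.

Lemma anchor_b1_T' (s t : {ffun I -> bool}) : s tb -> t tb -> anchored inner D s t b1 T'.
Proof.
by move=> sa ta; have [[? ? ? ?] [? ?]] := core; split=> //; apply: glued3 => l; rewrite /glue3 ?sa ?ta => -[_ [->]].
Qed.

Lemma anchor_m1_B' (s t : {ffun I -> bool}) : s mb = false -> t mb = false -> anchored inner D s t m1 B'.
Proof.
by move=> sa ta; have [[? ? ? ?] [? ?]] := core; split=> //; apply: glued3 => l; rewrite /glue3 ?sa ?ta => -[_ _ [_ ->]].
Qed.

Lemma anchor_b1_M' (s t : {ffun I -> bool}) : s mb = false -> t mb = false -> anchored inner D s t b1 M'.
Proof.
by move=> sa ta; have [[? ? ? ?] [? ?]] := core; split=> //; apply: glued3 => l; rewrite /glue3 ?sa ?ta => -[_ _ [->]].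
Qed.

Lemma anchor_t1_B' (s t : {ffun I -> bool}) : s tm -> t tm -> s mb = false -> t mb = false -> anchored inner D s t t1 B'.
Proof.
by move=> sa ta sc tc; have [[? ? ? ?] [? ?]] := core; split=> //; apply: glued3 => l; rewrite /glue3 ?sa ?ta ?sc ?tc => -[[_ ->] _ [_ ->]].
Qed.

Lemma anchor_t1_M' (s t : {ffun I -> bool}) : s tb = false -> t tb = false -> s mb = false -> t mb = false -> anchored inner D s t t1 M'.
Proof.
by move=> sa ta sc tc; have [[? ? ? ?] [? ?]] := core; split=> //; apply: glued3 => l; rewrite /glue3 ?sa ?ta ?sc ?tc => -[_ [_ ->] [->]].
Qed.

Lemma anchor_b1_T (s t : {ffun I -> bool}) : s tm = false -> t tm = false -> s mb -> t mb -> anchored inner D s t b1 T.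
Proof.
by move=> sa ta sc tc; have [[? ? ? ?] [? ?]] := core; split=> //; apply: glued3 => l; rewrite /glue3 ?sa ?ta ?sc ?tc => -[[-> _] _ [_ ->]].
Qed.

(** In a surviving state the triangle is not closed up, and a crossing whose marker is the same in
    [S] and [U] leads each inner arc to an outer one. *)
Lemma covered_rest (S U : state_basis D) : rest D S -> rest D U ->
  ((val S).1 tm = (val U).1 tm) \/ ((val S).1 tb = (val U).1 tb) ->
  (lab (val U).1 = (false, true, true) -> lab (val S).1 = (false, true, true)) ->
  (lab (val S).1 = (false, true, true) -> (val U).1 tm = false /\ (val U).1 tb) ->
  covered inner D (val S).1 (val U).1.
Proof.
move=> /restP HS /restP HU E1 E2 E3.
case: HS => [lS|Sz].
  have [Ua Ub] := E3 lS; case: lS => Sa Sb _.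
  exact: covered_mk (anchor_t1_M Sa Ua) (anchor_m1_T Sa Ua) (anchor_b1_T' Sb Ub).
have {HU} Uz : (val U).1 mb = false by case: HU => // /E2 [_ _]; rewrite Sz.
have cm := anchor_m1_B' Sz Uz; have cb := anchor_b1_M' Sz Uz.
case: E1 => E.
  case Sa: ((val S).1 tm); rewrite Sa in E.
    exact: covered_mk (anchor_t1_B' Sa (esym E) Sz Uz) cm cb.
  exact: covered_mk (anchor_t1_M Sa (esym E)) cm cb.
case Sb: ((val S).1 tb); rewrite Sb in E.
  exact: covered_mk (anchor_t1_B Sb (esym E)) cm cb.
exact: covered_mk (anchor_t1_M' Sb (esym E) Sz Uz) cm cb.
Qed.

End Covers.

Section OneSide.
Variables (D1 D2 : arc_diagram A I) (T T' M M' B B' : A).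
Hypothesis cr1 : crossings3 tm tb mb t1 m1 b1 false D1 T T' M M' B B'.
Hypothesis cr2 : crossings3 tm tb mb t1 m1 b1 false D2 T' T M' M B' B.
Hypothesis core1 : [/\ ~~ inner T, ~~ inner T', ~~ inner M & ~~ inner M'] /\ (~~ inner B /\ ~~ inner B').
Hypothesis core2 : [/\ ~~ inner T', ~~ inner T, ~~ inner M' & ~~ inner M] /\ (~~ inner B' /\ ~~ inner B).
Hypothesis ext1 : external D1 loc inner.
Hypothesis ext2 : external D2 loc inner.
Hypothesis base12 : base_l D1 = base_l D2 /\ base_r D1 = base_r D2.
Hypothesis cr12 : forall c, ~~ loc c -> cr D1 c = cr D2 c.
Hypothesis even1 : evenly_crossed D1.
Hypothesis even2 : evenly_crossed D2.
Variables (n0 n1 : int).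

Lemma outer12 : outer D2 loc =2 outer D1 loc.
Proof.
move=> s l; rewrite /outer; have [-> ->] := base12; congr (_ && _).
by apply: eq_forallb => c; case lc: (loc c) => //=; rewrite cr12 ?lc.
Qed.

(** The inner labels on the second side are dictated by the outer ones. These one-sided lemmas are
    applied with the sides in both orders, which yields a bijection. *)
Lemma rho_ex (S : state_basis D1) : rest D1 S -> exists S' : state_basis D2, rho S S'.
Proof.
move=> /restP H; have := compat_glue3 cr1 (valP S); rewrite /glue3.
have mk x y z t m b := make3 tmtb tmmb tbmb t1m1 t1b1 m1b1 cr2 core2 ext2 (S := S)
  (x := x) (y := y) (z := z) (t := t) (m := m) (b := b) outer12.
case: H => [lS|Sz].
  case: (lS) => Sa Sb Sz; rewrite Sa Sb Sz => -[[E1 F1] [E2 F2] [E3 F3]].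
  have [|||S' [so l' ag _]] := mk false true true ((val S).2 M') ((val S).2 T') ((val S).2 T).
  - by split.
  - by split=> //.
  - by split; congruence.
  by exists S'; rewrite /rho so ag l' lS.
case Sa: ((val S).1 tm); case Sb: ((val S).1 tb); rewrite Sz => -[[E1 F1] [E2 F2] [E3 F3]].
- have [|||S' [so l' ag _]] := mk true true false ((val S).2 B) ((val S).2 B) ((val S).2 M).
  + by split; congruence.
  + by split; congruence.
  + by split.
  by exists S'; rewrite /rho so ag l' /lab Sa Sb Sz.
- have [|||S' [so l' ag _]] := mk false true false ((val S).2 M') ((val S).2 B) ((val S).2 M).
  + by split; congruence.
  + by split; congruence.
  + by split.
  by exists S'; rewrite /rho so ag l' /lab Sa Sb Sz.
- have [|||S' [so l' ag _]] := mk true false false ((val S).2 B) ((val S).2 B) ((val S).2 M).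
  + by split; congruence.
  + by split; congruence.
  + by split.
  by exists S'; rewrite /rho so ag l' /lab Sa Sb Sz.
- have [|||S' [so l' ag _]] := mk false false false ((val S).2 M') ((val S).2 B) ((val S).2 M).
  + by split; congruence.
  + by split; congruence.
  + by split.
  by exists S'; rewrite /rho so ag l' /lab Sa Sb Sz.
Qed.

Lemma rho_inj (S : state_basis D1) (S' S'' : state_basis D2) : rest D1 S -> rho S S' -> rho S S'' -> S' = S''.
Proof.
move=> RS rS' /and3P[so'' ag'' /eqP l'']; have := rho_rest rS' RS; have /and3P[so' ag' /eqP l'] := rS'.
move=> /restP R'; apply: (eq_state3 cr2 core2).
- exact: trans_out so' so''.
- by rewrite l' l''.
- exact: trans_agree ag' ag''.
by move=> E; move: R'; rewrite E; case: E => _ _ ->; case.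
Qed.

Lemma rho_core_le (S : state_basis D1) (S' : state_basis D2) : rest D1 S -> rho S S' ->
  core_le inner D1 D2 (val S).1 (val S').1.
Proof.
move=> RS /and3P[so ag /eqP l'] l1 c1.
pose U : state_basis D1 := exist (fun p => compat D1 p.1 p.2) ((val S).1, l1) c1.
have RU : rest D1 U by apply/restP; move/restP: RS.
have [U' /and3P[soU agU /eqP lU]] := rho_ex RU.
exists (val U').2; last exact: agU.
have -> : (val S').1 = (val U').1 by apply: lab_eq; [exact: trans_out so soU | rewrite l' lU].
exact: (valP U').
Qed.

Lemma rho_lab (S : state_basis D1) (S' : state_basis D2) : rho S S' ->
  [/\ (val S').1 mb = (val S).1 mb,
      (val S').1 tm = (if (val S).1 mb then (val S).1 tm else (val S).1 tb)
    & (val S').1 tb = (if (val S).1 mb then (val S).1 tb else (val S).1 tm)].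
Proof. by move=> /and3P[_ _ /eqP]; rewrite /sw /lab /=; case: ((val S).1 mb) => -[-> -> ->]. Qed.

Section Matching.
Hypothesis core_eq12 : forall (S : state_basis D1) (S' : state_basis D2), rest D1 S -> rho S S' ->
  core_eq inner D1 D2 (val S).1 (val S').1.

Lemma rest_cases S : rest D1 S -> (val S).1 mb -> (val S).1 tm = false /\ (val S).1 tb.
Proof. by move=> /restP[[-> -> _]|->]. Qed.

Lemma step_rho (S U : state_basis D1) (S' U' : state_basis D2) c :
  rest D1 S -> rest D1 U -> rho S S' -> rho U U' ->
  (val U).1 mb = (val S).1 mb -> step c (val S).1 (val U).1 ->
  exists2 c', step c' (val S').1 (val U').1 &
    inc (eqv D1 (val S).1) (eqv D1 (val U).1) (cx D1 c) (cy D1 c) (val S).2 (val U).2 =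
    inc (eqv D2 (val S').1) (eqv D2 (val U').1) (cx D2 c') (cy D2 c') (val S').2 (val U').2.
Proof.
move=> RS RU rS rU mbE st; have /stepP[Sc Uc E] := st.
have RS' := rho_rest rS RS; have RU' := rho_rest rU RU.
have [sz sa sb] := rho_lab rS; have [uz ua ub] := rho_lab rU.
have [[nT nT' nM nM'] [nB nB']] := core1.
have /and3P[soS agS _] := rS; have /and3P[soU agU _] := rU.
have [H11 H12 H13] := cr1; have [H21 H22 H23] := cr2.
have cov1 : (val S).1 tm = (val U).1 tm \/ (val S).1 tb = (val U).1 tb ->
    covered inner D1 (val S).1 (val U).1.
  move=> H; apply: (covered_rest cr1 core1) => //.
  - by move=> [_ _ uz']; move/restP: RS => [//|]; rewrite -mbE uz'.
  - by move=> lS; have [_ _ sz'] := lS; apply: rest_cases => //; rewrite mbE.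
have cov2 : (val S').1 tm = (val U').1 tm \/ (val S').1 tb = (val U').1 tb ->
    covered inner D2 (val S').1 (val U').1.
  move=> H; apply: (covered_rest cr2 core2) => //.
  - by move=> [_ _ uz']; move/restP: RS' => [//|]; rewrite sz -mbE -uz uz'.
  - move=> [_ _ sz']; have mS : (val S).1 mb by rewrite -sz.
    have mU : (val U).1 mb by rewrite mbE.
    have [u1 u2] := rest_cases RU mU.
    by rewrite ua ub mU.
case lc: (loc c); last first.
  have nlc : ~~ loc c by rewrite lc.
  have nc x : loc x -> x != c by apply: contraTN => /eqP ->.
  have Eq x : loc x -> (val U).1 x = (val S).1 x by move=> lx; apply: E; apply: nc.
  have Ea : (val U).1 tm = (val S).1 tm by apply: Eq; rewrite /loc3 eqxx.
  have Eb : (val U).1 tb = (val S).1 tb by apply: Eq; rewrite /loc3 eqxx orbT.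
  have cxE : cx D2 c = cx D1 c by rewrite /cx cr12.
  have cyE : cy D2 c = cy D1 c by rewrite /cy cr12.
  have [_ _ /(_ c nlc)/and4P[nx ny _ _]] := ext1.
  exists c.
    move/same_outP: soS => soS; move/same_outP: soU => soU.
    apply/stepP; split; rewrite -?soS -?soU // => f fc.
    case lf: (loc f); last by rewrite -soS ?lf // -soU ?lf // E.
    by case: (loc3P lf) => ->; rewrite ?sa ?sb ?sz ?ua ?ub ?uz mbE ?Ea ?Eb.
  rewrite cxE cyE; apply: (inc_core (inner := inner) (cx := cx D1 c) (cy := cy D1 c)) => //;
    try exact: anchored_self; try exact: core_eq12.
  - by apply: cov1; left.
  - by apply: cov2; left; rewrite sa ua mbE Ea Eb.
have mbc : mb != c.
  by apply/negP => /eqP mc; rewrite -mc in Sc Uc; rewrite -mbE Uc in Sc.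
have Sz : (val S).1 mb = false.
  case Sz: ((val S).1 mb) => //; have [Sa Sb] := rest_cases RS Sz.
  have Uz : (val U).1 mb by rewrite mbE Sz.
  have [Ua Ub] := rest_cases RU Uz.
  by move: Sc Uc mbc; case: (loc3P lc) => ->; rewrite ?Sa ?Ub ?eqxx.
have Uz : (val U).1 mb = false by rewrite mbE.
have Sz' : (val S').1 mb = false by rewrite sz.
have Uz' : (val U').1 mb = false by rewrite uz.
rewrite Sz in sa sb; rewrite Uz in ua ub.
have soSU : same_out loc (val S').1 (val U').1.
  have sUS : same_out loc (val U).1 (val S).1 by rewrite same_out_sym (step_out st lc).
  exact: trans_out soS (trans_out sUS soU).
have ctb : c = tm \/ c = tb by case: (loc3P lc) => ce; [left | right | rewrite ce eqxx in mbc].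
case: ctb => ce; rewrite ce in Sc Uc E st *.
  have Eb : (val U).1 tb = (val S).1 tb by apply: E; rewrite eq_sym.
  exists tb.
    apply: (step3 (tm := tm) (tb := tb) (mb := mb)) soSU; rewrite ?sb ?ub // /loc3 ?eqxx ?orbT //.
    by move=> f /loc3P[] ->; rewrite ?eqxx // ?sa ?ua ?Sz' ?Uz'.
  rewrite /cx /cy H11 H22 /=.
  case Sb: ((val S).1 tb); rewrite Sb in Eb sa; rewrite Eb in ua.
    apply: (inc_core (inner := inner) (cx := T) (cy := B)) => //; try exact: anchored_self; try exact: core_eq12.
    - by apply: cov1; right; rewrite Eb.
    - by apply: cov2; left; rewrite sa ua.
    - exact: (anchor_t1_B cr1).
    - exact: (anchor_t1_B' cr2).
  apply: (inc_core (inner := inner) (cx := T) (cy := M')) => //; try exact: anchored_self; try exact: core_eq12.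
  - by apply: cov1; right; rewrite Eb.
  - by apply: cov2; left; rewrite sa ua.
  - exact: (anchor_t1_M' cr1).
  - exact: (anchor_t1_M cr2).
have Ea : (val U).1 tm = (val S).1 tm by apply: E.
exists tm.
  apply: (step3 (tm := tm) (tb := tb) (mb := mb)) soSU; rewrite ?sa ?ua // /loc3 ?eqxx ?orbT //.
  by move=> f /loc3P[] ->; rewrite ?eqxx // ?sb ?ub ?Sz' ?Uz'.
rewrite /cx /cy H12 H21 /=.
case Sa: ((val S).1 tm); rewrite Sa in Ea sb; rewrite Ea in ub.
  apply: (inc_core (inner := inner) (cx := T') (cy := B')) => //; try exact: anchored_self; try exact: core_eq12.
  - by apply: cov1; left; rewrite Ea.
  - by apply: cov2; right; rewrite sb ub.
  - exact: (anchor_t1_B' cr1).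
  - exact: (anchor_t1_B cr2).
apply: (inc_core (inner := inner) (cx := T') (cy := M)) => //; try exact: anchored_self; try exact: core_eq12.
- by apply: cov1; left; rewrite Ea.
- by apply: cov2; right; rewrite sb ub.
- exact: (anchor_t1_M cr1).
- exact: (anchor_t1_M' cr2).
Qed.

Local Notation X1 := (cube D1 n0 n1).
Local Notation X2 := (cube D2 n0 n1).
Local Notation r1 := (r3 tm tb mb t1 m1 b1 (D := D1)).

(** Both [(0, 0, 1)] and [(1, 0, 0)] connect [T] with [M], [T'] with [B] and [M'] with [B']; only
    the paths through the inner arcs differ. *)
Lemma occ_core_eq (U U0 : state_basis D1) : lab (val U).1 = (true, false, false) ->
  same_out loc (val U).1 (val U0).1 -> lab (val U0).1 = (false, false, true) ->
  core_eq inner D1 D1 (val U0).1 (val U).1.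
Proof.
move=> lU so l0; split=> l cl.
  pose V : state_basis D1 := exist (fun p => compat D1 p.1 p.2) ((val U0).1, l) cl.
  have [V1 V2 V3] := l0; have := compat_glue3 cr1 cl; rewrite /glue3 V1 V2 V3 => -[[E1 F1] [E2 F2] [E3 F3]].
  have [|||W [soW lW agW _]] := make3 tmtb tmmb tbmb t1m1 t1b1 m1b1 cr1 core1 ext1 (S := V)
    (x := true) (y := false) (z := false) (t := l M') (m := l M') (b := l M') (fun _ _ => erefl).
  - by split=> //=; congruence.
  - by split.
  - by split.
  exists (val W).2 => //; suff -> : (val U).1 = (val W).1 by apply: (valP W).
  apply: lab_eq; last by rewrite lU lW.
  by rewrite same_out_sym in so; apply: trans_out so soW.
pose V : state_basis D1 := exist (fun p => compat D1 p.1 p.2) ((val U).1, l) cl.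
have [W [soW lW agW]] := make_occ tmtb tmmb tbmb t1m1 t1b1 m1b1 cr1 core1 ext1 (U := V) lU.
exists (val W).2 => //; suff -> : (val U0).1 = (val W).1 by apply: (valP W).
by apply: lab_eq; [apply: trans_out so soW | rewrite l0 lW].
Qed.

(** The state that [rho] associates with [(1, 0, 0)] is [(0, 1, 0)], which a single step at [mb]
    reaches from [(0, 1, 1)]. This step and the first leg of the zigzag are the same surgery, at
    [T'] and [M]. *)
Lemma zigzag_match (S U : state_basis D1) (S' U' : state_basis D2) :
  lab (val S).1 = (false, true, true) -> lab (val U).1 = (true, false, false) ->
  rho S S' -> rho U U' -> zigzag (X := X1) r1 S U = dcoef (b := X2) S' U'.
Proof.
move=> lS lU rS rU.
have [U0 [so0 l0 ag0]] := make_occ tmtb tmmb tbmb t1m1 t1b1 m1b1 cr1 core1 ext1 lU.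
rewrite (zigzag_eval tmtb tmmb tbmb t1m1 t1b1 m1b1 cr1 core1 ext1 even1 n0 n1 lS lU so0 l0 ag0).
have [Sa Sb Sz] := lS; have [Ua Ub Uz] := lU; have [Va Vb Vz] := l0.
have [[nT nT' nM nM'] [nB nB']] := core1.
have [sz sa sb] := rho_lab rS; have [uz ua ub] := rho_lab rU.
rewrite Sz in sz sa sb; rewrite Uz in uz ua ub.
have /and3P[soS agS _] := rS; have /and3P[soU agU _] := rU.
have [H11 H12 H13] := cr1; have [H21 H22 H23] := cr2.
have RS : rest D1 S by apply/restP; left.
have RU : rest D1 U by apply/restP; right.
have soE : same_out loc (val S').1 (val U').1 = same_out loc (val S).1 (val U0).1.
  move: soS soU so0 => /same_outP h1 /same_outP h2 /same_outP h3.
  by apply/same_outP/same_outP => h e le; have := h e le; have := h1 e le; have := h2 e le; have := h3 e le; congruence.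
case so: (same_out loc (val S).1 (val U0).1); rewrite so in soE; last first.
  rewrite (dcoef_nostep (n0 := n0) (n1 := n1)); last first.
    move=> c; apply/negP => st; case lc: (loc c); first by rewrite (step_out st lc) in so.
    have /stepP[_ _ E] := st; have := E tb; rewrite Sb Vb => H.
    suff : false = true by []. apply: H.
    by apply: contraFN lc => /eqP <-; rewrite /loc3 eqxx orbT.
  rewrite (dcoef_nostep (n0 := n0) (n1 := n1)) // => c; apply/negP => st.
  case lc: (loc c); first by rewrite (step_out st lc) in soE.
  have /stepP[_ _ E] := st; have := E mb; rewrite sz uz => H.
  suff : false = true by []. apply: H.
  by apply: contraFN lc => /eqP <-; rewrite /loc3 eqxx !orbT.
have st1 : step tb (val S).1 (val U0).1.
  apply: (step3 (tm := tm) (tb := tb) (mb := mb)) so; rewrite ?Sb ?Vb // /loc3 ?eqxx ?orbT //.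
  by move=> f /loc3P[] ->; rewrite ?eqxx // ?Sa ?Va ?Sz ?Vz.
have st2 : step mb (val S').1 (val U').1.
  apply: (step3 (tm := tm) (tb := tb) (mb := mb)) soE; rewrite ?sz ?uz // /loc3 ?eqxx ?orbT //.
  by move=> f /loc3P[] ->; rewrite ?eqxx // ?sa ?sb ?ua ?ub ?Sa ?Sb ?Ua ?Ub.
have surg := step_surgery even2 st2.
rewrite (dcoef_step (n0 := n0) (n1 := n1) st1) (dcoef_step (n0 := n0) (n1 := n1) st2).
rewrite [in RHS]inc_swap; [|exact: eqv_equiv|exact: eqv_equiv|exact: basis_respects|exact: basis_respects].
rewrite /cx /cy H12 H23 /=; congr (_%:R : 'F_2); congr nat_of_bool.
rewrite Sa Sb in sa sb; rewrite Ua Ub in ua ub.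
apply: (inc_core (inner := inner) (cx := T') (cy := M)) => //; try exact: anchored_self; try exact: core_eq12.
- exact: core_eq_trans (occ_core_eq lU so0 l0) (core_eq12 RU rU).
- exact: covered_mk (anchor_t1_M cr1 core1 Sa Va) (anchor_m1_T cr1 core1 Sa Va) (anchor_b1_T cr1 core1 Sa Va Sz Vz).
- exact: covered_mk (anchor_t1_M cr2 core2 sa ua) (anchor_m1_T cr2 core2 sa ua) (anchor_b1_T' cr2 core2 sb ub).
- exact: trans_agree ag0 agU.
- exact: (anchor_m1_T cr2 core2).
- exact: (anchor_t1_M cr1 core1).
Qed.

End Matching.

End OneSide.

End R3Pair.

Section R3.
Variables (A I : finType) (tm tb mb : I) (t1 m1 b1 : A).
Hypothesis tmtb : tm != tb.
Hypothesis tmmb : tm != mb.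
Hypothesis tbmb : tb != mb.
Hypothesis t1m1 : t1 != m1.
Hypothesis t1b1 : t1 != b1.
Hypothesis m1b1 : m1 != b1.
Local Notation loc := (loc3 tm tb mb).
Local Notation inner := (inner3 t1 m1 b1).
Local Notation lab := (lab tm tb mb).
Local Notation rest D := (rest tm tb mb t1 (D := D)).
Local Notation rho := (rho tm tb mb t1 m1 b1).

Lemma negs_rho (D1 D2 : arc_diagram A I) (S : state_basis D1) (S' : state_basis D2) :
  rho S S' -> negs (val S).1 = negs (val S').1.
Proof.
move=> rS; have [sz sa sb] := rho_lab rS; have /and3P[/same_outP so _ _] := rS.
have split3 (s : {ffun I -> bool}) : negs s = (~~ s tm + (~~ s tb + (~~ s mb + \sum_(c | ~~ loc c) (~~ s c))))%N.
  rewrite /negs (bigD1 tm) //= (bigD1 tb) /=; last by rewrite eq_sym.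
  rewrite (bigD1 mb) /=; last by rewrite !(eq_sym mb) tmmb.
  by do 3 congr (_ + _)%N; apply: eq_bigl => c; rewrite /loc3 !negb_or andbA.
rewrite !split3 sz sa sb; have -> : (\sum_(c | ~~ loc c) (~~ (val S').1 c : nat) = \sum_(c | ~~ loc c) (~~ (val S).1 c : nat))%N.
  by apply: eq_bigr => c lc; rewrite so.
by case: ifP => _; [|rewrite addnCA].
Qed.

Section OneWay.
Variables (D : arc_diagram A I) (n0 n1 : int).
Local Notation X := (cube D n0 n1).

(** Among the surviving states only [(0, 1, 1)] has [mb] positive, so this is the only place where a
    direct step at [mb] can start. *)
Lemma dcoef_mb (S U : state_basis D) : rest D S -> rest D U -> (val S).1 mb != (val U).1 mb ->
  dcoef (b := X) S U != 0 -> lab (val S).1 = (false, true, true) /\ lab (val U).1 = (false, true, false).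
Proof.
move=> /restP RS RU SU /(dcoef_neq0 (n0 := n0) (n1 := n1))[c /stepP[Sc Uc E] _].
have cm : c = mb.
  by have [//|cm] := eqVneq c mb; rewrite E ?eqxx // eq_sym in SU.
rewrite cm in Sc Uc E; case: RS => [lS|]; last by rewrite Sc.
by have [Sa Sb _] := lS; split=> //; rewrite /lab Uc !E // Sa Sb.
Qed.

Lemma dcoef_eq (D' : arc_diagram A I) (S U : state_basis D) (S' U' : state_basis D') :
  (forall c, step c (val S).1 (val U).1 -> exists2 c', step c' (val S').1 (val U').1 &
    inc (eqv D (val S).1) (eqv D (val U).1) (cx D c) (cy D c) (val S).2 (val U).2 =
    inc (eqv D' (val S').1) (eqv D' (val U').1) (cx D' c') (cy D' c') (val S').2 (val U').2) ->
  (forall c, step c (val S').1 (val U').1 -> exists c', step c' (val S).1 (val U).1) ->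
  dcoef (b := X) S U = dcoef (b := cube D' n0 n1) S' U'.
Proof.
move=> H H'; have [c st|no] := pickP (fun c => step c (val S).1 (val U).1).
  have [c' st' e] := H c st.
  by rewrite (dcoef_step (n0 := n0) (n1 := n1) st) (dcoef_step (n0 := n0) (n1 := n1) st') e.
rewrite !(dcoef_nostep (n0 := n0) (n1 := n1)) // => c; last by rewrite no.
by apply/negP => /H'[c']; rewrite no.
Qed.

End OneWay.

Variables (L R : arc_diagram A I) (T T' M M' B B' : A).
Hypothesis crL : crossings3 tm tb mb t1 m1 b1 false L T T' M M' B B'.
Hypothesis crR : crossings3 tm tb mb t1 m1 b1 false R T' T M' M B' B.
Hypothesis core : [/\ ~~ inner T, ~~ inner T', ~~ inner M & ~~ inner M'] /\ (~~ inner B /\ ~~ inner B').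
Hypothesis extL : external L loc inner.
Hypothesis extR : external R loc inner.
Hypothesis baseLR : base_l L = base_l R /\ base_r L = base_r R.
Hypothesis crLR : forall c, ~~ loc c -> cr L c = cr R c.
Hypothesis evenL : evenly_crossed L.
Hypothesis evenR : evenly_crossed R.
Variables (n0 n1 : int).

Lemma reidemeister3_false : homotopy_equiv (cube L n0 n1) (cube R n0 n1).
Proof.
have core' : [/\ ~~ inner T', ~~ inner T, ~~ inner M' & ~~ inner M] /\ (~~ inner B' /\ ~~ inner B).
  by have [[? ? ? ?] [? ?]] := core.
have baseRL : base_l R = base_l L /\ base_r R = base_r L by have [-> ->] := baseLR.
have crRL c : ~~ loc c -> cr R c = cr L c by move=> /crLR ->.
apply: homotopy_equiv_trans (half_reduced tmtb tmmb tbmb t1m1 t1b1 m1b1 crL core extL evenL n0 n1) _.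
apply: homotopy_equiv_trans (homotopy_equiv_sym (half_reduced tmtb tmmb tbmb t1m1 t1b1 m1b1 crR core' extR evenR n0 n1)).
have exL := rho_ex tmtb tmmb tbmb t1m1 t1b1 m1b1 crL crR core' extR baseLR crLR.
have exR := rho_ex tmtb tmmb tbmb t1m1 t1b1 m1b1 crR crL core extL baseRL crRL.
have leL := rho_core_le tmtb tmmb tbmb t1m1 t1b1 m1b1 crL crR core' extR baseLR crLR.
have leR := rho_core_le tmtb tmmb tbmb t1m1 t1b1 m1b1 crR crL core extL baseRL crRL.
have ceL (S : state_basis L) (S' : state_basis R) : rest L S -> rho S S' ->
    core_eq inner L R (val S).1 (val S').1.
  by move=> RS rS; split; [apply: leL | apply: leR (rho_rest rS RS) _; rewrite rho_sym].
have ceR (S : state_basis R) (S' : state_basis L) : rest R S -> rho S S' ->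
    core_eq inner R L (val S).1 (val S').1.
  by move=> RS rS0; have rS := rS0; rewrite rho_sym in rS; exact: core_eq_sym (ceL _ _ (rho_rest rS0 RS) rS).
apply: (@homotopy_equiv_bij (reduced (X := cube L n0 n1) _ _ _) (reduced (X := cube R n0 n1) _ _ _)
  (fun S S' => rho (val S : state_basis L) (val S' : state_basis R))).
- move=> [S RS]; have [S' rS] := exL S RS.
  by exists (exist _ S' (rho_rest rS RS)).
- move=> [S RS]; have [S' rS] := exR S RS.
  by exists (exist _ S' (rho_rest rS RS)); rewrite rho_sym.
- move=> [S RS] [U RU] [U' RU'] /= r1 r2; apply/val_inj => /=.
  exact: (rho_inj crR core' RS r1 r2).
- move=> [S RS] [U RU] [U' RU'] /=; rewrite rho_sym => r1; rewrite rho_sym => r2; apply/val_inj => /=.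
  exact: (rho_inj crL core RU' r1 r2).
- move=> [S RS] [S' RS'] /= rS; rewrite (negs_rho rS).
  have -> // : deg (eqv L (val S).1) (val S).2 = deg (eqv R (val S').1) (val S').2.
  have /and3P[_ ag _] := rS.
  apply: (deg_core (inner := inner)) => //; first exact: ceL.
    by apply: (covered_rest crL core) => //; [left | case=> -> -> _].
  by apply: (covered_rest crR core') => //; [left | case=> -> -> _].
move=> [S RS] [S' RS'] [U RU] [U' RU'] rS rU; rewrite /= in rS rU.
rewrite -[LHS]/(dcoef (b := cube L n0 n1) S U + zigzag (X := cube L n0 n1) _ S U).
rewrite -[RHS]/(dcoef (b := cube R n0 n1) S' U' + zigzag (X := cube R n0 n1) _ S' U').
have rS' : rho S' S by rewrite rho_sym. have rU' : rho U' U by rewrite rho_sym.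
have [sz sa sb] := rho_lab rS; have [uz ua ub] := rho_lab rU.
have zL : ~~ ((lab (val S).1 == (false, true, true)) && (lab (val U).1 == (true, false, false))) ->
    zigzag (X := cube L n0 n1) (r3 tm tb mb t1 m1 b1 (D := L)) S U = 0.
  by move=> H; apply/eqP; apply: contraNT H => /(zigzag_support tmtb tmmb RS RU)[-> ->]; rewrite !eqxx.
have zR : ~~ ((lab (val S').1 == (false, true, true)) && (lab (val U').1 == (true, false, false))) ->
    zigzag (X := cube R n0 n1) (r3 tm tb mb t1 m1 b1 (D := R)) S' U' = 0.
  by move=> H; apply/eqP; apply: contraNT H => /(zigzag_support tmtb tmmb RS' RU')[-> ->]; rewrite !eqxx.
(* Zigzags lower [mb], so with [mb] fixed only direct terms occur and they are matched step by step.
   Otherwise a direct term on one side is exchanged with a zigzag on the other. *)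
have [mbE|mbN] := eqVneq ((val S).1 mb) ((val U).1 mb).
  have mbE' : (val S').1 mb = (val U').1 mb by rewrite sz uz.
  rewrite zL ?zR ?addr0; last 2 first.
  - by apply/negP => /andP[/eqP[_ _ h1] /eqP[_ _ h2]]; rewrite h1 h2 in mbE'.
  - by apply/negP => /andP[/eqP[_ _ h1] /eqP[_ _ h2]]; rewrite h1 h2 in mbE.
  apply: dcoef_eq => c st.
    exact: (step_rho tmtb crL crR core core' extL crLR ceL RS RU rS rU (esym mbE) st).
  have [c' st' _] := step_rho tmtb crR crL core' core extR crRL ceR RS' RU' rS' rU' (esym mbE') st.
  by exists c'.
have mbN' : (val S').1 mb != (val U').1 mb by rewrite sz uz.
have dL : ~~ ((lab (val S).1 == (false, true, true)) && (lab (val U).1 == (false, true, false))) ->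
    dcoef (b := cube L n0 n1) S U = 0.
  by move=> H; apply/eqP; apply: contraNT H => /(dcoef_mb RS RU mbN)[-> ->]; rewrite !eqxx.
have dR : ~~ ((lab (val S').1 == (false, true, true)) && (lab (val U').1 == (false, true, false))) ->
    dcoef (b := cube R n0 n1) S' U' = 0.
  by move=> H; apply/eqP; apply: contraNT H => /(dcoef_mb RS' RU' mbN')[-> ->]; rewrite !eqxx.
have [lS|nS] := eqVneq (lab (val S).1) (false, true, true); last first.
  have nS' : lab (val S').1 != (false, true, true).
    apply: contra nS => /eqP lS'; have /and3P[_ _ /eqP] := rS'; rewrite lS' => -> //.
  by rewrite zL ?zR ?dL ?dR // ?(negbTE nS) ?(negbTE nS').
have lS' : lab (val S').1 = (false, true, true) by have /and3P[_ _ /eqP->] := rS; rewrite lS.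
have /and3P[_ _ /eqP lU'] := rU.
have Uz : (val U).1 mb = false by have [_ _ h] := lS; move: mbN; rewrite h; case: ((val U).1 mb).
have [lU|nU] := eqVneq (lab (val U).1) (true, false, false).
  have lU2 : lab (val U').1 = (false, true, false) by rewrite lU' lU.
  rewrite dL ?lS ?lU // zR ?lS' ?lU2 // add0r addr0.
  exact: (zigzag_match tmtb tmmb tbmb t1m1 t1b1 m1b1 crL crR core core' extL evenL evenR n0 n1 ceL lS lU rS rU).
have [lU|nU2] := eqVneq (lab (val U).1) (false, true, false).
  have lU2 : lab (val U').1 = (true, false, false) by rewrite lU' lU.
  rewrite dR ?lS' ?lU2 // zL ?lS ?lU // add0r addr0; symmetry.
  exact: (zigzag_match tmtb tmmb tbmb t1m1 t1b1 m1b1 crR crL core' core extR evenR evenL n0 n1 ceR lS' lU2 rS' rU').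
rewrite zL ?zR ?dL ?dR ?lS ?lS' ?lU' ?(negbTE nU) ?(negbTE nU2) //.
- by move: nU; rewrite /sw /lab Uz /=; case: ((val U).1 tm); case: ((val U).1 tb).
- by move: nU nU2; rewrite /sw /lab Uz /=; case: ((val U).1 tm); case: ((val U).1 tb).
Qed.

End R3.

(** * The local moves for all markers and presentations of crossings *)

Lemma mirror_external (A I : finType) (D : arc_diagram A I) loc inner :
  external D loc inner -> external (mirror D) loc inner.
Proof.
case=> bl br ext; split=> // c /ext; rewrite /external_crossing /=.
by case: (cr D c) => [[? ?] ?].
Qed.

Definition recross (A I : finType) (D : arc_diagram A I) (f : I -> crossing A) :=
  ArcDiagram (base_l D) (base_r D) f.

Lemma recross_external (A I : finType) (D : arc_diagram A I) f loc inner :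
  (forall c, ~~ loc c -> f c = cr D c) ->
  external D loc inner -> external (recross D f) loc inner.
Proof. by move=> fD [bl br ext]; split=> // c lc /=; rewrite fD //; apply: ext. Qed.

Section R1.
Variables (A A0 I0 : finType) (D : arc_diagram A (option I0)) (D0 : arc_diagram A0 I0).
Variables (g : A -> A0) (k : A0 -> A) (a0 o a2 : A) (kappa : bool).
Hypothesis crN : cr D None = (kappa, (a0, o), (o, a2)).
Hypothesis a0o : a0 != o.
Hypothesis a2o : a2 != o.
Hypothesis D0_cr : forall i, cr D0 i = map_crossing g (cr D (Some i)).
Hypothesis D0_base : base_l D0 = g (base_l D) /\ base_r D0 = g (base_r D).
Hypothesis ext : external D (fun c => c == None) (pred1 o).
Hypothesis gk : cancel k g.
Hypothesis k_out : forall a, k a != o.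
Hypothesis ga : g a0 = g a2.
Hypothesis fib : forall l : A -> bool, l a0 = l a2 -> forall a, a != o -> l a = l (k (g a)).
Hypothesis even : evenly_crossed D.
Hypothesis even0 : evenly_crossed D0.
Variables (n0 n1 : int).

(** [kappa] is the sign of the kink, which explains both shifts; the negative kink is the mirror
    image of the positive one. *)
Lemma reidemeister1_arcs :
  homotopy_equiv (cube D (n0 + (~~ kappa : nat)%:Z) (n1 + pm kappa)) (cube D0 n0 n1).
Proof.
case: kappa crN => crN' /=.
  by rewrite addr0; apply: (reidemeister1_positive crN' a0o a2o D0_cr D0_base ext gk k_out ga fib even).
apply: homotopy_equiv_mirror => //.
have -> : #|{: option I0}|%:Z - (n0 + 1) = #|I0|%:Z - n0 by rewrite card_option intS; ring.
have -> : - (n1 + -1) = - n1 + 1 :> int by ring.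
have crM : cr (mirror D) None = (true, (a0, o), (o, a2)) by rewrite /= crN'.
apply: (reidemeister1_positive (D := mirror D) (D0 := mirror D0) crM a0o a2o _ D0_base _ gk k_out ga fib).
- by move=> i /=; rewrite D0_cr; case: (cr D (Some i)) => [[? [? ?]] [? ?]].
- exact: mirror_external.
- exact: mirror_even.
Qed.

End R1.

Section R2.
Variables (A A0 I0 : finType) (D : arc_diagram A (option (option I0))) (D0 : arc_diagram A0 I0).
Variables (g : A -> A0) (k : A0 -> A) (a0 a1 a2 b0 b1 b2 : A).
Let inner : pred A := pred2 a1 b1.
Hypothesis crc : same_crossing (cr D None) (true, (a0, a1), (b0, b1)).
Hypothesis crd : same_crossing (cr D (Some None)) (false, (a1, a2), (b1, b2)).
Hypothesis D0_cr : forall i, cr D0 i = map_crossing g (cr D (Some (Some i))).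
Hypothesis D0_base : base_l D0 = g (base_l D) /\ base_r D0 = g (base_r D).
Hypothesis a1b1 : a1 != b1.
Hypothesis core : [&& ~~ inner a0, ~~ inner a2, ~~ inner b0 & ~~ inner b2].
Hypothesis ext : external D (fun e => (e == None) || (e == Some None)) inner.
Hypothesis gk : cancel k g.
Hypothesis k_out : forall a, ~~ inner (k a).
Hypothesis ga : g a0 = g a2.
Hypothesis gb : g b0 = g b2.
Hypothesis fib : forall l : A -> bool, l a0 = l a2 -> l b0 = l b2 ->
  forall a, ~~ inner a -> l a = l (k (g a)).
Hypothesis even : evenly_crossed D.
Variables (n0 n1 : int).

Lemma reidemeister2_same : homotopy_equiv (cube D (n0 + 1) n1) (cube D0 n0 n1).
Proof.
pose D' := recross D (fun e => match e with
  | None => (true, (a0, a1), (b0, b1))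
  | Some None => (false, (a1, a2), (b1, b2))
  | _ => cr D e end).
have DD' c : same_crossing (cr D c) (cr D' c) by case: c => [[i|]|] //; apply: same_crossing_refl.
apply: homotopy_equiv_trans (cube_same (D' := D') _ _ even erefl erefl DD') _.
apply: (reidemeister2_arcs (D := D') erefl erefl D0_cr D0_base a1b1 core _ gk k_out ga gb fib).
  by apply: recross_external ext; case=> [[]|].
exact: even_same DD' even.
Qed.

End R2.

Section R3.
Variables (A I : finType).
Implicit Types (L R : arc_diagram A I).

Definition same_unordered (X : crossing A) k (p q : A * A) :=
  same_crossing X (k, p, q) /\ same_crossing X (k, q, p).

Lemma same_unordered_sym X k p q : same_unordered X k p q -> same_unordered X k q p.
Proof. by case. Qed.

Lemma same_unordered_flip x y k (p q : A * A) :
  same_unordered (k (+) x (+) y, flip x p, flip y q) k p q.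
Proof.
case: p q => [a a'] [b b']; split; first exact: same_crossing_flip.
have [h1 h2 _] := same_crossing_flip x y k a a' b b'; have [s1 s2 _] := same_crossing_swap k a a' b b'; split.
- by move=> m l; rewrite h1 s1.
- by move=> l; rewrite h2 s2.
- by case: y {h1 h2}; [apply: Or44 | apply: Or43].
Qed.

Lemma same_unordered_swap k0 p0 q0 k (p q : A * A) :
  same_unordered (k0, p0, q0) k p q -> same_unordered (k0, q0, p0) k p q.
Proof.
case: p0 q0 p q => [a a'] [b b'] [c c'] [d d'] [[h1 h2 h3] [h1' h2' h3']].
have [s1 s2 _] := same_crossing_swap k0 b b' a a'.
split; split; do ?[by move=> m l; rewrite s1|by move=> l; rewrite s2].
  by case: h3 => /= h; [apply: Or43 | apply: Or44 | apply: Or41 | apply: Or42].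
by case: h3' => /= h; [apply: Or43 | apply: Or44 | apply: Or41 | apply: Or42].
Qed.

Definition same_crossings3 (tm tb mb : I) (t1 m1 b1 : A) (k1 k2 k3 : bool) (D : arc_diagram A I) (T T' M M' B B' : A) :=
  [/\ same_unordered (cr D tm) k1 (T, t1) (M, m1), same_unordered (cr D tb) k2 (T', t1) (B, b1)
    & same_unordered (cr D mb) k3 (M', m1) (B', b1)].

Definition r3_context L R (tm tb mb : I) (t1 m1 b1 T T' M M' B B' : A) :=
  [/\ uniq [:: tm; tb; mb], uniq [:: t1; m1; b1],
    ~~ has (inner3 t1 m1 b1) [:: T; T'; M; M'; B; B'],
    external L (loc3 tm tb mb) (inner3 t1 m1 b1) /\ external R (loc3 tm tb mb) (inner3 t1 m1 b1) &
    [/\ base_l L = base_l R /\ base_r L = base_r R,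
      forall c, ~~ loc3 tm tb mb c -> cr L c = cr R c,
      evenly_crossed L & evenly_crossed R]].

Lemma r3_exact L R tm tb mb t1 m1 b1 T T' M M' B B' k n0 n1 :
  r3_context L R tm tb mb t1 m1 b1 T T' M M' B B' ->
  crossings3 tm tb mb t1 m1 b1 k L T T' M M' B B' ->
  crossings3 tm tb mb t1 m1 b1 k R T' T M' M B' B ->
  homotopy_equiv (cube L n0 n1) (cube R n0 n1).
Proof.
case=> /and3P[]; rewrite !inE => /norP[t12 t13] t23 _ /and3P[]; rewrite !inE => /norP[s12 s13] s23 _.
move=> /hasPn H [eL eR] [bb cc evL evR].
have core : [/\ ~~ inner3 t1 m1 b1 T, ~~ inner3 t1 m1 b1 T', ~~ inner3 t1 m1 b1 M & ~~ inner3 t1 m1 b1 M'] /\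
  (~~ inner3 t1 m1 b1 B /\ ~~ inner3 t1 m1 b1 B').
  by split; split; apply: H; rewrite !inE eqxx ?orbT.
case: k => crL crR; last first.
  exact: (reidemeister3_false t12 t13 t23 s12 s13 s23 crL crR core eL eR bb cc evL evR).
apply: homotopy_equiv_mirror => //.
have crM D P P' Q Q' S S' : crossings3 tm tb mb t1 m1 b1 true D P P' Q Q' S S' ->
    crossings3 tm tb mb t1 m1 b1 false (mirror D) P P' Q Q' S S'.
  by case=> h1 h2 h3; split; rewrite /= ?h1 ?h2 ?h3.
have mcc c : ~~ loc3 tm tb mb c -> cr (mirror L) c = cr (mirror R) c by move=> lc /=; rewrite cc.
exact: (@reidemeister3_false _ _ tm tb mb t1 m1 b1 t12 t13 t23 s12 s13 s23 (mirror L) (mirror R) T T' M M' B B'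
  (crM _ _ _ _ _ _ _ crL) (crM _ _ _ _ _ _ _ crR) core (mirror_external eL) (mirror_external eR) bb mcc
  (mirror_even evL) (mirror_even evR)).
Qed.

(** The three local crossings are replaced by the exact presentations of [crossings3] on both sides,
    which changes neither complex up to equivalence. *)
Lemma r3_middle_odd L R tm tb mb t1 m1 b1 T T' M M' B B' k n0 n1 :
  r3_context L R tm tb mb t1 m1 b1 T T' M M' B B' ->
  same_crossings3 tm tb mb t1 m1 b1 k (~~ k) k L T T' M M' B B' ->
  same_crossings3 tm tb mb t1 m1 b1 k (~~ k) k R T' T M' M B' B ->
  homotopy_equiv (cube L n0 n1) (cube R n0 n1).
Proof.
case=> ut us core [eL eR] [bb cc evL evR] sL sR.
pose mk X1 X2 X3 D := recross D (fun e : I => if e == tm then X1 else if e == tb then X2 else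
   if e == mb then X3 else cr D e : crossing A).
have mkE X1 X2 X3 D : [/\ cr (mk X1 X2 X3 D) tm = X1, cr (mk X1 X2 X3 D) tb = X2 & cr (mk X1 X2 X3 D) mb = X3].
  case/and3P: ut; rewrite !inE => /norP[/negbTE t12 /negbTE t13] /negbTE t23 _.
  by rewrite /= !eqxx ![tb == _]eq_sym ![mb == _]eq_sym t12 t13 t23.
have mk_out X1 X2 X3 D c : ~~ loc3 tm tb mb c -> cr (mk X1 X2 X3 D) c = cr D c.
  by rewrite /loc3 !negb_or => /and3P[/negbTE /= -> /negbTE -> /negbTE ->].
have mk_same X1 X2 X3 D : same_crossing (cr D tm) X1 -> same_crossing (cr D tb) X2 ->
    same_crossing (cr D mb) X3 -> forall c, same_crossing (cr D c) (cr (mk X1 X2 X3 D) c).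
  move=> h1 h2 h3 c /=; case: eqP => [->//|_]; case: eqP => [->//|_]; case: eqP => [->//|_].
  exact: same_crossing_refl.
case: sL sR => [[l1 _] [l2 _] [l3 _]] [[r1 _] [r2 _] [r3 _]].
set Y1 := (k, (T, t1), _) in l1; set Y2 := (~~ k, _, _) in l2; set Y3 := (k, (M', m1), _) in l3.
set Z1 := (k, (T', t1), _) in r1; set Z2 := (~~ k, _, _) in r2; set Z3 := (k, _, (B, b1)) in r3.
have hL := mk_same _ _ _ _ l1 l2 l3; have hR := mk_same _ _ _ _ r1 r2 r3.
set L' := mk Y1 Y2 Y3 L in hL *; set R' := mk Z1 Z2 Z3 R in hR.
have e'L : evenly_crossed L' by apply: even_same hL evL.
have e'R : evenly_crossed R' by apply: even_same hR evR.
apply: homotopy_equiv_trans (cube_same (D' := L') _ _ evL erefl erefl hL) _.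
apply: homotopy_equiv_trans (homotopy_equiv_sym (cube_same (D' := R') _ _ evR erefl erefl hR)).
apply: (@r3_exact L' R' tm tb mb t1 m1 b1 T T' M M' B B' k); [|exact: mkE..].
split=> //; first by split; apply: recross_external => // c lc; apply: mk_out.
by split=> // c lc; rewrite !mk_out //; apply: cc.
Qed.

Lemma perm_r3_context L R tm tb mb t1 m1 b1 T T' M M' B B' tm0 tb0 mb0 t0 m0 b0 xT xT' xM xM' xB xB' :
  perm_eq [:: tm; tb; mb] [:: tm0; tb0; mb0] ->
  perm_eq [:: t1; m1; b1] [:: t0; m0; b0] ->
  perm_eq [:: T; T'; M; M'; B; B'] [:: xT; xT'; xM; xM'; xB; xB'] ->
  r3_context L R tm tb mb t1 m1 b1 T T' M M' B B' ->
  r3_context L R tm0 tb0 mb0 t0 m0 b0 xT xT' xM xM' xB xB'.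
Proof.
move=> pt pa pc [ut ua hc [eL eR] [bb cc evL evR]].
have lE c : loc3 tm0 tb0 mb0 c = loc3 tm tb mb c.
  by have := perm_mem pt c; rewrite !inE /loc3 => ->.
have iE a : inner3 t0 m0 b0 a = inner3 t1 m1 b1 a.
  by have := perm_mem pa a; rewrite !inE /inner3 => ->.
have eE D : external D (loc3 tm tb mb) (inner3 t1 m1 b1) -> external D (loc3 tm0 tb0 mb0) (inner3 t0 m0 b0).
  by case=> e1 e2 e3; split; rewrite ?iE // => c; rewrite lE /external_crossing !iE; apply: e3.
split; rewrite -?(perm_uniq pt) -?(perm_uniq pa) -?(perm_has _ pc) //.
- by rewrite (eq_has iE).
- by split; apply: eE.
- by split=> // c; rewrite lE; apply: cc.
Qed.

(* Permuting the strands brings the odd one out of [k1], [k2], [k3] to [k2]. *)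
Lemma reidemeister3_same L R tm tb mb t1 m1 b1 T T' M M' B B' k1 k2 k3 n0 n1 :
  r3_context L R tm tb mb t1 m1 b1 T T' M M' B B' ->
  ~~ ((k1 == k2) && (k2 == k3)) ->
  same_crossings3 tm tb mb t1 m1 b1 k1 k2 k3 L T T' M M' B B' ->
  same_crossings3 tm tb mb t1 m1 b1 k1 k2 k3 R T' T M' M B' B ->
  homotopy_equiv (cube L n0 n1) (cube R n0 n1).
Proof.
move=> ctx k123 [l1 l2 l3] [r1 r2 r3].
have sw := same_unordered_sym.
have perm3_rot (E : eqType) (x y z : E) : perm_eq [:: x; y; z] [:: x; z; y] 
  by rewrite perm_cons -[_ :: _]/([:: y] ++ [:: z]) perm_catC.
have perm3_swap (E : eqType) (x y z : E) : perm_eq [:: x; y; z] [:: y; x; z] 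
  by rewrite -[X in perm_eq _ X]/([:: y] ++ [:: x] ++ [:: z]) -[X in perm_eq X _]/([:: x] ++ [:: y] ++ [:: z]) perm_catCA.
have [k13|k13] := eqVneq k1 k3.
  have k2E : k2 = ~~ k1 by move: k123 k13; case: (k1); case: (k2); case: (k3).
  by rewrite -k13 k2E in l1 l2 l3 r1 r2 r3; apply: (r3_middle_odd _ _ ctx (k := k1)).
have [k23|k23] := eqVneq k2 k3.
  have k1E : k1 = ~~ k2 by move: k123 k13 k23; case: (k1); case: (k2); case: (k3).
  rewrite -k23 k1E in l1 l2 l3 r1 r2 r3.
  apply: (@r3_middle_odd L R tb tm mb t1 b1 m1 T' T B B' M M' k2); last 2 first.
  - by split=> //; apply: sw.
  - by split=> //; apply: sw.
  apply: perm_r3_context ctx.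
  - exact: perm3_swap.
  - exact: perm3_rot.
  - by apply/allP => z _; rewrite /=; apply/eqP; lia.
have k3E : k3 = ~~ k1 by move: k13; case: (k1); case: (k3).
have k2E : k2 = k1 by move: k13 k23; case: (k1); case: (k2); case: (k3).
rewrite k2E k3E in l1 l2 l3 r1 r2 r3.
apply: (@r3_middle_odd L R tm mb tb m1 t1 b1 M M' T T' B' B k1).
- apply: perm_r3_context ctx.
  - exact: perm3_rot.
  - exact: perm3_swap.
  - by apply/allP => z _; rewrite /=; apply/eqP; lia.
- by split=> //; apply: sw.
- by split=> //; apply: sw.
Qed.

End R3.

(** * Diagrams of words *)

Section Positions.
Implicit Types (c : nat) (u : seq nat).

Definition pos1 c u := index c u.
Definition pos2 c u := ((index c u).+1 + index c (drop (index c u).+1 u))%N.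

Lemma count_drop_index c u : (0 < count_mem c u)%N ->
  count_mem c (drop (index c u).+1 u) = (count_mem c u).-1.
Proof.
elim: u => //= x u IH; have [_|_] := eqVneq x c; first by rewrite drop0.
by rewrite /= add0n => /IH.
Qed.

Lemma posP c u : count_mem c u = 2%N ->
  [/\ pos1 c u < pos2 c u, pos2 c u < size u, nth 0%N u (pos1 c u) = c & nth 0%N u (pos2 c u) = c]%N.
Proof.
move=> cu; have c1 : (0 < count_mem c u)%N by rewrite cu.
have c2 : (0 < count_mem c (drop (index c u).+1 u))%N by rewrite count_drop_index ?cu.
have cin : c \in u by rewrite -has_pred1 has_count.
have cin2 : c \in drop (index c u).+1 u by rewrite -has_pred1 has_count.
split.
- by rewrite /pos2 /pos1 -addn1 -addnA leq_add2l.
- by move: cin2; rewrite -index_mem size_drop ltn_subRL.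
- by rewrite /pos1 nth_index.
- by rewrite /pos2 -nth_drop nth_index.
Qed.

Lemma index_before c u k : (k < index c u)%N -> nth 0%N u k != c.
Proof. by move=> ku; apply/negP => /eqP uk; have := @before_find _ 0%N (pred1 c) _ _ ku; rewrite /= uk eqxx. Qed.

Lemma pos_only c u k : count_mem c u = 2%N -> (k < size u)%N -> nth 0%N u k = c ->
  k = pos1 c u \/ k = pos2 c u.
Proof.
move=> cu ku uk; have [lt lts p1 p2] := posP cu.
have [kl|kl|->] := ltngtP k (pos1 c u); last by left.
  by have := index_before kl; rewrite uk eqxx.
have [kl2|kl2|->] := ltngtP k (pos2 c u); last by right.
  have : (k - (pos1 c u).+1 < index c (drop (pos1 c u).+1 u))%N by move: kl2; rewrite /pos2 -/(pos1 c u); lia.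
  by move/index_before; rewrite nth_drop subnKC // uk eqxx.
exfalso; have dc := count_drop_index (c := c) (u := u); rewrite cu in dc; have {dc} /= dc := dc isT.
set v := drop _ u in dc.
have v1 : (0 < count_mem c v)%N by rewrite dc.
have := count_drop_index v1; rewrite dc /= => /eqP; rewrite -[_ == _]negbK -lt0n -has_count has_pred1 => /negP; apply.
rewrite drop_drop addnC -/(pos1 c u) addnS -/(pos2 c u) -{1}uk.
have -> : k = ((pos2 c u).+1 + (k - (pos2 c u).+1))%N by lia.
by rewrite -nth_drop mem_nth // size_drop ltn_sub2r // (leq_ltn_trans kl2).
Qed.

Lemma posE c u k l : count_mem c u = 2%N -> (k < l < size u)%N -> nth 0%N u k = c -> nth 0%N u l = c ->
  pos1 c u = k /\ pos2 c u = l.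
Proof.
move=> cu /andP[kl ls] uk ul; have [lt lts _ _] := posP cu.
have [h|h] := pos_only cu (ltn_trans kl ls) uk; have [h'|h'] := pos_only cu ls ul; lia.
Qed.

End Positions.

Section WordDiagram.
Variables (n : nat) (I : finType) (nm : I -> nat) (w : seq (nat * sign)).
Local Notation u := (unzip1 w).

Definition wsign (i : I) : sign := (nm i, true) \in w.

(** The letter at position [p] separates the arcs [p] and [p.+1], and taking the sign as marker [k]
    gives the smoothing that respects the orientation. The length [n] and the index type [I] are
    free, so that a move can extend [I] by [option] and a length can be replaced by an equal one. *)
Definition word_diagram : arc_diagram 'I_n.+1 I := ArcDiagram (inord 0) (inord n) (fun i =>
  (wsign i, (inord (pos1 (nm i) u), inord (pos1 (nm i) u).+1),
            (inord (pos2 (nm i) u), inord (pos2 (nm i) u).+1))).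

Definition names := injective nm /\ forall c, (c \in u) = (c \in codom nm).

Hypothesis nw : size w = n.
Hypothesis nmw : names.
Hypothesis w2 : two_ended w.

Lemma count_names i : count_mem (nm i) u = 2%N.
Proof.
have [_ cod] := nmw; have : nm i \in u by rewrite cod codom_f.
by move: w2 => /allP H /H /eqP.
Qed.

(** Regrouped by positions instead of chords, the sum telescopes to the labels of the first and last
    arcs, which agree at the base point. *)
Lemma word_even : evenly_crossed word_diagram.
Proof.
move=> l /= l0n; pose G p := l (inord p) (+) l (inord p.+1).
have szu : size u = n by rewrite size_map.
transitivity (\big[addb/false]_(p < n) G p).
  transitivity (\big[addb/false]_(i : I) \big[addb/false]_(p < n | nth 0%N u p == nm i) G p).
    apply: eq_bigr => i _; have [lt lts p1 p2] := posP (count_names i).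
    rewrite szu in lts; have lts1 := ltn_trans lt lts.
    rewrite (bigD1 (Ordinal lts1)) /=; last by rewrite p1.
    rewrite (bigD1 (Ordinal lts)) /=; last by rewrite p2 eqxx -val_eqE /=; lia.
    rewrite big1 ?addbF /G ?addbA // => p /andP[/andP[/eqP up q1] q2].
    have pu : (p < size u)%N by rewrite szu.
    have [h|h] := pos_only (count_names i) pu up.
      by rewrite -val_eqE /= h eqxx in q1.
    by rewrite -val_eqE /= h eqxx in q2.
  under eq_bigr do rewrite big_mkcond; rewrite exchange_big; apply: eq_bigr => p _ /=.
  have [inj cod] := nmw.
  have : nth 0%N u p \in u by rewrite mem_nth ?szu.
  rewrite cod => /codomP[i ui].
  rewrite (bigD1 i) //= ui eqxx big1 ?addbF // => j ji.
  by rewrite (inj_eq inj) eq_sym (negbTE ji).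
suff H m : \big[addb/false]_(p < m) G p = l (inord 0) (+) l (inord m) by rewrite H l0n addbb.
elim: m => [|m IH]; first by rewrite big_ord0 addbb.
by rewrite big_ord_recr IH /= /G; case: (l _); case: (l _); case: (l _).
Qed.

End WordDiagram.

Section Rename.
Variables (A I I' : finType) (D : arc_diagram A I) (D' : arc_diagram A I') (f : I' -> I).
Hypothesis f_bij : bijective f.
Hypothesis base : base_l D' = base_l D /\ base_r D' = base_r D.
Hypothesis crE : forall i, cr D' i = cr D (f i).

Lemma cube_rename n0 n1 : homotopy_equiv (cube D n0 n1) (cube D' n0 n1).
Proof.
have [g fg gf] := f_bij; have [bl br] := base.
pose pl (s : {ffun I -> bool}) : {ffun I' -> bool} := [ffun i => s (f i)].
have plI : injective pl.
  by move=> s t /ffunP st; apply/ffunP => i; have := st (g i); rewrite !ffunE gf.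
have cE s l : compat D' (pl s) l = compat D s l.
  rewrite /compat bl br; congr (_ && _); apply/forallP/forallP => H i.
    by have := H (g i); rewrite crE ffunE gf.
  by rewrite crE ffunE; apply: H.
have eE s : eqv D' (pl s) =2 eqv D s by move=> a b; apply: eq_forallb => l; rewrite cE.
have sE s t i : step (f i) s t = step i (pl s) (pl t).
  apply/stepP/stepP => -[h1 h2 h3]; split; rewrite ?ffunE // in h1 h2 *.
  - by move=> e ei; rewrite !ffunE h3 // (inj_eq (can_inj fg)).
  - by move=> e ei; have := h3 (g e); rewrite !ffunE gf; apply; apply: contraNneq ei => <-; rewrite gf.
apply: (@homotopy_equiv_bij (cube D _ _) (cube D' _ _) (fun (S : state_basis D) (T : state_basis D') =>
  ((val T).1 == pl (val S).1) && ((val T).2 == (val S).2))).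
- move=> S; have ok : compat D' (pl (val S).1) (val S).2 by rewrite cE (valP S).
  by exists (exist (fun p => compat D' p.1 p.2) (pl (val S).1, (val S).2) ok); rewrite /= !eqxx.
- move=> T; pose s := [ffun i => (val T).1 (g i)] : {ffun I -> bool}.
  have sT : (val T).1 = pl s by apply/ffunP => i; rewrite !ffunE fg.
  have ok : compat D s (val T).2 by rewrite -cE -sT (valP T).
  by exists (exist (fun p => compat D p.1 p.2) (s, (val T).2) ok); rewrite sT /= !eqxx.
- move=> S T T' /andP[/eqP h1 /eqP h2] /andP[/eqP h1' /eqP h2'].
  by apply: state_basis_eq; rewrite ?h1 ?h2 ?h1' ?h2'.
- move=> S S' T /andP[/eqP h1 /eqP h2] /andP[/eqP h1' /eqP h2'].
  by apply: state_basis_eq; [apply: plI; rewrite -h1 -h1' | rewrite -h2 -h2'].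
- move=> S T /andP[/eqP h1 /eqP h2] /=; rewrite h1 h2 (eq_deg _ (eE _)).
  suff -> : negs (pl (val S).1) = negs (val S).1 by [].
  rewrite /negs [RHS](reindex f) /=; last by exists g => i _; rewrite ?fg ?gf.
  by apply: eq_bigr => i _; rewrite ffunE.
move=> S T S' T' /andP[/eqP h1 /eqP h2] /andP[/eqP h1' /eqP h2'] /=.
rewrite [LHS](reindex f) /=; last by exists g => i _; rewrite ?fg ?gf.
apply: eq_bigr => i _; rewrite /inc_at sE h1 h1' h2 h2' (eq_inc _ _ _ _ (eE _) (eE _)).
by rewrite /cx /cy crE.
Qed.

End Rename.

(** * The complex of a word as a cube *)

Section KhovanovComplex.
Variable w : seq (nat * sign).

Definition khovanov_complex := BasedComplex (@hdeg w) (@qdeg w)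
  (fun S T => \sum_(c : chord w) (incident_at c S T)%:R).

Lemma diff_mact v : linfun (@diff w) v = mact (dmx khovanov_complex) v.
Proof.
rewrite lfunE /=; apply/ffunP => T; rewrite !ffunE; apply: eq_bigr => S _.
by rewrite /dmx /kmx mxE !enum_rankK /= mulr_suml.
Qed.

Lemma chains_deg_homogeneous i j : homogeneous_part (X := khovanov_complex) i j (chains_deg w i j).
Proof.
move=> v; split.
  move=> vC x vx; suff : (hdeg x == i) && (qdeg x == j) by case/andP=> /eqP + /eqP.
  apply: contraNT vx => xij; rewrite (coord_span (X := in_tuple _) vC) sum_ffunE big1 // => m _.
  rewrite ffunE /GRing.scale /=; set X := (X in X`_m).
  have /imageP[S] : X`_m \in X by rewrite mem_nth // ltn_ord.
  rewrite inE => Sij ->; rewrite ffunE; case: eqP => [xS|_]; last by rewrite mulr0.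
  by rewrite -xS (negbTE xij) in Sij.
move=> H.
have -> : v = \sum_S v S *: basis_chain S.
  apply/ffunP => T; rewrite sum_ffunE (bigD1 T) //= big1 ?addr0 ?ffunE ?eqxx /=.
    by rewrite /GRing.scale /= mulr1.
  by move=> S ST; rewrite !ffunE eq_sym (negbTE ST) /GRing.scale /= mulr0.
apply: rpred_sum => S _.
have [vS|vS] := eqVneq (v S) 0; first by rewrite vS scale0r mem0v.
apply: memvZ; apply: memv_span; apply/imageP; exists S => //.
by have [h1 h2] := H S vS; rewrite inE; apply/andP; split; apply/eqP.
Qed.

(** Writing [pm b] as 1 minus twice an indicator makes the difference visibly even, so the integer
    division is exact. *)
Lemma hdegE (S : enhanced_state w) :
  hdeg S = (negs (markers S))%:Z - \sum_(c : chord w) (~~ csign c : nat)%:Z.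
Proof.
have pmE b : pm b = 1 - (~~ b : nat)%:Z * 2 by case: b.
rewrite /hdeg /writhe /sigma; have -> : negs (markers S) = (\sum_c (~~ markers S c : nat))%N by [].
rewrite (eq_bigr (fun c => 1 - (~~ csign c : nat)%:Z * 2)); last by move=> c _; apply: pmE.
rewrite [X in _ - X](eq_bigr (fun c => 1 - (~~ markers S c : nat)%:Z * 2)); last by move=> c _; apply: pmE.
rewrite !sumrB -!mulr_suml (big_morph Posz PoszD erefl).
set a := \sum_c _; set b := \sum_c _; set e := \sum_c _.
have -> : a - b * 2 - (a - e * 2) = (e - b) * 2 by ring.
by rewrite mulzK.
Qed.

End KhovanovComplex.

Lemma khovanov_iso w w' : homotopy_equiv (khovanov_complex w) (khovanov_complex w') ->
  forall i j, lmod_iso (KH_word w i j) (KH_word w' i j).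
Proof.
move=> H i j; apply: (homology_iso _ _ _ _ _ _ H); do ?exact: diff_mact; exact: chains_deg_homogeneous.
Qed.

Section WordCube.
Variable w : seq (nat * sign).
Hypothesis w2 : two_ended w.
Local Notation u := (unzip1 w).
Local Notation D := (word_diagram (size w) (@ssval _ u : chord w -> nat) w).

Lemma ssval_names : names (@ssval _ u : chord w -> nat) w.
Proof.
split; first exact: val_inj.
move=> c; apply/idP/codomP => [cu|[x ->]]; last exact: ssvalP.
by exists (SeqSub cu).
Qed.

Let cnt (c : chord w) := count_names ssval_names w2 c.

Lemma chord_ends (c : chord w) : exists kl : 'I_(size w) * 'I_(size w),
  [/\ kl.1 = pos1 (ssval c) u :> nat, kl.2 = pos2 (ssval c) u :> nat, kl.1 != kl.2,
    endpoint c kl.1 /\ endpoint c kl.2 & forall k, endpoint c k -> k = kl.1 \/ k = kl.2].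
Proof.
have [lt lts p1 p2] := posP (cnt c); have szu : size u = size w by rewrite size_map.
have lts' := lts; rewrite szu in lts'; have lt1 := ltn_trans lt lts'.
exists (Ordinal lt1, Ordinal lts'); split=> //=.
- by rewrite -val_eqE /= neq_ltn lt.
- by rewrite /endpoint p1 p2 eqxx.
move=> k /eqP uk; have ku : (k < size u)%N by rewrite szu.
by case: (pos_only (cnt c) ku uk) => h; [left|right]; apply/val_inj.
Qed.

Lemma compat_glued s (l : {ffun 'I_(size w).+1 -> bool}) :
  compat D s l <-> forall x y, glued s x y -> l x = l y.
Proof.
have ordE (x : 'I_(size w).+1) m : (x == m :> nat) -> x = inord m by move/eqP<-; rewrite inord_val.
split.
  case/andP=> /eqP bE /forallP sm x y /orP[/andP[/ordE-> /ordE->] //|].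
  case/existsP=> c /existsP[k /existsP[m /and4P[km ck cm]]].
  have [[k0 m0] /= [kE mE km0 _ only]] := chord_ends c.
  have := sm c; rewrite /= -/(csign c) -kE -mE => {}sm.
  case: (only _ ck) km cm => -> km cm; case: (only _ cm) km => ->; rewrite ?eqxx // => _.
    case: ifP sm => _ /andP[/eqP h1 /eqP h2]; first by case/andP=> /ordE-> /ordE->.
    by case/orP=> /andP[/ordE-> /ordE->].
  case: ifP sm => _ /andP[/eqP h1 /eqP h2]; first by case/andP=> /ordE-> /ordE->.
  by case/orP=> /andP[/ordE-> /ordE->].
move=> H; apply/andP; split.
  by apply/eqP/H; rewrite /glued !inordK // !eqxx.
apply/forallP => c; have [[k0 m0] /= [kE mE km0 [ck cm] _]] := chord_ends c.
have Hc (x y : Defs.arc w) (k m : 'I_(size w)) : k != m -> endpoint c k -> endpoint c m ->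
   (if s c == csign c then (x == k :> nat) && (y == m.+1 :> nat)
      else ((x == k :> nat) && (y == m :> nat)) || ((x == k.+1 :> nat) && (y == m.+1 :> nat))) -> l x = l y.
  move=> h1 h2 h3 h4; apply: H; apply/orP; right; apply/existsP; exists c.
  by apply/existsP; exists k; apply/existsP; exists m; rewrite h1 h2 h3.
have k1 := ltn_ord k0; have m1 := ltn_ord m0; have mk0 : m0 != k0 by rewrite eq_sym.
rewrite /= -/(csign c) -kE -mE; case E: (_ == _) in Hc *; apply/andP; split; apply/eqP.
- by apply: (Hc _ _ k0 m0) => //; rewrite !inordK ?ltnS ?eqxx // ltnW.
- by apply/esym/(Hc _ _ m0 k0) => //; rewrite !inordK ?ltnS ?eqxx // ltnW.
- by apply: (Hc _ _ k0 m0) => //; rewrite !inordK ?ltnS ?eqxx // ltnW.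
- by apply: (Hc _ _ k0 m0) => //; rewrite !inordK ?ltnS ?eqxx ?orbT // ltnW.
Qed.

Lemma same_circle_eqv s : @same_circle w s =2 eqv D s.
Proof.
move=> x y; apply/idP/eqvP.
  case/connectP=> p xp -> l /compat_glued H.
  elim: p x xp => //= z p IH x /andP[xz zp]; rewrite -(IH _ zp).
  by case/orP: xz => /H.
(* The indicator of the circle of [x] is itself a compatible labelling, hence it does not separate
   [x] from [y]. *)
move=> H; pose l := [ffun z => same_circle s x z] : {ffun 'I_(size w).+1 -> bool}.
have sym : connect_sym [rel x y | @glued w s x y || glued s y x].
  by apply: sym_connect_sym => a b /=; rewrite orbC.
suff cl : compat D s l by have := H l cl; rewrite !ffunE /same_circle connect0 => <-.
apply/compat_glued => a b ab; rewrite !ffunE.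
apply: (same_connect_r sym); apply: connect1; by rewrite /= ab.
Qed.

Lemma enhancedE (s : state w) (l : {ffun Defs.arc w -> bool}) :
  [forall x, forall y, same_circle s x y ==> (l x == l y)] = compat D s l.
Proof.
apply/idP/idP => [/forallP H|].
  apply/compat_respects => x y; rewrite -same_circle_eqv => xy.
  by have /forallP/(_ y) := H x; rewrite xy => /eqP.
move/compat_respects => H; apply/forallP => x; apply/forallP => y; apply/implyP.
by rewrite same_circle_eqv => /H ->.
Qed.

Lemma khovanov_cube : homotopy_equiv (khovanov_complex w)
  (cube D (\sum_(c : chord w) (~~ csign c : nat)%:Z) (\sum_(c : chord w) pm (csign c))).
Proof.
apply: (@homotopy_equiv_bij (khovanov_complex w) (cube D _ _)
  (fun (S : enhanced_state w) (T : state_basis D) => val S == val T)).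
- move=> S; have ok : compat D (val S).1 (val S).2 by rewrite -enhancedE (valP S).
  by exists (exist (fun p => compat D p.1 p.2) (val S) ok) => /=.
- move=> T; have ok : [forall x, forall y, same_circle (val T).1 x y ==> ((val T).2 x == (val T).2 y)].
    by rewrite enhancedE (valP T).
  by exists (exist (fun S : state w * {ffun Defs.arc w -> bool} =>
    [forall x, forall y, same_circle S.1 x y ==> (S.2 x == S.2 y)]) (val T) ok) => /=.
- by move=> S T T' /eqP ST /eqP ST'; apply/val_inj; rewrite -ST.
- by move=> S S' T /eqP ST /eqP ST'; apply/val_inj; rewrite ST.
- move=> S T /eqP ST /=.
  have hE : hdeg S = (negs (val T).1)%:Z - \sum_(c : chord w) (~~ csign c : nat)%:Z.
    by rewrite hdegE /markers ST.
  rewrite /qdeg hE; split=> //; congr (_ + _); rewrite /tau /labels /markers ST -(eq_deg _ (same_circle_eqv _)) //.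
- move=> S T S' T' /eqP ST /eqP ST' /=; apply: eq_bigr => c _; congr (_%:R : 'F_2); congr nat_of_bool.
  rewrite /inc_at /incident_at /step /lower /markers /labels ST ST' -andbA; congr [&& _, _ & _].
  by rewrite -(eq_inc _ _ _ _ (same_circle_eqv _) (same_circle_eqv _)).
Qed.

End WordCube.

(** Keeping the signs as a function of the chord name lets a move act on plain words of names while
    [F] stays fixed. *)
Definition paint (F : nat -> sign) (u : seq nat) : seq (nat * sign) := [seq (c, F c) | c <- u].

Lemma unzip1_paint F u : unzip1 (paint F u) = u.
Proof. by rewrite /unzip1 -map_comp map_id. Qed.

Definition paired (u : seq nat) := all (fun c => count_mem c u == 2%N) u.

Lemma pairedP u c : paired u -> c \in u -> count_mem c u = 2%N.
Proof. by move=> /allP H /H /eqP. Qed.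

Lemma perm_paired u u' : perm_eq u u' -> paired u' = paired u.
Proof.
move=> uu; rewrite /paired -(perm_all _ uu); apply: eq_all => c; congr (_ == _).
by rewrite (permP uu).
Qed.

Lemma two_ended_paint F u : two_ended (paint F u) = paired u.
Proof. by rewrite /two_ended unzip1_paint. Qed.

Section Painted.
Variables (n : nat) (I : finType) (nm : I -> nat) (F : nat -> sign) (u : seq nat).

Definition painted_diagram : arc_diagram 'I_n.+1 I := ArcDiagram (inord 0) (inord n) (fun i =>
  (F (nm i), (inord (pos1 (nm i) u), inord (pos1 (nm i) u).+1),
             (inord (pos2 (nm i) u), inord (pos2 (nm i) u).+1))).

Definition names_of := injective nm /\ forall c, (c \in u) = (c \in codom nm).

Hypothesis nu : size u = n.
Hypothesis nmu : names_of.
Hypothesis u2 : paired u.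

Lemma mem_names i : nm i \in u.
Proof. by have [_ ->] := nmu; apply: codom_f. Qed.

Lemma count_names_of i : count_mem (nm i) u = 2%N.
Proof. exact/pairedP/mem_names. Qed.

Lemma painted_word : (forall i, cr painted_diagram i = cr (word_diagram n nm (paint F u)) i).
Proof.
move=> i; rewrite /= unzip1_paint; congr (_, _, _); rewrite /wsign.
apply/idP/mapP => [Fi|[c _ [-> <-]] //].
by exists (nm i); [apply: mem_names | rewrite Fi].
Qed.

Lemma painted_even : evenly_crossed painted_diagram.
Proof.
have nw : size (paint F u) = n by rewrite size_map.
have nmw : names nm (paint F u) by rewrite /names unzip1_paint.
have w2 : two_ended (paint F u) by rewrite two_ended_paint.
apply: (even_same (D := word_diagram n nm (paint F u))) (word_even nw nmw w2) => // c.
by rewrite -painted_word; apply: same_crossing_refl.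
Qed.

Definition negatives : int := \sum_i (~~ F (nm i) : nat)%:Z.
Definition total_sign : int := \sum_i pm (F (nm i)).

Lemma painted_cube : homotopy_equiv (khovanov_complex (paint F u))
  (cube painted_diagram negatives total_sign).
Proof.
have w2 : two_ended (paint F u) by rewrite two_ended_paint.
have [inj cod] := nmu.
have mi i : nm i \in unzip1 (paint F u) by rewrite unzip1_paint mem_names.
pose f i : chord (paint F u) := SeqSub (mi i).
have mc (c : chord (paint F u)) : ssval c \in codom nm by rewrite -cod -[u in _ \in u](unzip1_paint F); apply: ssvalP.
have fg : cancel f (fun c => iinv (mc c)) by move=> i; apply: inj; rewrite f_iinv.
have gf : cancel (fun c => iinv (mc c)) f by move=> c; apply/val_inj; rewrite /= f_iinv.
have fb : bijective f by exists (fun c => iinv (mc c)).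
have nw : size (paint F u) = n by rewrite size_map.
have csE i : csign (f i) = F (nm i).
  by have := painted_word i; rewrite /= => -[-> _ _].
apply: homotopy_equiv_trans (khovanov_cube w2) _.
have -> : \sum_(c : chord (paint F u)) (~~ csign c : nat)%:Z = negatives.
  rewrite (reindex f) /=; last by exists (fun c => iinv (mc c)) => i _; rewrite ?fg ?gf.
  by apply: eq_bigr => i _; rewrite csE.
have -> : \sum_(c : chord (paint F u)) pm (csign c) = total_sign.
  rewrite (reindex f) /=; last by exists (fun c => iinv (mc c)) => i _; rewrite ?fg ?gf.
  by apply: eq_bigr => i _; rewrite csE.
(* The type of arcs depends on [n]; eliminating the equality of lengths identifies the two types of
   arcs. *)
have pw := painted_word; rewrite /painted_diagram in pw *; case: _ / nw pw => pw.
by apply: (cube_rename fb) => // i; rewrite pw.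
Qed.

End Painted.

Lemma ssval_names_of (u : seq nat) : names_of (@ssval _ u : seq_sub u -> nat) u.
Proof.
split; first exact: val_inj.
move=> c; apply/idP/codomP => [cu|[x ->]]; last exact: ssvalP.
by exists (SeqSub cu).
Qed.

Lemma pos_shift u u' (h : nat -> nat) c :
  {homo h : p q / (p < q)%N} ->
  (forall p, (p < size u)%N -> (h p < size u')%N /\ nth 0%N u' (h p) = nth 0%N u p) ->
  count_mem c u = 2%N -> count_mem c u' = 2%N ->
  pos1 c u' = h (pos1 c u) /\ pos2 c u' = h (pos2 c u).
Proof.
move=> hm hu cu cu'; have [lt lts p1 p2] := posP cu.
have [_ e1] := hu _ (ltn_trans lt lts); have [s2 e2] := hu _ lts.
by apply: posE; rewrite ?e1 ?e2 // hm.
Qed.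

(* Inserting two letters before the letter [a] of a word moves the letter [p]
   to [shift a p]; the arcs created are [a.+1] and one of [a], [a.+2]. *)
Definition shift (a p : nat) : nat := if (p < a)%N then p else p.+2.
Definition arc_collapse (a k : nat) : nat := if (k <= a)%N then k else if k == a.+1 then a else k.-2.
Definition arc_section (a m : nat) : nat := if (m <= a)%N then m else m.+2.

Lemma shift_mono a : {homo shift a : p q / (p < q)%N}.
Proof. by move=> p q; rewrite /shift; do 2 case: ifP; lia. Qed.

Lemma arc_collapse_shift a p : arc_collapse a (shift a p) = p /\ arc_collapse a (shift a p).+1 = p.+1.
Proof.
by rewrite /arc_collapse /shift; case: (ltnP p a) => pa; split; repeat case: ifP; lia.
Qed.

Lemma shift_out a p : shift a p != a.+1 /\ (shift a p).+1 != a.+1.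
Proof. by rewrite /shift; case: ifP; split; lia. Qed.

Lemma arc_sectionK a : cancel (arc_section a) (arc_collapse a).
Proof. by move=> m; rewrite /arc_section /arc_collapse; repeat case: ifP; lia. Qed.

Lemma arc_section_out a m : arc_section a m != a.+1.
Proof. by rewrite /arc_section; case: ifP; lia. Qed.

Lemma nth_insert (u1 X u2 : seq nat) p : size X = 2%N ->
  nth 0%N (u1 ++ X ++ u2) (shift (size u1) p) = nth 0%N (u1 ++ u2) p.
Proof.
move=> X2; rewrite /shift !nth_cat; case: (ltnP p (size u1)) => [->//|up].
have -> : (p.+2 < size u1)%N = false by lia.
rewrite X2; have -> : (p.+2 - size u1 < 2)%N = false by lia.
by congr nth; lia.
Qed.

Lemma big_option (V : zmodType) (I : finType) (f : option I -> V) :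
  \sum_i f i = f None + \sum_i f (Some i).
Proof.
rewrite (bigD1 None) //=; congr (_ + _); rewrite (reindex_omap Some id) //=; last by case.
by apply: eq_bigl => i; rewrite eqxx.
Qed.

Lemma names_option (I : finType) (nm : I -> nat) u u' c :
  names_of nm u -> c \notin u -> (u' =i c :: u) -> names_of (oapp nm c) u'.
Proof.
case=> inj cod cu uu; have no i : nm i != c.
  by apply: contraNneq cu => <-; rewrite cod codom_f.
split.
  move=> [x|] [y|] //= => [/inj -> //|/eqP|/esym/eqP]; by rewrite (negbTE (no _)).
move=> d; rewrite uu inE; apply/orP/codomP => [[/eqP->|]|[[i|] ->]] /=.
- by exists None.
- by rewrite cod => /codomP[i ->]; exists (Some i).
- by right; rewrite cod codom_f.
- by left.
Qed.

Lemma paint_eq F F' u : {in u, F =1 F'} -> paint F u = paint F' u.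
Proof. by move=> FF; apply/eq_in_map => c cu; rewrite FF. Qed.

Lemma inordE n m k : (m <= n)%N -> (k <= n)%N -> (inord m == inord k :> 'I_n.+1) = (m == k).
Proof. by move=> mn kn; rewrite -val_eqE /= !inordK. Qed.

(** * The three moves on painted words *)

Section Reidemeister1.
Variables (u1 u2 : seq nat) (c : nat) (F : nat -> sign).
Let u := u1 ++ u2.
Let u' := u1 ++ [:: c; c] ++ u2.
Hypothesis u'2 : paired u'.

Let count_u' d : count_mem d u' = ((c == d) * 2 + count_mem d u)%N.
Proof. by rewrite !count_cat /=; lia. Qed.

Let cu : c \notin u.
Proof.
have cu' : c \in u' by rewrite !mem_cat !inE eqxx /= orbT.
by rewrite -has_pred1 has_count -leqNgt leqn0; have := pairedP u'2 cu'; rewrite count_u' eqxx; lia.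
Qed.

Let u'P : u' =i c :: u.
Proof. by move=> d; rewrite !mem_cat !inE !mem_cat; case: (d \in u1); case: (d \in u2); case: (d == c). Qed.

Let count_out d : d \in u -> count_mem d u' = count_mem d u.
Proof.
by move=> du; rewrite count_u'; case: eqP => [cd|//]; rewrite -cd (negbTE cu) in du.
Qed.

Let u2p : paired u.
Proof. by apply/allP => d du; rewrite -count_out // (pairedP u'2) // u'P inE du orbT. Qed.

Let n := size u.
Let nm : seq_sub u -> nat := @ssval _ u.

Lemma khovanov_reidemeister1 :
  homotopy_equiv (khovanov_complex (paint F u)) (khovanov_complex (paint F u')).
Proof.
have nmu : names_of nm u := ssval_names_of u.
have nmu' := names_option nmu cu u'P.
have su' : size u' = n.+2 by rewrite /n /u' !size_cat /=; lia.
have su : size u = n by [].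
apply: homotopy_equiv_trans (painted_cube (n := n) F su nmu u2p) _.
apply: homotopy_equiv_sym; apply: homotopy_equiv_trans (painted_cube (n := n.+2) F su' nmu' u'2) _.
have -> : negatives (oapp nm c) F = negatives nm F + (~~ F c : nat)%:Z.
  by rewrite /negatives big_option addrC.
have -> : total_sign (oapp nm c) F = total_sign nm F + pm (F c).
  by rewrite /total_sign big_option addrC.
set a := size u1; have an : (a <= n)%N by rewrite /n /u size_cat leq_addr.
have a2 : a.+2 = size (u1 ++ [:: c; c]) by rewrite size_cat addn2.
pose g (x : 'I_n.+3) : 'I_n.+1 := inord (arc_collapse a x).
pose k (x : 'I_n.+1) : 'I_n.+3 := inord (arc_section a x).
have shift_lt p : (p < n)%N -> (shift a p < n.+2)%N by rewrite /shift; case: ifP; lia.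
have hu p : (p < size u)%N -> (shift a p < size u')%N /\ nth 0%N u' (shift a p) = nth 0%N u p.
  by move=> pn; rewrite su' shift_lt // nth_insert.
have pos i : pos1 (nm i) u' = shift a (pos1 (nm i) u) /\ pos2 (nm i) u' = shift a (pos2 (nm i) u).
  have ci := count_names_of nmu u2p i.
  by apply: pos_shift => //; [apply: shift_mono | rewrite count_out // mem_names].
have posc : pos1 c u' = a /\ pos2 c u' = a.+1.
  apply: posE; first by rewrite (pairedP u'2) // u'P inE eqxx.
  - by rewrite su'; lia.
  - by rewrite nth_cat ltnn subnn.
  - by rewrite nth_cat ltnNge leqnSn /= subSnn.
have gs p : (p < n)%N -> g (inord (shift a p)) = inord p /\ g (inord (shift a p).+1) = inord p.+1.
  move=> pn; have [e1 e2] := arc_collapse_shift a p; have := shift_lt p pn.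
  by rewrite /g => lt; rewrite !inordK ?e1 ?e2 // ltnW.
have posn i : (pos1 (nm i) u < n)%N /\ (pos2 (nm i) u < n)%N.
  by have [lt lts _ _] := posP (count_names_of nmu u2p i); split=> //; apply: ltn_trans lts.
(* The two new letters at positions [a] and [a.+1] create the kink arc [a.+1], and cut one arc of
   the old diagram into [a] and [a.+2]. *)
apply: (reidemeister1_arcs (g := g) (k := k) (a0 := inord a) (o := inord a.+1) (a2 := inord a.+2)).
- by rewrite /=; have [-> ->] := posc.
- by rewrite inordE //; lia.
- by rewrite inordE //; lia.
- move=> i /=; rewrite /map_crossing /=; have [-> ->] := pos i; have [l1 l2] := posn i.
  by have [-> ->] := gs _ l1; have [-> ->] := gs _ l2.
- by rewrite /= /g !inordK // /arc_collapse; split; congr inord; repeat case: ifP; lia.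
- split=> [||[i|//] _]; do 2?[by rewrite /= inordE //; lia].
  rewrite /external_crossing /=; have [-> ->] := pos i; have [l1 l2] := posn i.
  have [o1 o2] := shift_out a (pos1 (nm i) u); have [o3 o4] := shift_out a (pos2 (nm i) u).
  by have := shift_lt _ l1; have := shift_lt _ l2 => s1 s2; rewrite !inordE ?o1 ?o2 ?o3 ?o4 // ltnW.
- move=> x; rewrite /g /k inordK; last by rewrite /arc_section; have := ltn_ord x; case: ifP; lia.
  by rewrite arc_sectionK inord_val.
- move=> x; rewrite /k inordE ?arc_section_out //; last lia.
  by rewrite /arc_section; have := ltn_ord x; case: ifP; lia.
- by rewrite /g !inordK ?ltnS //; try lia; congr inord; rewrite /arc_collapse; repeat case: ifP; lia.
- move=> l la x xo; have xn := ltn_ord x; rewrite /k /g inordK; last by rewrite /arc_collapse; repeat case: ifP; lia.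
  have {}xo : x != a.+1 :> nat.
    by apply: contraNneq xo => xa; rewrite -val_eqE /= xa inordK //; lia.
  have [xa|xa] := eqVneq (x : nat) a.+2.
    have -> : x = inord a.+2 by rewrite -xa inord_val.
    by rewrite -la; congr (l _); rewrite inordK; [congr inord; rewrite /arc_section /arc_collapse; repeat case: ifP; lia | lia].
  by congr (l _); rewrite -[LHS]inord_val; congr inord; rewrite /arc_section /arc_collapse; repeat case: ifP; lia.
- exact: painted_even.
- exact: painted_even.
Qed.

End Reidemeister1.

Section DoubleShift.
Variables (n al be : nat).
Hypothesis ben : (be <= n.+2)%N.
Hypothesis albe : (al.+2 <= be)%N.

Ltac arith := rewrite /shift /arc_section /arc_collapse; repeat case: ifP; lia.

(** The position [be] is counted in the word that already contains the first inserted pair, whence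
    the order of composition and the bound [al.+2 <= be]. *)
Definition shift2 p := shift be (shift al p).
Definition arc_collapse2 z := arc_collapse al (arc_collapse be z).
Definition arc_section2 z := arc_section be (arc_section al z).

Lemma shift2_lt p : (p < n)%N -> (shift2 p < n.+4)%N.
Proof. rewrite /shift2; arith. Qed.

Lemma shift2_mono : {homo shift2 : p q / (p < q)%N}.
Proof. by move=> p q pq; do 2 apply: shift_mono. Qed.

Lemma shift2_out p : [/\ shift2 p != al.+1, shift2 p != be.+1, (shift2 p).+1 != al.+1 & (shift2 p).+1 != be.+1].
Proof. rewrite /shift2; split; arith. Qed.

Lemma arc_collapse2_shift p : arc_collapse2 (shift2 p) = p /\ arc_collapse2 (shift2 p).+1 = p.+1.
Proof.
have [e1 e2] := arc_collapse_shift al p; have [e3 e4] := arc_collapse_shift be (shift al p).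
by rewrite /arc_collapse2 e3 e4.
Qed.

Lemma arc_section2K : cancel arc_section2 arc_collapse2.
Proof. by move=> m; rewrite /arc_section2 /arc_collapse2 !arc_sectionK. Qed.

Lemma arc_section2_lt m : (m < n.+1)%N -> (arc_section2 m < n.+1.+4)%N.
Proof. rewrite /arc_section2; arith. Qed.

Lemma arc_section2_out m : arc_section2 m != al.+1 /\ arc_section2 m != be.+1.
Proof. by split; last exact: arc_section_out; rewrite /arc_section2; arith. Qed.

Lemma arc_collapse2_lt z : (z < n.+1.+4)%N -> (arc_collapse2 z < n.+1)%N.
Proof. rewrite /arc_collapse2; arith. Qed.

Lemma arc_collapse2_ends : arc_collapse2 0 = 0%N /\ arc_collapse2 n.+4 = n.
Proof.
have e : arc_collapse be n.+4 = n.+2 by arith.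
have e0 : arc_collapse be 0 = 0%N by [].
by rewrite /arc_collapse2 e e0; split=> //; arith.
Qed.

Lemma arc_collapse2_core : arc_collapse2 al = arc_collapse2 al.+2 /\ arc_collapse2 be = arc_collapse2 be.+2.
Proof. rewrite /arc_collapse2; split; arith. Qed.

Lemma arc_section_collapse2 (T : Type) (l : nat -> T) z : l al = l al.+2 -> l be = l be.+2 ->
  z != al.+1 -> z != be.+1 -> l z = l (arc_section2 (arc_collapse2 z)).
Proof.
move=> la lb z1 z2; transitivity (l (arc_section be (arc_collapse be z))).
  have [->|z3] := eqVneq z be.+2; last by congr l; arith.
  by rewrite -lb; congr l; arith.
rewrite /arc_collapse2 /arc_section2; set v := arc_collapse be z.
have v1 : v != al.+1 by rewrite /v; arith.
have [->|v2] := eqVneq v al.+2; last by congr l; arith.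
have -> : arc_section be al.+2 = al.+2 by arith.
by rewrite -la; congr l; arith.
Qed.

End DoubleShift.

(* [x] and [y] tell whether each of the two strands meets the crossing with
   [kappa = true] last. *)
Section Reidemeister2.
Variables (u1 u2 u3 : seq nat) (c d : nat) (F : nat -> sign) (x y : bool).
Let pair (b : bool) := if b then [:: d; c] else [:: c; d].
Let u := u1 ++ u2 ++ u3.
Let u' := u1 ++ pair x ++ u2 ++ pair y ++ u3.
Hypothesis u'2 : paired u'.
Hypothesis cd : c != d.
Hypothesis Fc : F c = true (+) x (+) y.
Hypothesis Fd : F d = false (+) x (+) y.

Let count_pair b e : count_mem e (pair b) = ((c == e) + (d == e))%N.
Proof. by case: b => /=; lia. Qed.

Let count_u' e : count_mem e u' = ((c == e) * 2 + (d == e) * 2 + count_mem e u)%N.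
Proof. by rewrite !count_cat !count_pair; lia. Qed.

Let mem_pair b e : (e \in pair b) = (e == c) || (e == d).
Proof. by case: b; rewrite !inE 1?orbC. Qed.

Let u'P e : (e \in u') = [|| e == c, e == d | e \in u].
Proof.
by rewrite !mem_cat !mem_pair; case: (e == c); case: (e == d); case: (e \in u1); case: (e \in u2); case: (e \in u3).
Qed.

Let cu : c \notin u.
Proof.
have := pairedP u'2 (_ : c \in u'); rewrite u'P eqxx => /(_ isT).
by rewrite -has_pred1 has_count -leqNgt leqn0 count_u' eqxx; lia.
Qed.

Let du : d \notin u.
Proof.
have := pairedP u'2 (_ : d \in u'); rewrite u'P eqxx orbT => /(_ isT).
by rewrite -has_pred1 has_count -leqNgt leqn0 count_u' eqxx; lia.
Qed.

Let count_out e : e \in u -> count_mem e u' = count_mem e u.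
Proof.
move=> eu; rewrite count_u'; case: eqP => [ce|_]; first by rewrite -ce (negbTE cu) in eu.
by case: eqP => [de|//]; rewrite -de (negbTE du) in eu.
Qed.

Let u2p : paired u.
Proof. by apply/allP => e eu; rewrite -count_out // (pairedP u'2) // u'P eu !orbT. Qed.

Variables (n al be : nat).
Hypotheses (su : size u = n) (ale : size u1 = al) (bee : (size u1 + 2 + size u2)%N = be).
Let nm : seq_sub u -> nat := @ssval _ u.
Let nm' : option (option (seq_sub u)) -> nat := oapp (oapp nm d) c.

Local Notation h := (shift2 al be).
Let g (z : 'I_n.+1.+4) : 'I_n.+1 := inord (arc_collapse2 al be z).
Let k (z : 'I_n.+1) : 'I_n.+1.+4 := inord (arc_section2 al be z).

Let size_pair b : size (pair b) = 2%N. Proof. by case: b. Qed.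

Let ben : (be <= n.+2)%N.
Proof. by rewrite -su -bee !size_cat; move: (size u1) (size u2) (size u3) => p q r; clear; lia. Qed.

Let albe : (al.+2 <= be)%N.
Proof. by rewrite -ale -bee -addn2 leq_addr. Qed.

Let al_lt : (al.+2 < n.+1.+4)%N.
Proof. by clear - ben albe; lia. Qed.

Let su' : size u' = n.+4.
Proof. by rewrite -su /u' !size_cat !size_pair; move: (size u1) (size u2) (size u3) => p q r; clear; lia. Qed.

Let nth_h p : nth 0%N u' (h p) = nth 0%N u p.
Proof.
have -> : u' = (u1 ++ pair x ++ u2) ++ pair y ++ u3 by rewrite /u' -!catA.
have -> : h p = shift (size (u1 ++ pair x ++ u2)) (shift (size u1) p).
  by rewrite /shift2 !size_cat size_pair -bee -ale addnA.
by rewrite nth_insert // -!catA nth_insert.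
Qed.

Let pos i : pos1 (nm i) u' = h (pos1 (nm i) u) /\ pos2 (nm i) u' = h (pos2 (nm i) u).
Proof.
have ci := count_names_of (ssval_names_of u) u2p i.
apply: pos_shift => //; first exact: shift2_mono.
  by move=> p; rewrite su su' nth_h => /(shift2_lt ben albe).
by rewrite count_out // (mem_names (ssval_names_of u)).
Qed.

Let posn i : (pos1 (nm i) u < n)%N /\ (pos2 (nm i) u < n)%N.
Proof.
have [lt lts _ _] := posP (count_names_of (ssval_names_of u) u2p i).
by rewrite -su; split=> //; apply: ltn_trans lts.
Qed.

Let nth_pair : [/\ nth 0%N u' (al + x) = c, nth 0%N u' (be + y) = c,
  nth 0%N u' (al + ~~ x) = d & nth 0%N u' (be + ~~ y) = d].
Proof.
have h1 (b : bool) : nth 0%N u' (al + b) = nth 0%N (pair x) b.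
  rewrite -ale nth_cat ltnNge leq_addr /= addKn nth_cat size_pair.
  by case: b.
have h2 (b : bool) : nth 0%N u' (be + b) = nth 0%N (pair y) b.
  have -> : u' = (u1 ++ pair x ++ u2) ++ pair y ++ u3 by rewrite /u' -!catA.
  have -> : be = size (u1 ++ pair x ++ u2) by rewrite !size_cat size_pair -bee addnA.
  rewrite nth_cat ltnNge leq_addr /= addKn nth_cat size_pair.
  by case: b.
by rewrite !h1 !h2 /pair; case: x; case: y.
Qed.

Let pos_cd : [/\ pos1 c u' = al + x, pos2 c u' = be + y, pos1 d u' = al + ~~ x & pos2 d u' = be + ~~ y]%N.
Proof.
have [e1 e2 e3 e4] := nth_pair.
have cc : count_mem c u' = 2%N by rewrite (pairedP u'2) // u'P eqxx.
have cd' : count_mem d u' = 2%N by rewrite (pairedP u'2) // u'P eqxx orbT.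
have bnd (b b' : bool) : (al + b < be + b' < size u')%N.
  by rewrite su'; clear - ben albe; case: b; case: b'; lia.
by have [-> ->] := posE cc (bnd _ _) e1 e2; have [-> ->] := posE cd' (bnd _ _) e3 e4.
Qed.

Let gs p : (p < n)%N -> g (inord (h p)) = inord p /\ g (inord (h p).+1) = inord p.+1.
Proof.
move=> /(shift2_lt ben albe) lt; have [e1 e2] := arc_collapse2_shift al be p.
by rewrite /g (inordK (leqW lt)) inordK // e1 e2.
Qed.

Lemma khovanov_reidemeister2 :
  homotopy_equiv (khovanov_complex (paint F u)) (khovanov_complex (paint F u')).
Proof.
have nmu : names_of nm u := ssval_names_of u.
have nmd : names_of (oapp nm d) (d :: u) by apply: names_option nmu du _.
have nmu' : names_of nm' u'.
  apply: names_option nmd _ _; first by rewrite inE negb_or cd cu.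
  by move=> e; rewrite u'P !inE.
apply: homotopy_equiv_trans (painted_cube (n := n) F su nmu u2p) _.
apply: homotopy_equiv_sym; apply: homotopy_equiv_trans (painted_cube (n := n.+4) F su' nmu' u'2) _.
have -> : negatives nm' F = negatives nm F + 1.
  rewrite /negatives !big_option /= Fc Fd.
  by case: x; case: y => /=; ring.
have -> : total_sign nm' F = total_sign nm F.
  rewrite /total_sign !big_option /= Fc Fd.
  by case: x; case: y => /=; ring.
pose A0 : 'I_n.+1.+4 := inord al; pose A1 : 'I_n.+1.+4 := inord al.+1; pose A2 : 'I_n.+1.+4 := inord al.+2.
pose B0 : 'I_n.+1.+4 := inord be; pose B1 : 'I_n.+1.+4 := inord be.+1; pose B2 : 'I_n.+1.+4 := inord be.+2.
have be_lt : (be.+2 < n.+1.+4)%N by [].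
have [cA cB] := arc_collapse2_core ben albe.
have gA : g A0 = g A2 by rewrite /g (inordK al_lt) inordK ?cA //; do 2 apply: ltnW.
have gB : g B0 = g B2 by rewrite /g (inordK be_lt) inordK ?cB //; do 2 apply: ltnW.
have out_inner z : (z < n.+1.+4)%N -> z != al.+1 -> z != be.+1 -> ~~ pred2 A1 B1 (inord z : 'I_n.+1.+4).
  move=> zn z1 z2; rewrite /= !inordE ?negb_or ?z1 //; exact: ltnW.
have [a_ne b_ne] : [&& 0 != al.+1, 0 != be.+1, n.+4 != al.+1 & n.+4 != be.+1]%N /\
  [&& al != be.+1, al.+2 != be.+1, be != al.+1 & be.+2 != al.+1]%N.
  by clear - ben albe; lia.
have [ne1 ne2 ne3 ne4] := and4P a_ne; have [ne5 ne6 ne7 ne8] := and4P b_ne.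
have ltS (m : nat) : (m.+2 < n.+1.+4)%N -> (m < n.+1.+4)%N by move=> H; do 2 apply: ltnW.
have neS m : (m != m.+1)%N /\ (m.+2 != m.+1)%N by rewrite neq_ltn ltnSn (gtn_eqF (ltnSn _)).
(* When [c] comes last on a strand, that strand is read backwards and its two outer arcs are
   exchanged; the signs prescribed for [c] and [d] are those that these flips turn into [true] and
   [false]. *)
apply: (reidemeister2_same (g := g) (k := k)
  (a0 := if x then A2 else A0) (a1 := A1) (a2 := if x then A0 else A2)
  (b0 := if y then B2 else B0) (b1 := B1) (b2 := if y then B0 else B2)).
- have [p1 p2 _ _] := pos_cd; rewrite /= p1 p2 Fc.
  have := same_crossing_flip x y true (if x then A2 else A0) A1 (if y then B2 else B0) B1.
  by rewrite /flip; case: x; case: y; rewrite /= ?addn0 ?addn1.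
- have [_ _ p1 p2] := pos_cd; rewrite /= p1 p2 Fd.
  have := same_crossing_flip x y false A1 (if x then A0 else A2) B1 (if y then B0 else B2).
  by rewrite /flip; case: x; case: y; rewrite /= ?addn0 ?addn1.
- move=> i /=; rewrite /map_crossing /=; have [-> ->] := pos i; have [l1 l2] := posn i.
  by have [-> ->] := gs l1; have [-> ->] := gs l2.
- by have [e1 e2] := arc_collapse2_ends ben albe; rewrite /= /g !inordK // e1 e2.
- by rewrite inordE ?eqSS ?ltn_eqF //; exact: ltnW.
- have [sA1 sA2] := neS al; have [sB1 sB2] := neS be.
  by apply/and4P; split; case: ifP => _; apply: out_inner => //; apply: ltS.
- have h_out p : (p < n)%N -> ~~ pred2 A1 B1 (inord (h p) : 'I_n.+1.+4) /\ ~~ pred2 A1 B1 (inord (h p).+1 : 'I_n.+1.+4).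
    move=> /(shift2_lt ben albe) pn; have [o1 o2 o3 o4] := shift2_out ben albe p.
    by split; apply: out_inner => //; apply: ltnW.
  split=> [||[[i|]|] // _]; do 2?[by apply: out_inner].
  rewrite /external_crossing /=; have [-> ->] := pos i; have [l1 l2] := posn i.
  by have [-> ->] := h_out _ l1; have [-> ->] := h_out _ l2.
- move=> z; rewrite /g /k inordK; last exact: arc_section2_lt.
  by rewrite arc_section2K inord_val.
- move=> z; have [o1 o2] := arc_section2_out ben albe z; apply: out_inner => //; exact: arc_section2_lt.
- by case: x.
- by case: y.
- move=> l la lb z zo; have zn := ltn_ord z.
  have {}la : l A0 = l A2 by move: la; case: x.
  have {}lb : l B0 = l B2 by move: lb; case: y.
  have z1 : z != al.+1 :> nat by apply: contraNneq zo => e; rewrite /= -(inord_val z) e eqxx.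
  have z2 : z != be.+1 :> nat by apply: contraNneq zo => e; rewrite /= -(inord_val z) e eqxx orbT.
  rewrite -[in LHS](inord_val z) /k /g inordK; last exact: arc_collapse2_lt.
  exact: (arc_section_collapse2 ben albe (l := fun m => l (inord m))).
- exact: painted_even.
Qed.

End Reidemeister2.

Lemma pos_pair c u p q : count_mem c u = 2%N -> p != q -> (p < size u)%N -> (q < size u)%N ->
  nth 0%N u p = c -> nth 0%N u q = c -> (pos1 c u = p /\ pos2 c u = q) \/ (pos1 c u = q /\ pos2 c u = p).
Proof.
move=> cu pq pu qu up uq; have [lt|lt|e] := ltngtP p q; last by rewrite e eqxx in pq.
  by left; apply: posE; rewrite ?lt.
by right; apply: posE; rewrite ?lt.
Qed.

Section Strands.
Variable n : nat.
Definition strand (p : nat) : 'I_n.+1 * 'I_n.+1 := (inord p, inord p.+1).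
(** A strand of the third move occupies the positions [k] and [k.+1]; its side of the triangle is
    the arc [k.+1], and this is the other arc at the crossing in position [k + b]. *)
Definition outer_end (k : nat) (b : bool) : 'I_n.+1 := inord (if b then k.+2 else k).

Lemma strand_flip k (b : bool) : strand (k + b) = flip b (outer_end k b, inord k.+1).
Proof. by case: b; rewrite /strand /flip /= ?addn0 ?addn1. Qed.

Lemma same_unordered_strands k k' (b b' : bool) e :
  same_unordered (e, strand (k + b), strand (k' + b')) (e (+) b (+) b')
    (outer_end k b, inord k.+1) (outer_end k' b', inord k'.+1).
Proof.
rewrite !strand_flip -[X in same_unordered (X, _, _)](_ : e (+) b (+) b' (+) b (+) b' = e).
  exact: same_unordered_flip.
by case: e; case: b; case: b'.
Qed.

End Strands.

Section Reidemeister3.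
Variables (n : nat) (u u' : seq nat) (F : nat -> sign) (tm tb mb kt km kb : nat) (etb emb pi : bool).
Hypotheses (su : size u = n) (uu : perm_eq u u') (u2 : paired u).
Hypothesis ut : uniq [:: tm; tb; mb].
Hypothesis small : [/\ kt.+1 < n, km.+1 < n & kb.+1 < n]%N.
Let far k k' := ((k.+1 < k') || (k'.+1 < k))%N.
Hypothesis apart : [/\ far kt km, far kt kb & far km kb].
Let at_ends v (et em ep : bool) := [/\ nth 0%N v (kt + ~~ et) = tm /\ nth 0%N v (kt + et) = tb,
  nth 0%N v (km + ~~ em) = tm /\ nth 0%N v (km + em) = mb &
  nth 0%N v (kb + ~~ ep) = tb /\ nth 0%N v (kb + ep) = mb].
Hypothesis endsL : at_ends u etb emb pi.
Hypothesis endsR : at_ends u' (~~ etb) (~~ emb) (~~ pi).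
Let outside p := [&& p != kt, p != kt.+1, p != km, p != km.+1, p != kb & p != kb.+1].
Hypothesis same_outside : forall p, outside p -> nth 0%N u' p = nth 0%N u p.
(** The markers of the three crossings after their strands have been directed towards the triangle:
    the sign, corrected by one flip for each strand met backwards. The common negations in the two
    flips at [tm] cancel. *)
Let k1 := F tm (+) etb (+) emb.
Let k2 := F tb (+) etb (+) ~~ pi.
Let k3 := F mb (+) emb (+) pi.
Hypothesis kappas : ~~ ((k1 == k2) && (k2 == k3)).

Let su' : size u' = n. Proof. by rewrite -su (perm_size uu). Qed.
Let u'2 : paired u'. Proof. by rewrite (perm_paired uu). Qed.
Let nm : seq_sub u -> nat := @ssval _ u.
Let nmu : names_of nm u := ssval_names_of u.
Let nmu' : names_of nm u'.
Proof. by case: nmu => inj cod; split=> // c; rewrite -(perm_mem uu). Qed.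

Let lt_b k (b : bool) : (k.+1 < n)%N -> (k + b < n)%N.
Proof. by case: b; rewrite ?addn1 ?addn0 // => /ltnW. Qed.

Let far_ne k k' (b b' : bool) : far k k' -> (k + b)%N != (k' + b')%N.
Proof. by rewrite /far; clear; case: b; case: b'; lia. Qed.

Let mem_at v (et em ep : bool) : size v = n -> at_ends v et em ep -> [/\ tm \in v, tb \in v & mb \in v].
Proof.
move=> sv [[<- <-] _ [_ <-]]; have [l1 l2 l3] := small.
by split; apply: mem_nth; rewrite sv lt_b.
Qed.

Let cross v c (k k' : nat) (b b' : bool) : size v = n -> paired v -> c \in v ->
  (k.+1 < n)%N -> (k'.+1 < n)%N -> far k k' ->
  nth 0%N v (k + b) = c -> nth 0%N v (k' + b') = c ->
  same_unordered (F c, strand n (pos1 c v), strand n (pos2 c v)) (F c (+) b (+) b')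
    (outer_end n k b, inord k.+1) (outer_end n k' b', inord k'.+1).
Proof.
move=> sv v2 cv l l' fr e e'; have cc := pairedP v2 cv.
have := same_unordered_strands n k k' b b' (F c).
have := pos_pair cc (far_ne b b' fr) _ _ e e'; rewrite sv !lt_b // => /(_ isT isT).
by case=> -[-> ->] // /same_unordered_swap.
Qed.

Let crosses v (et em ep : bool) (x1 x2 x3 : seq_sub u) : size v = n -> paired v -> at_ends v et em ep ->
  nm x1 = tm -> nm x2 = tb -> nm x3 = mb ->
  same_crossings3 x1 x2 x3 (inord kt.+1) (inord km.+1) (inord kb.+1)
    (F tm (+) et (+) em) (F tb (+) et (+) ~~ ep) (F mb (+) em (+) ep) (painted_diagram n nm F v)
    (outer_end n kt (~~ et)) (outer_end n kt et) (outer_end n km (~~ em)) (outer_end n km em)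
    (outer_end n kb (~~ ep)) (outer_end n kb ep).
Proof.
move=> sv v2 ends e1 e2 e3; have [c1 c2 c3] := mem_at sv ends.
have [[h1 h2] [h3 h4] [h5 h6]] := ends; have [l1 l2 l3] := small; have [f1 f2 f3] := apart.
split; rewrite /= ?e1 ?e2 ?e3.
- by have := cross sv v2 c1 l1 l2 f1 h1 h3; rewrite !addbN !addNb negbK.
- exact: cross sv v2 c2 l1 l3 f2 h2 h5.
- exact: cross sv v2 c3 l2 l3 f3 h4 h6.
Qed.

Lemma khovanov_reidemeister3 :
  homotopy_equiv (khovanov_complex (paint F u)) (khovanov_complex (paint F u')).
Proof.
apply: homotopy_equiv_trans (painted_cube F su nmu u2) _.
apply: homotopy_equiv_sym; apply: homotopy_equiv_trans (painted_cube F su' nmu' u'2) _; apply: homotopy_equiv_sym.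
have [c1 c2 c3] := mem_at su endsL.
pose x1 : seq_sub u := SeqSub c1; pose x2 : seq_sub u := SeqSub c2; pose x3 : seq_sub u := SeqSub c3.
have [l1 l2 l3] := small; have [f1 f2 f3] := apart.
have sL := crosses su u2 endsL (erefl : nm x1 = tm) (erefl : nm x2 = tb) (erefl : nm x3 = mb).
have := crosses su' u'2 endsR (erefl : nm x1 = tm) (erefl : nm x2 = tb) (erefl : nm x3 = mb).
have -> : F tm (+) ~~ etb (+) ~~ emb = k1 by rewrite /k1; case: (F tm); case: (etb); case: (emb).
have -> : F tb (+) ~~ etb (+) ~~ ~~ pi = k2 by rewrite /k2; case: (F tb); case: (etb); case: (pi).
have -> : F mb (+) ~~ emb (+) ~~ pi = k3 by rewrite /k3; case: (F mb); case: (emb); case: (pi).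
rewrite !negbK => sR.
(* The six positions of the move are filled by its three chords, so every other chord has its ends
   elsewhere and keeps them. *)
have out_pos i : ~~ loc3 x1 x2 x3 i -> [/\ outside (pos1 (nm i) u), outside (pos2 (nm i) u),
    pos1 (nm i) u' = pos1 (nm i) u & pos2 (nm i) u' = pos2 (nm i) u].
  move=> ni; have ci := count_names_of nmu u2 i; have ci' := count_names_of nmu' u'2 i.
  have [lt lts p1 p2] := posP ci.
  have out p : nth 0%N u p = nm i -> outside p.
    have {ni} : [/\ nm i != tm, nm i != tb & nm i != mb] by move: ni; rewrite /loc3 !negb_or => /and3P[].
    have [[h1 h2] [h3 h4] [h5 h6]] := endsL => -[ne1 ne2 ne3] pi'.
    have nb k (b : bool) c c' : nm i != c -> nm i != c' -> nth 0%N u (k + ~~ b) = c -> nth 0%N u (k + b) = c' ->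
        (p != k) && (p != k.+1).
      move=> n1 n2 e1 e2; have no (b0 : bool) : p != (k + b0)%N.
        apply/eqP => pk; move: n1 n2; rewrite -e1 -e2 -pi' pk.
        by case: (b); case: (b0); rewrite /= ?addn0 ?addn1 eqxx.
      by move: (no false) (no true); rewrite addn0 addn1 => -> ->.
    have /andP[o1 o2] := nb _ _ _ _ ne1 ne2 h1 h2; have /andP[o3 o4] := nb _ _ _ _ ne1 ne3 h3 h4.
    by have /andP[o5 o6] := nb _ _ _ _ ne2 ne3 h5 h6; rewrite /outside o1 o2 o3 o4 o5 o6.
  have o1 := out _ p1; have o2 := out _ p2.
  have bnd : (pos1 (nm i) u < pos2 (nm i) u < size u')%N by rewrite lt su' -su.
  have q1 : nth 0%N u' (pos1 (nm i) u) = nm i by rewrite same_outside.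
  have q2 : nth 0%N u' (pos2 (nm i) u) = nm i by rewrite same_outside.
  by have [-> ->] := posE ci' bnd q1 q2.
apply: (reidemeister3_same _ _ _ kappas sL sR).
pose inn : pred 'I_n.+1 := inner3 (inord kt.+1) (inord km.+1) (inord kb.+1).
have inn_out p : (p <= n)%N -> p != kt.+1 -> p != km.+1 -> p != kb.+1 -> ~~ inn (inord p).
  by move=> pn p1 p2 p3; rewrite /inn /inner3 !inordE ?negb_or ?p1 ?p2 //; exact: ltnW.
have eo k b : (k.+1 < n)%N -> [\/ k = kt, k = km | k = kb] -> ~~ inn (outer_end n k b).
  have ar : [/\ k != kt.+1, k != km.+1 & k != kb.+1] /\ [/\ k.+2 != kt.+1, k.+2 != km.+1 & k.+2 != kb.+1] ->
     (k.+1 < n)%N -> ~~ inn (outer_end n k b).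
    by case=> -[? ? ?] [? ? ?] kn; rewrite /outer_end; case: b; apply: inn_out => //; do 2?apply: ltnW.
  move=> kn kE; apply: ar => //.
  clear - kE f1 f2 f3; rewrite /far in f1 f2 f3.
  by case: kE => ->; split; split; lia.
have ext (v : seq nat) : (forall i, ~~ loc3 x1 x2 x3 i -> [/\ outside (pos1 (nm i) v), outside (pos2 (nm i) v),
     (pos1 (nm i) v < n)%N & (pos2 (nm i) v < n)%N]) ->
   external (painted_diagram n nm F v) (loc3 x1 x2 x3) inn.
  move=> H; split=> [||i /H]; try by apply: inn_out => //; clear - l1 l2 l3; lia.
  have op p : outside p -> (p < n)%N -> ~~ inn (inord p) /\ ~~ inn (inord p.+1).
    by rewrite /outside => /and5P[? ? ? ? /andP[? ?]] pn; split; apply: inn_out => //; apply: ltnW.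
  rewrite /external_crossing /= => -[o1 o2 n1 n2].
  by have [-> ->] := op _ o1 n1; have [-> ->] := op _ o2 n2.
have posn i : (pos1 (nm i) u < n)%N /\ (pos2 (nm i) u < n)%N.
  have [lt lts _ _] := posP (count_names_of nmu u2 i).
  by rewrite -su; split=> //; apply: ltn_trans lts.
split.
- by [].
- rewrite /= !inE !inordE ?eqSS ?andbT; try exact: ltnW.
  by clear - f1 f2 f3; rewrite /far in f1 f2 f3; lia.
- apply/hasPn => z; rewrite !inE.
  case/or4P => [/eqP->|/eqP->|/eqP->|/or3P[]/eqP->]; apply: eo => //;
    by [apply: Or31 | apply: Or32 | apply: Or33].
- split; apply: ext => i ni; have [o1 o2 e1 e2] := out_pos i ni; have [q1 q2] := posn i; by rewrite ?e1 ?e2.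
- split=> // [i ni||]; [|exact: painted_even|exact: painted_even].
  by have [_ _ e1 e2] := out_pos i ni; rewrite /= e1 e2.
Qed.

End Reidemeister3.

(** * Gauss words *)

Lemma perm2P (T : eqType) (A B P Q : T) : perm_eq [:: A; B] [:: P; Q] ->
  (A = P /\ B = Q) \/ (A = Q /\ B = P).
Proof.
move=> pAB; have : A \in [:: P; Q] by rewrite -(perm_mem pAB) mem_head.
rewrite !inE => /orP[]/eqP E; [left|right]; split=> //; move: pAB; rewrite E.
  by rewrite perm_cons => /perm_small_eq H; case: (H isT).
by rewrite -[X in perm_eq _ X]/([:: P] ++ [:: Q]) perm_sym perm_catC perm_sym perm_cons => /perm_small_eq H; case: (H isT).
Qed.

Lemma perm3P (T : eqType) (A B C P Q R : T) : perm_eq [:: A; B; C] [:: P; Q; R] ->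
  [\/ A = P /\ ((B = Q /\ C = R) \/ (B = R /\ C = Q)),
      A = Q /\ ((B = P /\ C = R) \/ (B = R /\ C = P)) |
      A = R /\ ((B = P /\ C = Q) \/ (B = Q /\ C = P))].
Proof.
move=> pABC; have : A \in [:: P; Q; R] by rewrite -(perm_mem pABC) mem_head.
rewrite !inE => /or3P[]/eqP E; [apply: Or31|apply: Or32|apply: Or33]; split=> //; apply: perm2P; move: pABC; rewrite E.
- by rewrite perm_cons.
- by rewrite -[X in perm_eq _ X]/([:: P] ++ [:: Q] ++ [:: R]) perm_sym perm_catCA perm_sym perm_cons.
- by rewrite -[X in perm_eq _ X]/([:: P; Q] ++ [:: R]) perm_sym perm_catC perm_sym perm_cons.
Qed.

Definition default_end : nat * (bool * sign) := (0%N, (true, true)).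

(* [phi] tells, from the direction of the arrow of [c], whether the sign of [c] is
   exchanged. The maps [p_r], [p_ra], [i p], [i_a p] are given by the functions
   [false], [true], [negb], [id]. *)
Definition shade (phi : bool -> bool) (w : gauss_word) (c : nat) : sign :=
  let l := nth default_end w (index c (unzip1 w)) in l.2.2 (+) phi l.2.1.

Definition shaded phi w := paint (shade phi w) (unzip1 w).

Lemma first_end_filter (w : gauss_word) c :
  nth default_end w (index c (unzip1 w)) = head default_end [seq l <- w | l.1 == c].
Proof. by elim: w => //= l w IH; case: eqP. Qed.

Lemma shade_filter phi w w' c : [seq l <- w | l.1 == c] = [seq l <- w' | l.1 == c] ->
  shade phi w c = shade phi w' c.
Proof. by rewrite /shade !first_end_filter => ->. Qed.

Lemma filter_chord_notin (w : gauss_word) c : c \notin unzip1 w -> [seq l <- w | l.1 == c] = [::].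
Proof.
move=> cw; apply/eqP; rewrite -[_ == _]negbK -has_filter; apply/hasPn => l lw.
by apply: contraNneq cw => <-; apply: map_f.
Qed.

Lemma unzip1_cat (w1 w2 : gauss_word) : unzip1 (w1 ++ w2) = unzip1 w1 ++ unzip1 w2.
Proof. exact: map_cat. Qed.

Lemma nth_unzip1 (w : gauss_word) p : nth 0%N (unzip1 w) p = (nth default_end w p).1.
Proof.
have [pw|pw] := ltnP p (size w); first by rewrite (nth_map default_end).
by rewrite !nth_default ?size_map.
Qed.

Lemma shaded_renaming phi w w' : paired (unzip1 w) -> renaming w w' ->
  homotopy_equiv (khovanov_complex (shaded phi w)) (khovanov_complex (shaded phi w')).
Proof.
move=> w2 [f fI w'E]; set u := unzip1 w in w2 *.
have u'E : unzip1 w' = map f u by rewrite w'E /unzip1 /u -!map_comp.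
have u'2 : paired (map f u).
  apply/allP => _ /mapP[c cu ->]; rewrite count_map (eq_count (a2 := pred1 c)) ?(pairedP w2) //.
  by move=> d /=; rewrite (inj_eq fI).
pose nm : seq_sub u -> nat := @ssval _ u; pose nm' := f \o nm.
have nmu : names_of nm u := ssval_names_of u.
have nmu' : names_of nm' (map f u).
  case: nmu => inj cod; split; first exact: inj_comp.
  move=> c; apply/mapP/codomP => [[d]|[i ->]].
    by rewrite cod => /codomP[i ->] ->; exists i.
  by exists (nm i); rewrite ?cod ?codom_f.
have shE c : shade phi w' (f c) = shade phi w c.
  rewrite /shade u'E index_map // w'E.
  have [cw|cw] := ltnP (index c u) (size w); first by rewrite (nth_map default_end).
  by rewrite !nth_default ?size_map.
rewrite /shaded u'E; have su' : size (map f u) = size u by rewrite size_map.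
apply: homotopy_equiv_trans (painted_cube _ erefl nmu w2) _.
apply: homotopy_equiv_sym; apply: homotopy_equiv_trans (painted_cube _ su' nmu' u'2) _.
have -> : negatives nm' (shade phi w') = negatives nm (shade phi w).
  by apply: eq_bigr => i _; rewrite shE.
have -> : total_sign nm' (shade phi w') = total_sign nm (shade phi w).
  by apply: eq_bigr => i _; rewrite shE.
apply: cube_same => [|//|//|i]; first exact: painted_even.
rewrite /= /nm' /= shE /pos1 /pos2 index_map // -map_drop index_map //; exact: same_crossing_refl.
Qed.

Lemma shaded_reidemeister1 phi w1 w2 c o s :
  paired (unzip1 (w1 ++ [:: (c, (o, s)); (c, (~~ o, s))] ++ w2)) ->
  homotopy_equiv (khovanov_complex (shaded phi (w1 ++ w2)))
    (khovanov_complex (shaded phi (w1 ++ [:: (c, (o, s)); (c, (~~ o, s))] ++ w2))).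
Proof.
rewrite /shaded; set w' := _ ++ _ ++ _; set w := w1 ++ w2 => p2.
have u'E : unzip1 w' = unzip1 w1 ++ [:: c; c] ++ unzip1 w2 by rewrite !unzip1_cat.
rewrite u'E in p2 *.
have cu : c \notin unzip1 w1 ++ unzip1 w2.
  have c' : c \in unzip1 w1 ++ [:: c; c] ++ unzip1 w2 by rewrite !mem_cat mem_head orbT.
  rewrite -has_pred1 has_count -leqNgt leqn0; have := pairedP p2 c'.
  by rewrite !count_cat /= eqxx; lia.
have -> : paint (shade phi w) (unzip1 w) = paint (shade phi w') (unzip1 w1 ++ unzip1 w2).
  rewrite unzip1_cat; apply: paint_eq => d du; apply: shade_filter; rewrite !filter_cat /=.
  by case: eqP => // cd; rewrite cd du in cu.
exact: khovanov_reidemeister1.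
Qed.

(** In each case the orders on the two strands and the sign of [c] decide which chord plays the
    crossing with marker [true]. *)
Lemma khovanov_reidemeister2_opposite (u1 u2 u3 : seq nat) c d F (anti : bool) :
  let u' := u1 ++ [:: c; d] ++ u2 ++ (if anti then [:: d; c] else [:: c; d]) ++ u3 in
  paired u' -> c != d -> F d = ~~ F c ->
  homotopy_equiv (khovanov_complex (paint F (u1 ++ u2 ++ u3))) (khovanov_complex (paint F u')).
Proof.
move=> /= u'2 cd Fd; have dc : d != c by rewrite eq_sym.
case: anti u'2 => u'2; case Fc: (F c) Fd => Fd.
- exact: (@khovanov_reidemeister2 u1 u2 u3 d c F true false u'2 dc Fd Fc).
- exact: (@khovanov_reidemeister2 u1 u2 u3 c d F false true u'2 cd Fc Fd).
- exact: (@khovanov_reidemeister2 u1 u2 u3 c d F false false u'2 cd Fc Fd).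
- exact: (@khovanov_reidemeister2 u1 u2 u3 d c F true true u'2 dc Fd Fc).
Qed.

(** Both chords are first met on the same strand, so [phi] receives the same direction twice and
    opposite signs stay opposite. *)
Lemma shaded_reidemeister2 phi w1 w2 w3 c d o s B (anti : bool) :
  unzip1 B = (if anti then [:: d; c] else [:: c; d]) ->
  let w' := w1 ++ [:: (c, (o, s)); (d, (o, ~~ s))] ++ w2 ++ B ++ w3 in
  paired (unzip1 w') ->
  homotopy_equiv (khovanov_complex (shaded phi (w1 ++ w2 ++ w3))) (khovanov_complex (shaded phi w')).
Proof.
move=> BE w'; rewrite /shaded => p2.
have u'E : unzip1 w' = unzip1 w1 ++ [:: c; d] ++ unzip1 w2 ++ (if anti then [:: d; c] else [:: c; d]) ++ unzip1 w3.
  by rewrite !unzip1_cat BE.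
have cntB e : count_mem e (if anti then [:: d; c] else [:: c; d]) = ((c == e) + (d == e))%N.
  by case: anti {BE u'E} => /=; lia.
have cnt e : count_mem e (unzip1 w') = ((c == e) * 2 + (d == e) * 2 + count_mem e (unzip1 w1) +
    count_mem e (unzip1 w2) + count_mem e (unzip1 w3))%N.
  by rewrite u'E !count_cat cntB /=; lia.
have c' : c \in unzip1 w' by rewrite u'E !mem_cat !inE eqxx /= orbT.
have d' : d \in unzip1 w' by rewrite u'E !mem_cat !inE eqxx /= !orbT.
have := pairedP p2 c'; have := pairedP p2 d'; rewrite !cnt !eqxx => cd2 cc2.
have cd : c != d by apply/eqP => cd; rewrite cd eqxx in cc2; move: cc2; lia.
have out e : e \in unzip1 w1 ++ unzip1 w2 ++ unzip1 w3 -> (c == e) = false /\ (d == e) = false.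
  rewrite -has_pred1 has_count !count_cat => e0; split; apply/eqP => ee; subst; lia.
have shE : shade phi w' c = s (+) phi o /\ shade phi w' d = ~~ s (+) phi o.
  rewrite /shade !first_end_filter /w' !filter_cat (filter_chord_notin (w := w1) (c := c)) 1?(filter_chord_notin (w := w1) (c := d)) /=.
  - by rewrite !eqxx (negbTE cd).
  - by apply/negP => dw; have := out d; rewrite mem_cat dw eqxx => /(_ isT) [].
  - by apply/negP => dw; have := out c; rewrite mem_cat dw eqxx => /(_ isT) [].
have -> : paint (shade phi (w1 ++ w2 ++ w3)) (unzip1 (w1 ++ w2 ++ w3)) =
    paint (shade phi w') (unzip1 w1 ++ unzip1 w2 ++ unzip1 w3).
  rewrite !unzip1_cat; apply: paint_eq => e eu; apply: shade_filter; rewrite !filter_cat /=.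
  have [-> ->] := out e eu; rewrite (filter_chord_notin (w := B)) // BE.
  by have [h1 h2] := out e eu; case: anti {BE u'E cntB}; rewrite !inE ![e == _]eq_sym h1 h2.
rewrite u'E in p2 *; apply: khovanov_reidemeister2_opposite => //.
by have [-> ->] := shE; rewrite addNb.
Qed.

Section Blocks.
Variables (T : Type) (x0 : T) (w1 w2 w3 w4 : seq T).
Let kA := size w1.
Let kB := (kA + 2 + size w2)%N.
Let kC := (kB + 2 + size w3)%N.

Definition three_blocks A B C := w1 ++ A ++ w2 ++ B ++ w3 ++ C ++ w4.

Lemma nth_cat_at (s t : seq T) (k p : nat) : size s = k -> nth x0 (s ++ t) (k + p) = nth x0 t p.
Proof. by move=> <-; rewrite nth_cat ltnNge leq_addr addKn. Qed.

Lemma nth_three_blocks A B C (b : bool) : size A = 2%N -> size B = 2%N -> size C = 2%N ->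
  [/\ nth x0 (three_blocks A B C) (kA + b) = nth x0 A b,
      nth x0 (three_blocks A B C) (kB + b) = nth x0 B b &
      nth x0 (three_blocks A B C) (kC + b) = nth x0 C b].
Proof.
move=> sA sB sC; have b2 : (b < 2)%N by case: b.
rewrite /three_blocks; split.
- by rewrite nth_cat_at // nth_cat sA b2.
- have -> : w1 ++ A ++ w2 ++ B ++ w3 ++ C ++ w4 = (w1 ++ A ++ w2) ++ B ++ w3 ++ C ++ w4 by rewrite -!catA.
  rewrite nth_cat_at; first by rewrite nth_cat sB b2.
  by rewrite !size_cat sA addnA.
- have -> : w1 ++ A ++ w2 ++ B ++ w3 ++ C ++ w4 = (w1 ++ A ++ w2 ++ B ++ w3) ++ C ++ w4 by rewrite -!catA.
  rewrite nth_cat_at; first by rewrite nth_cat sC b2.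
  by rewrite !size_cat sA sB !addnA.
Qed.

Lemma three_blocks_outside A B C A' B' C' p : size A = 2%N -> size B = 2%N -> size C = 2%N ->
  size A' = 2%N -> size B' = 2%N -> size C' = 2%N ->
  [&& p != kA, p != kA.+1, p != kB, p != kB.+1, p != kC & p != kC.+1] ->
  nth x0 (three_blocks A B C) p = nth x0 (three_blocks A' B' C') p.
Proof.
move=> sA sB sC sA' sB' sC'; rewrite /kC /kB /kA /three_blocks !nth_cat sA sB sC sA' sB' sC'.
move: (size w1) (size w2) (size w3) => a b c H.
case: ifP => // h1; case: ifP => // h2; first by clear - H h1 h2; lia.
case: ifP => // h3; case: ifP => // h4; first by clear - H h1 h2 h3 h4; lia.
case: ifP => // h5; case: ifP => // h6; by clear - H h1 h2 h3 h4 h5 h6; lia.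
Qed.

End Blocks.

Definition rev2 (T : Type) (x0 : T) (X : seq T) : size X = 2%N -> forall b : bool, nth x0 (rev X) b = nth x0 X (~~ b).
Proof. by case: X => [|x [|y []]] // _ []. Qed.

Definition far k k' := ((k.+1 < k') || (k'.+1 < k))%N.
Definition block_at (w w' X : gauss_word) k := forall b : bool,
  nth default_end w (k + b) = nth default_end X b /\ nth default_end w' (k + b) = nth default_end X (~~ b).

(** The strands may occur in any order along the line. The positions are indexed by strand instead
    of by occurrence, so that the six orders need no further case analysis. *)
Lemma r3_blocks w1 w2 w3 w4 A B C P Q R : perm_eq [:: A; B; C] [:: P; Q; R] ->
  size P = 2%N -> size Q = 2%N -> size R = 2%N ->
  let w := three_blocks w1 w2 w3 w4 A B C in
  let w' := three_blocks w1 w2 w3 w4 (rev A) (rev B) (rev C) in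
  exists kP kQ kR, [/\ [/\ block_at w w' P kP, block_at w w' Q kQ & block_at w w' R kR],
    [/\ kP.+1 < size w, kQ.+1 < size w & kR.+1 < size w]%N, [/\ far kP kQ, far kP kR & far kQ kR] &
    forall p, [&& p != kP, p != kP.+1, p != kQ, p != kQ.+1, p != kR & p != kR.+1] ->
      nth default_end w' p = nth default_end w p].
Proof.
move=> pm sP sQ sR w w'.
have [sA sB sC] : [/\ size A = 2%N, size B = 2%N & size C = 2%N].
  by case: (perm3P pm) => -[-> []] [-> ->].
have rA : size (rev A) = 2%N by rewrite size_rev.
have rB : size (rev B) = 2%N by rewrite size_rev.
have rC : size (rev C) = 2%N by rewrite size_rev.
pose kA := size w1; pose kB := (kA + 2 + size w2)%N; pose kC := (kB + 2 + size w3)%N.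
have bA : block_at w w' A kA.
  move=> b; have [-> _ _] := nth_three_blocks default_end w1 w2 w3 w4 b sA sB sC.
  by have [-> _ _] := nth_three_blocks default_end w1 w2 w3 w4 b rA rB rC; rewrite rev2.
have bB : block_at w w' B kB.
  move=> b; have [_ -> _] := nth_three_blocks default_end w1 w2 w3 w4 b sA sB sC.
  by have [_ -> _] := nth_three_blocks default_end w1 w2 w3 w4 b rA rB rC; rewrite rev2.
have bC : block_at w w' C kC.
  move=> b; have [_ _ ->] := nth_three_blocks default_end w1 w2 w3 w4 b sA sB sC.
  by have [_ _ ->] := nth_three_blocks default_end w1 w2 w3 w4 b rA rB rC; rewrite rev2.
have [lA lB lC] : [/\ kA.+1 < size w, kB.+1 < size w & kC.+1 < size w]%N.
  rewrite /w /three_blocks !size_cat sA sB sC /kC /kB /kA; move: (size w1) (size w2) (size w3) (size w4) => a b c d.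
  by clear; split; lia.
have [fAB fAC fBC] : [/\ far kA kB, far kA kC & far kB kC].
  by rewrite /far /kC /kB /kA; move: (size w1) (size w2) (size w3) => a b c; clear; split; lia.
have fs k k' : far k k' -> far k' k by rewrite /far orbC.
have out p : [&& p != kA, p != kA.+1, p != kB, p != kB.+1, p != kC & p != kC.+1] ->
   nth default_end w' p = nth default_end w p.
  by apply: three_blocks_outside.
case: (perm3P pm) => -[EA []] [EB EC]; rewrite EA EB EC in bA bB bC.
- by exists kA, kB, kC.
- by exists kA, kC, kB; split=> [|||p H]; [..|apply: out; clear - H; lia]; split=> //; apply: fs.
- by exists kB, kA, kC; split=> [|||p H]; [..|apply: out; clear - H; lia]; split=> //; apply: fs.
- by exists kC, kA, kB; split=> [|||p H]; [..|apply: out; clear - H; lia]; split=> //; apply: fs.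
- by exists kB, kC, kA; split=> [|||p H]; [..|apply: out; clear - H; lia]; split=> //; apply: fs.
- by exists kC, kB, kA; split=> [|||p H]; [..|apply: out; clear - H; lia]; split=> //; apply: fs.
Qed.

Lemma shade_two phi (w : gauss_word) c s p q o o' : count_mem c (unzip1 w) = 2%N ->
  (p < size w)%N -> (q < size w)%N -> p != q ->
  nth default_end w p = (c, (o, s)) -> nth default_end w q = (c, (o', s)) ->
  shade phi w c = s (+) phi (if (p < q)%N then o else o').
Proof.
move=> cw pw qw pq wp wq; have su : size (unzip1 w) = size w by rewrite size_map.
have := pos_pair cw pq; rewrite su !nth_unzip1 wp wq => /(_ pw qw erefl erefl).
have [lt _ _ _] := posP cw; rewrite /shade -/(pos1 _ _) => -[] [e1 e2]; rewrite e1 e2 in lt *.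
  by rewrite wp lt.
by rewrite wq ltnNge (ltnW lt).
Qed.

Lemma shaded_reidemeister3 phi w1 w2 w3 w4 tm tb mb etm etb emb A B C :
  perm_eq [:: A; B; C]
      [:: r3_top tm tb etm etb; r3_middle tm mb etm emb; r3_bottom tb mb etm etb emb] ->
  let w := w1 ++ A ++ w2 ++ B ++ w3 ++ C ++ w4 in
  let w' := w1 ++ rev A ++ w2 ++ rev B ++ w3 ++ rev C ++ w4 in
  paired (unzip1 w) ->
  homotopy_equiv (khovanov_complex (shaded phi w)) (khovanov_complex (shaded phi w')).
Proof.
move=> pm w w' w2p.
have so b (X Y : nat * (bool * sign)) : size (ordered b [:: X; Y]) = 2%N by case: b.
have [kt [km [kb [[bt bm bb] [lt lm lb] [ftm ftb fmb] out]]]] :=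
  r3_blocks w1 w2 w3 w4 pm (so _ _ _) (so _ _ _) (so _ _ _).
rewrite -[three_blocks _ _ _ _ A B C]/w -[three_blocks _ _ _ _ _ _ _]/w' in bt bm bb lt lm lb out.
pose pi := etm (+) etb (+) emb.
have ord (b : bool) (X Y : nat * (bool * sign)) : nth default_end (ordered b [:: X; Y]) (~~ b) = X /\
    nth default_end (ordered b [:: X; Y]) b = Y by case: b.
have uu : perm_eq w w'.
  by rewrite /w /w'; do 3 (apply: perm_cat => //; apply: perm_cat; first by rewrite perm_sym perm_rev).
have at_b X Y (b : bool) k : block_at w w' (ordered b [:: X; Y]) k ->
    [/\ nth default_end w (k + ~~ b) = X, nth default_end w (k + b) = Y,
      nth default_end w' (k + b) = X & nth default_end w' (k + ~~ b) = Y].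
  move=> H; have [H1 H2] := H b; have [H3 H4] := H (~~ b); have [e1 e2] := ord b X Y.
  by rewrite H1 H2 H3 H4 negbK e1 e2.
have [t1 t2 t3 t4] := at_b _ _ _ _ bt; have [m1 m2 m3 m4] := at_b _ _ _ _ bm; have [b1 b2 b3 b4] := at_b _ _ _ _ bb.
rewrite -/pi in b1 b2 b3 b4.
have lt_b k (b : bool) : (k.+1 < size w)%N -> (k + b < size w)%N by case: b; rewrite ?addn1 ?addn0 // => /ltnW.
have uuu : perm_eq (unzip1 w) (unzip1 w') by apply: perm_map.
have w'2p : paired (unzip1 w') by rewrite (perm_paired uuu).
have sw' : size w' = size w by rewrite (perm_size uu).
have su : size (unzip1 w) = size w by rewrite size_map.
have at_mem p c x : (p < size w)%N -> nth default_end w p = (c, x) -> c \in unzip1 w.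
  by move=> pw e; rewrite -[c]/(c, x).1 -e; apply/map_f/mem_nth.
have ctm := at_mem _ _ _ (lt_b _ _ lt) t1; have ctb := at_mem _ _ _ (lt_b _ _ lt) t2; have cmb := at_mem _ _ _ (lt_b _ _ lm) m2.
have no3 p q r c : [/\ p < size w, q < size w & r < size w]%N -> [/\ p != q, p != r & q != r] ->
   (nth default_end w p).1 = c -> (nth default_end w q).1 = c -> (nth default_end w r).1 = c -> False.
  move=> [pw qw rw] [pq pr qr]; rewrite -!nth_unzip1 -su in pw qw rw * => pc qc rc.
  have cc : count_mem c (unzip1 w) = 2%N by apply: (pairedP w2p); rewrite -pc mem_nth.
  have [hp|hp] := pos_only cc pw pc; have [hq|hq] := pos_only cc qw qc; have [hr|hr] := pos_only cc rw rc;
    move: pq pr qr; by rewrite hp hq hr ?eqxx.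
have fne k k' (b b' : bool) : far k k' -> (k + b)%N != (k' + b')%N by rewrite /far; clear; case: b; case: b'; lia.
have flt k k' (b b' : bool) : far k k' -> (k + b < k' + b')%N = (k < k')%N.
  by rewrite /far; clear; case: b; case: b'; lia.
have neb k (b : bool) : (k + ~~ b != k + b)%N by clear; case: b; lia.
have ut : uniq [:: tm; tb; mb].
  rewrite /= !inE andbT negb_or -andbA; apply/and3P; split; apply/eqP => e.
  - by apply: (no3 (kt + ~~ etb)%N (kt + etb)%N (km + ~~ emb)%N tm); rewrite ?t1 ?t2 ?m1 -?e //; split; rewrite ?lt_b ?neb ?fne.
  - by apply: (no3 (kt + ~~ etb)%N (km + ~~ emb)%N (km + emb)%N tm); rewrite ?t1 ?m2 ?m1 -?e //; split; rewrite ?lt_b ?neb ?fne.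
  - by apply: (no3 (kt + etb)%N (kb + ~~ pi)%N (kb + pi)%N tb); rewrite ?t2 ?b1 ?b2 -?e //; split; rewrite ?lt_b ?neb ?fne.
(* The chord goes from the upper to the lower strand, so its arrow is forward exactly when the upper
   strand comes first. *)
have Ftm : shade phi w tm = etm (+) phi (kt < km)%N.
  rewrite (shade_two phi (pairedP w2p ctm) (lt_b _ _ lt) (lt_b _ _ lm) (fne _ _ _ _ ftm) t1 m1) flt //.
  by case: (kt < km)%N.
have Ftb : shade phi w tb = etb (+) phi (kt < kb)%N.
  rewrite (shade_two phi (pairedP w2p ctb) (lt_b _ _ lt) (lt_b _ _ lb) (fne _ _ _ _ ftb) t2 b1) flt //.
  by case: (kt < kb)%N.
have Fmb : shade phi w mb = emb (+) phi (km < kb)%N.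
  rewrite (shade_two phi (pairedP w2p cmb) (lt_b _ _ lm) (lt_b _ _ lb) (fne _ _ _ _ fmb) m2 b2) flt //.
  by case: (km < kb)%N.
(* Reversing each block does not alter which strand comes first, hence every shade is preserved. *)
have same : {in unzip1 w, shade phi w' =1 shade phi w}.
  have lt_b' k (b : bool) : (k.+1 < size w)%N -> (k + b < size w')%N by rewrite sw'; apply: lt_b.
  have pw' c : c \in unzip1 w -> count_mem c (unzip1 w') = 2%N.
    by rewrite (perm_mem uuu); apply: (pairedP w'2p).
  move=> c cw; have [->|ntm] := eqVneq c tm.
    rewrite Ftm (shade_two phi (pw' _ ctm) (lt_b' _ _ lt) (lt_b' _ _ lm) (fne _ _ _ _ ftm) t3 m3) flt //.
    by case: (kt < km)%N.
  have [->|ntb] := eqVneq c tb.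
    rewrite Ftb (shade_two phi (pw' _ ctb) (lt_b' _ _ lt) (lt_b' _ _ lb) (fne _ _ _ _ ftb) t4 b3) flt //.
    by case: (kt < kb)%N.
  have [->|nmb] := eqVneq c mb.
    rewrite Fmb (shade_two phi (pw' _ cmb) (lt_b' _ _ lm) (lt_b' _ _ lb) (fne _ _ _ _ fmb) m4 b4) flt //.
    by case: (km < kb)%N.
  have none X : X \in [:: A; B; C] -> [seq l <- X | l.1 == c] = [::].
    have none2 b Y Z : c != Y.1 -> c != Z.1 -> [seq l <- ordered b [:: Y; Z] | l.1 == c] = [::].
      by rewrite ![c == _]eq_sym => /negbTE y /negbTE z; case: b; rewrite /= y z.
    by rewrite (perm_mem pm) !inE => /or3P[]/eqP->; apply: none2.
  have [nA nB nC] : [/\ [seq l <- A | l.1 == c] = [::], [seq l <- B | l.1 == c] = [::] & [seq l <- C | l.1 == c] = [::]].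
    by split; apply: none; rewrite !inE eqxx ?orbT.
  by apply: shade_filter; rewrite /w /w' !filter_cat !filter_rev nA nB nC.
rewrite /shaded (paint_eq (u := unzip1 w') (F := shade phi w') (F' := shade phi w)); last first.
  by move=> c cw; apply: same; rewrite (perm_mem uuu).
apply: (@khovanov_reidemeister3 (size w) (unzip1 w) (unzip1 w') (shade phi w) tm tb mb kt km kb etb emb pi) => //.
- by rewrite !nth_unzip1 t1 t2 m1 m2 b1 b2.
- by rewrite !negbK !nth_unzip1 t3 t4 m3 m4 b3 b4.
- by move=> p H; rewrite !nth_unzip1 out.
rewrite Ftm Ftb Fmb.
(* [phi] is applied to the order of two strands along the line, and these orders
   are transitive. *)
have : ~~ [&& kt < km, km < kb & ~~ (kt < kb)]%N && ~~ [&& ~~ (kt < km), ~~ (km < kb) & kt < kb]%N.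
  by clear - ftm ftb fmb; rewrite /far in ftm ftb fmb; lia.
(* After cancellation the three markers are [pi (+) phi (kt < km)], [~~ pi (+) phi (kt < kb)] and
   [pi (+) phi (km < kb)]. They could be equal only if [phi] distinguished the order of top and
   bottom from the two other orders, themselves equal: a cyclic order of the strands. *)
rewrite /pi; case: (kt < km)%N; case: (km < kb)%N; case: (kt < kb)%N => // _;
  case: (etm); case: (etb); case: (emb); case: (phi true); case: (phi false); by [].
Qed.

Lemma shaded_reidemeister phi w w' : reidemeister w w' -> paired (unzip1 w) -> paired (unzip1 w') ->
  homotopy_equiv (khovanov_complex (shaded phi w)) (khovanov_complex (shaded phi w')).
Proof.
case=> {w w'} [w1 w2 c o s|w1 w2 w3 c d s A B pm|w1 w2 w3 c d s A B pm|w1 w2 w3 w4 tm tb mb etm etb emb A B C pm] p p'.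
- exact: shaded_reidemeister1.
- case: (perm2P pm) p' => -[-> ->] p'.
    exact: (@shaded_reidemeister2 phi w1 w2 w3 c d true s (r2_under c d s) false).
  exact: (@shaded_reidemeister2 phi w1 w2 w3 c d false s (r2_over c d s) false).
- case: (perm2P pm) p' => -[-> ->] p'.
    exact: (@shaded_reidemeister2 phi w1 w2 w3 c d true s (rev (r2_under c d s)) true).
  (* When the reversed lower strand comes first it starts with [d], so the two chords exchange their
     roles and [s] is negated. *)
  have := @shaded_reidemeister2 phi w1 w2 w3 d c false (~~ s) (r2_over c d s) true erefl.
  by rewrite /= negbK; apply.
- exact: shaded_reidemeister3 pm p.
Qed.

(** * The four maps on long virtual knots *)

Lemma gd_paired (D : gauss_diagram) : paired (unzip1 D).
Proof. by have /and3P[] := gd_ok D. Qed.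

Lemma renaming_id (A : Type) (w : seq (nat * A)) : renaming w w.
Proof. by exists id => //; rewrite -[LHS]map_id; apply: eq_map => -[]. Qed.

Lemma long_equiv_shaded phi D D' : long_equiv D D' ->
  homotopy_equiv (khovanov_complex (shaded phi D)) (khovanov_complex (shaded phi D')).
Proof.
elim=> {D D'} [D D' [r|r]|D|D D' _|D D' D'' _ + _].
- exact: shaded_renaming (gd_paired D) r.
- exact: shaded_reidemeister r (gd_paired D) (gd_paired D').
- exact: shaded_renaming (gd_paired D) (renaming_id D).
- exact: homotopy_equiv_sym.
- exact: homotopy_equiv_trans.
Qed.

Lemma forget_shaded phi D f : (forall c, f c = gd_sign D c (+) phi (arrow_forward D c)) ->
  [seq (l.1, f l.1) | l <- gd_word D] = shaded phi D.
Proof.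
move=> fE; rewrite /shaded /paint /unzip1 -map_comp; apply/eq_in_map => l lD /=; congr (_, _).
have lw : (index l.1 (unzip1 D) < size D)%N.
  by rewrite -(size_map fst) index_mem map_f.
by rewrite fE /gd_sign /arrow_forward /first_end /shade (set_nth_default default_end).
Qed.

Lemma map_pr_shaded D : cd_word (map_pr D) = shaded (fun=> false) D.
Proof. by apply: forget_shaded => c; rewrite addbF. Qed.

Lemma map_pra_shaded D : cd_word (map_pra D) = shaded (fun=> true) D.
Proof.
rewrite -(forget_shaded (f := fun c => ~~ gd_sign D c)); last by move=> c; rewrite addbT.
by rewrite /map_pra /tau1 /= -map_comp.
Qed.

Lemma map_ip_shaded D : cd_word ((map_i \o map_p) D) = shaded negb D.
Proof.
rewrite -(forget_shaded (f := fun c => gd_sign D c == arrow_forward D c)); last first.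
  by move=> c; case: (gd_sign D c); case: (arrow_forward D c).
rewrite /map_i /map_p /= -map_comp; apply: eq_map => l /=; congr (_, _).
by case: (gd_sign D _); case: (arrow_forward D _).
Qed.

Lemma map_iap_shaded D : cd_word ((map_ia \o map_p) D) = shaded id D.
Proof.
rewrite -(forget_shaded (f := fun c => ~~ (gd_sign D c == arrow_forward D c))); last first.
  by move=> c; case: (gd_sign D c); case: (arrow_forward D c).
rewrite /map_ia /tau1 /map_i /map_p /= -!map_comp; apply: eq_map => l /=; congr (_, _).
by case: (gd_sign D _); case: (arrow_forward D _).
Qed.

Lemma long_equiv_KH_iso phi (F : gauss_diagram -> signed_diagram) D D' :
  (forall D0, cd_word (F D0) = shaded phi D0) -> long_equiv D D' -> KH_iso (F D) (F D').
Proof.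
by move=> FE DD i j; rewrite /KH !FE; apply/khovanov_iso/long_equiv_shaded.
Qed.

Lemma renaming_decorations (A : Type) (w w' : seq (nat * A)) : renaming w w' -> unzip2 w = unzip2 w'.
Proof. by case=> f _ ->; rewrite /unzip2 -map_comp. Qed.

Fact kink_ok (o : bool) (s : sign) : gauss_ok [:: (0%N, (o, s)); (0%N, (~~ o, s))].
Proof. by case: o; case: s. Qed.
Definition kink o s := GaussDiagram (kink_ok o s).

(** A single chord starting on the branch [o] exhibits the value at [o], and a renaming keeps the
    decorations in order. *)
Lemma shaded_distinct phi psi (F G : gauss_diagram -> signed_diagram) o :
  (forall D, cd_word (F D) = shaded phi D) -> (forall D, cd_word (G D) = shaded psi D) ->
  phi o != psi o -> ~ same_map F G.
Proof.
move=> FE GE pp /(_ (kink o true)) /renaming_decorations; rewrite FE GE => -[/eqP].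
by move: pp; rewrite /shade /=; case: (phi o); case: (psi o).
Qed.

Fact linked_ok (b : bool) : gauss_ok [:: (0, (true, true)); (1, (b, true)); (0, (false, true)); (1, (~~ b, true))]%N.
Proof. by case: b. Qed.
(* The chords [0] and [1] are linked and positive; the arrow of [1] is reversed when [b] is [false]. *)
Definition linked b := GaussDiagram (linked_ok b).

(** * Two diagrams with the same signs and different homologies *)

Section Example.
Let w (s : sign) : seq (nat * sign) := [:: (0, true); (1, s); (0, true); (1, s)]%N.

Lemma shaded_linked b : shaded negb (linked b) = w b.
Proof. by case: b. Qed.

Lemma w_two_ended s : two_ended (w s). Proof. by []. Qed.

Let parity : {ffun 'I_5 -> bool} := [ffun a : 'I_5 => odd a].
Let negative : state (w true) := [ffun=> false].

Lemma w_csign (c : chord (w true)) : csign c.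
Proof.
rewrite /csign; have := ssvalP c; rewrite /= !inE.
by case/or4P => /eqP ->.
Qed.

(** At a positive chord the negative marker glues entering to entering and leaving to leaving arcs;
    the ends of each chord of [0101] have positions of equal parity, and the base point glues the
    arcs 0 and 4. *)
Lemma negative_parity x y : glued negative x y -> parity x = parity y.
Proof.
rewrite !ffunE; case/orP => [/andP[/eqP-> /eqP->] //|].
case/existsP => c /existsP[k /existsP[l /and4P[kl /eqP ck /eqP cl]]].
rewrite ffunE w_csign /=.
have kl2 : odd k = odd l.
  move: kl ck cl; rewrite -val_eqE /=; move: (ssval c) => m.
  by case: k => -[|[|[|[|]]]] //= _; case: l => -[|[|[|[|]]]] //= _ _ <-.
by case/orP => /andP[/eqP-> /eqP->] //=; rewrite kl2.
Qed.

Lemma top_ok : [forall x, forall y, same_circle negative x y ==>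
  ([ffun=> true] x == [ffun=> true] y :> bool)].
Proof. by apply/forallP => x; apply/forallP => y; rewrite !ffunE eqxx implybT. Qed.

Let top : enhanced_state (w true) := exist (fun S : state (w true) * {ffun Defs.arc (w true) -> bool} =>
  [forall x, forall y, same_circle S.1 x y ==> (S.2 x == S.2 y)]) (negative, [ffun=> true]) top_ok.

(* The circles of [negative] do not mix arcs of different parities, so that changing
   a marker to reach [top] splits a circle; but no coproduct contains [1 (x) 1]. *)
Lemma top_not_hit c S : incident_at c S top = false.
Proof.
apply/negP => /and4P[_ _ _].
have -> : same_circle (markers top) (arc_in c) (arc_out c) = false.
  apply/negP; rewrite (same_circle_eqv (w_two_ended true)) => /eqvP/(_ parity) H.
  have : parity (arc_in c) = parity (arc_out c).
    by apply: H; apply/(compat_glued (w_two_ended true)); apply: negative_parity.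
  have : (index (ssval c) (unzip1 (w true)) < 4)%N by have := ssvalP c; rewrite -index_mem.
  rewrite !ffunE /arc_in /arc_out => lt4; rewrite (inordK (leqW lt4)) (inordK (lt4 : _.+1 < 5)%N) /=.
  by case: (odd _).
by case: (same_circle _ _ _) => //; rewrite /labels /= !ffunE; case: (labels S _).
Qed.

Lemma top_not_left c T : incident_at c top T = false.
Proof. by rewrite /incident_at /markers /= ffunE. Qed.

(** Both words have two chords, so at most two negative markers; the negative chord of [w false]
    lowers all homological degrees by at least one. *)
Lemma w_hdeg_lt (T : enhanced_state (w false)) : hdeg T < hdeg top.
Proof.
rewrite !hdegE [X in _ < _ - X]big1 ?subr0; last by move=> c _; rewrite w_csign.
have le_negs : (negs (markers T) <= negs negative)%N.
  by apply: leq_sum => c _; rewrite ffunE; case: (markers T c).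
have one : 1%N \in unzip1 (w false) by [].
rewrite (bigD1 (SeqSub one)) //= -(big_morph Posz PoszD erefl).
set m := (\sum_(c | _) _)%N.
have -> : negs (markers top) = negs negative by [].
move: le_negs; move: (negs (markers T)) (negs negative) m => p q m; clear; lia.
Qed.

Lemma linked_not_iso : ~ forall i j, lmod_iso (KH_word (w true) i j) (KH_word (w false) i j).
Proof.
move=> /(_ (hdeg top) (qdeg top)) [f [g fK gK]].
have zero (v : subvs_of (lker (linfun (@diff (w false))) :&: chains_deg (w false) (hdeg top) (qdeg top))%VS) : v = 0.
  apply/val_inj; rewrite /=; have := subvsP v; rewrite memv_cap => /andP[_].
  move/(chains_deg_homogeneous (w := w false)) => H; apply/ffunP => T; rewrite ffunE.
  apply/eqP; apply: contraTT (w_hdeg_lt T) => /H[/= -> _].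
  by rewrite Order.POrderTheory.ltxx.
have sub (x y : KH_word (w false) (hdeg top) (qdeg top)) : x = y.
  rewrite -[x]reprK -[y]reprK; congr (\pi_(_)%qT _); by rewrite [LHS]zero [RHS]zero.
(* [top] is a cycle because it has no positive marker left to change. *)
have tZ : basis_chain top \in (lker (linfun (@diff (w true))) :&: chains_deg (w true) (hdeg top) (qdeg top))%VS.
  rewrite memv_cap memv_ker; apply/andP; split.
    rewrite lfunE /=; apply/eqP/ffunP => T; rewrite !ffunE big1 // => S _.
    rewrite big1 // => c _; rewrite ffunE; have [->|_] := eqVneq S top; last by rewrite mulr0.
    by rewrite top_not_left mul0r.
  apply/(chains_deg_homogeneous (w := w true)) => S /=; rewrite ffunE.
  by have [->|_] := eqVneq S top; rewrite ?eqxx.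
pose Z := (lker (linfun (@diff (w true))) :&: chains_deg (w true) (hdeg top) (qdeg top))%VS.
pose B := (linfun (@diff (w true)) @: chains_deg (w true) (hdeg top - 1) (qdeg top))%VS.
pose U := (linfun (vsval : subvs_of Z -> chains (w true)) @^-1: B)%VS.
(* An isomorphism with the zero space would make [top] a boundary, yet every boundary has
   coefficient 0 at [top]. *)
have /vquot_piE : \pi_(vquot U)%qT (Subvs tZ) = \pi_(vquot U)%qT 0 by apply: (can_inj fK); apply: sub.
rewrite subr0 -memv_preim lfunE /= => /memv_imgP[v _ /ffunP/(_ top)].
rewrite lfunE /= !ffunE eqxx big1 // => S _; rewrite big1 // => c _.
by rewrite top_not_hit mul0r.
Qed.

End Example.

Theorem theorem4p4 :
  [/\ same_map (map_i \o map_p) (map_ia \o map_pa) /\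
      same_map (map_ia \o map_p) (map_i \o map_pa),
  ~ same_map map_pr map_pra /\
  ~ same_map map_pr (map_i \o map_p) /\
  ~ same_map map_pr (map_ia \o map_p) /\
  ~ same_map map_pra (map_i \o map_p) /\
  ~ same_map map_pra (map_ia \o map_p) /\
  ~ same_map (map_i \o map_p) (map_ia \o map_p),
  forall D D' : gauss_diagram, long_equiv D D' -> KH4_iso D D',
  forall D1 D2 : gauss_diagram, KH4_iso D1 D2 -> KH_gauss_iso D1 D2 &
  exists D1 D2 : gauss_diagram,
    KH_gauss_iso D1 D2 /\ ~ KH4_iso D1 D2].
Proof.
split.
- have same (P Q : signed_diagram) : cd_word P = cd_word Q -> renaming P Q by move=> ->; apply: renaming_id.
  by split=> D; apply: same; rewrite /map_ia /map_pa /tau0 /tau1 /map_i /= -!map_comp; apply: eq_map => l /=;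
    case: ifP.
- do 5?split.
  + exact: (shaded_distinct (o := true) map_pr_shaded map_pra_shaded).
  + exact: (shaded_distinct (o := false) map_pr_shaded map_ip_shaded).
  + exact: (shaded_distinct (o := true) map_pr_shaded map_iap_shaded).
  + exact: (shaded_distinct (o := true) map_pra_shaded map_ip_shaded).
  + exact: (shaded_distinct (o := false) map_pra_shaded map_iap_shaded).
  + exact: (shaded_distinct (o := true) map_ip_shaded map_iap_shaded).
- move=> D D' DD; split.
  + exact: long_equiv_KH_iso map_pr_shaded DD.
  + exact: long_equiv_KH_iso map_pra_shaded DD.
  + exact: long_equiv_KH_iso map_ip_shaded DD.
  + exact: long_equiv_KH_iso map_iap_shaded DD.
(* The first entry of the tuple is the Khovanov homology itself, as [map_pr] keeps the signs. *)
- move=> D1 D2 [iso _ _ _] i j.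
  by rewrite (KH_arrows (P := map_pr D1)) // (KH_arrows (P := map_pr D2)).
(* Reversing an arrow does not change the signed word, so the two Khovanov homologies are the same
   module. *)
- exists (linked true), (linked false); split; first by move=> i j; apply: lmod_iso_refl.
  case=> _ _ iso _; apply: linked_not_iso => i j.
  by have := iso i j; rewrite /KH !map_ip_shaded !shaded_linked.
Qed.
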